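(* Let $n\geq 1$, let $p$ be a prime coprime to $n$, and let $r_1,\dots,r_{n-1}\ge0$ be integers with $r_1+\cdots+r_{n-1}\le p$. Let $v(z)=\prod_{i=0}^{n-1}(z-(\overline{r_1}+\cdots+\overline{r_i}))\in\mathbb K[z]$ and $r_0=p-(r_1+\cdots+r_{n-1})$. Let $k$ be the number of non-zero elements among $r_0,\dots,r_{n-1}$. Then $t(v)$ is Morita equivalent to the no-cycle algebra $N_{\mathbb K}(k)$. Moreover, if $k=n$, there is a $\mathbb Z$-equivalence of categories $$t(v)\text{-grmod}\longrightarrow N_{\mathbb K}(n)\text{-grmod}.$$
   Context: $\mathbb K$ is an algebraically closed field of characteristic $p$ with prime subfield $\mathbb F$; $\overline m\in\mathbb F$ is the reduction of $m\in\mathbb Z$. For $v\in\mathbb K[z]$ of degree $n$ with all roots in $\mathbb F$, $T(v)$ is the associative $\mathbb K$-algebra with generators $a,b,h$ and relations $ha=a(h+1)$, $hb=b(h-1)$, $ba=v(h)$, $ab=v(h-1)$, and $t(v)=T(v)/(a^p,b^p,h^p-h)$. Let $\overline c\in\mathbb F$ be the inverse of $\overline n$. Objects of $t(v)$-grmod are finitely generated $t(v)$-modules with a decomposition $M=\bigoplus_{j\in\mathbb Z}M_j$ such that $aM_j\subseteq M_{j+n}$, $bM_j\subseteq M_{j-n}$ and $h$ acts on $M_j$ as the scalar $\overline j\,\overline c$; morphisms are degree-preserving homomorphisms. Shifts: $(M[i])_j=M_{j-pi}$. For $k\ge1$ let $Q$ be the quiver with vertices $i\in\mathbb Z/k\mathbb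 Z$ and $2k$ arrows $a_i:i\to i+1$, $b_i:i+1\to i$ ($i\in\mathbb Z/k\mathbb Z$). The no-cycle algebra $N_{\mathbb K}(k)$ is the quotient of the path algebra $\mathbb KQ$ by the two-sided ideal generated by all non-trivial paths which start and end at the same vertex. It is $\mathbb Z$-graded: vertex idempotents have degree $0$, $a_i$ degree $-1$, $b_i$ degree $1$. $N_{\mathbb K}(k)$-grmod is the category of finitely generated $\mathbb Z$-graded modules with degree-preserving maps and shifts $(M[i])_j=M_{j-i}$. (Paths are composed like functions and modules are left modules.) A $\mathbb Z$-category is an abelian category with exact shift functors $[i]$, $i\in\mathbb Z$, and natural isomorphisms $[i]\circ[j]\to[i+j]$. A $\mathbb Z$-functor is a functor $\Phi$ with $\Phi\circ[i]$ naturally isomorphic to $[i]\circ\Phi$ for all $i$. A $\mathbb Z$-equivalence is a $\mathbb Z$-functor having a quasi-inverse that is also a $\mathbb Z$-functor. *)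

(* Defs.v *)
From HB Require Import structures.
From mathcomp Require Import all_boot all_order all_algebra.
From mathcomp Require Import finmap boolp.
From mathcomp.multinomials Require Import monalg.

Set Implicit Arguments.
Unset Strict Implicit.
Unset Printing Implicit Defensive.

Import GRing.Theory.

Local Open Scope ring_scope.
Local Open Scope quotient_scope.

(* Unital associative K-algebras, as rings A with a ring morphism from K to the
   centre of A.  Unlike in [algType], 1 = 0 is allowed: a quotient by an
   arbitrary two-sided ideal need not be nonzero. *)
HB.mixin Record isPzAlgebra (K : pzRingType) A of GRing.PzRing A := {
  algc : K -> A;
  algc1 : algc 1 = 1;
  algcB : {morph algc : a b / a - b};
  algcM : {morph algc : a b / a * b};
  algc_central : forall c x, algc c * x = x * algc c
}.

#[short(type="pzAlgType")]
HB.structure Definition PzAlgebra (K : pzRingType) :=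
  {A of GRing.PzRing A & isPzAlgebra K A}.

Arguments algc {K s}.

Section TwoSidedQuotient.
Variables (K : pzRingType) (A : pzAlgType K) (S : A -> Prop).

Definition two_sided_ideal (I : A -> Prop) : Prop :=
  [/\ I 0, forall x y, I x -> I y -> I (x + y),
      forall a x, I x -> I (a * x) & forall a x, I x -> I (x * a)].

Definition ideal_gen (x : A) : Prop :=
  forall I : A -> Prop, two_sided_ideal I -> (forall s, S s -> I s) -> I x.

Definition ideal_pred : {pred A} := fun x => `[< ideal_gen x >].

Lemma ideal_gen_ideal : two_sided_ideal ideal_gen.
Proof.
split.
- by move=> I [].
- move=> x y Ix Iy I hI SI; have [_ ID _ _] := hI.
  by apply: ID; [exact: Ix|exact: Iy].
- by move=> a x Ix I hI SI; have [_ _ Il _] := hI; apply: Il; exact: Ix.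
- by move=> a x Ix I hI SI; have [_ _ _ Ir] := hI; apply: Ir; exact: Ix.
Qed.

Lemma ideal_predE x : (x \in ideal_pred) = `[< ideal_gen x >]. Proof. by []. Qed.

Lemma ideal_predMl a x : x \in ideal_pred -> a * x \in ideal_pred.
Proof.
case: ideal_gen_ideal => _ _ Il _.
by rewrite !ideal_predE => /asboolP Ix; apply/asboolP; apply: Il.
Qed.

Lemma ideal_predMr a x : x \in ideal_pred -> x * a \in ideal_pred.
Proof.
case: ideal_gen_ideal => _ _ _ Ir.
by rewrite !ideal_predE => /asboolP Ix; apply/asboolP; apply: Ir.
Qed.

Lemma ideal_pred_zmod : zmod_closed ideal_pred.
Proof.
case: ideal_gen_ideal => I0 ID _ _; split; first exact/asboolP.
move=> x y; rewrite -[- y]mulN1r => Ix Iy.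
have := ideal_predMl (-1) Iy; rewrite !ideal_predE => /asboolP Iy'.
by move: Ix => /asboolP Ix; apply/asboolP; apply: ID.
Qed.

HB.instance Definition _ := GRing.isZmodClosed.Build A ideal_pred ideal_pred_zmod.

Definition alg_quot : Type := Quotient.quot ideal_pred.

HB.instance Definition _ := GRing.Zmodule.on alg_quot.

Definition quot_pi (x : A) : alg_quot := \pi_(Quotient.quot ideal_pred) x.

Local Notation rep := (fun x : alg_quot => repr (x : Quotient.quot ideal_pred)).

Lemma quot_pi_rep x : quot_pi (rep x) = x.
Proof. exact: reprK. Qed.

Lemma quot_piE x y : quot_pi x = quot_pi y <-> x - y \in ideal_pred.
Proof. by rewrite Quotient.idealrBE; split=> [/eqP|/eqP]. Qed.

Lemma quot_piD x y : quot_pi (x + y) = quot_pi x + quot_pi y.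
Proof. exact: raddfD. Qed.

Definition qmul (x y : alg_quot) : alg_quot := quot_pi (rep x * rep y).

Lemma quot_piM x y : quot_pi (x * y) = qmul (quot_pi x) (quot_pi y).
Proof.
apply/quot_piE; set x' := rep _; set y' := rep _.
have Ix : x - x' \in ideal_pred by apply/quot_piE; rewrite quot_pi_rep.
have Iy : y - y' \in ideal_pred by apply/quot_piE; rewrite quot_pi_rep.
have -> : x * y - x' * y' = (x - x') * y + x' * (y - y').
  by rewrite mulrBl mulrBr addrA subrK.
by apply: rpredD; [exact: ideal_predMr|exact: ideal_predMl].
Qed.

Lemma qmulA : associative qmul.
Proof.
move=> x y z; rewrite -[x]quot_pi_rep -[y]quot_pi_rep -[z]quot_pi_rep.
by rewrite -!quot_piM mulrA.
Qed.

Lemma qmul1 : left_id (quot_pi 1) qmul.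
Proof. by move=> x; rewrite -[x]quot_pi_rep -quot_piM mul1r. Qed.

Lemma qmulr1 : right_id (quot_pi 1) qmul.
Proof. by move=> x; rewrite -[x]quot_pi_rep -quot_piM mulr1. Qed.

Lemma qmulDl : left_distributive qmul +%R.
Proof.
move=> x y z; rewrite -[x]quot_pi_rep -[y]quot_pi_rep -[z]quot_pi_rep.
by rewrite -quot_piD -!quot_piM mulrDl quot_piD.
Qed.

Lemma qmulDr : right_distributive qmul +%R.
Proof.
move=> x y z; rewrite -[x]quot_pi_rep -[y]quot_pi_rep -[z]quot_pi_rep.
by rewrite -quot_piD -!quot_piM mulrDr quot_piD.
Qed.

HB.instance Definition _ := GRing.Zmodule_isPzRing.Build alg_quot
  qmulA qmul1 qmulr1 qmulDl qmulDr.

Definition qalgc (c : K) : alg_quot := quot_pi (algc c).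

Lemma qalgc1 : qalgc 1 = 1.
Proof. by rewrite /qalgc algc1. Qed.

Lemma qalgcB : {morph qalgc : a b / a - b}.
Proof. by move=> a b; rewrite /qalgc algcB; exact: raddfB. Qed.

Lemma qalgcM : {morph qalgc : a b / a * b}.
Proof. by move=> a b; rewrite /qalgc algcM quot_piM. Qed.

Lemma qalgc_central c x : qalgc c * x = x * qalgc c.
Proof.
by rewrite -[x]quot_pi_rep -[LHS]quot_piM -[RHS]quot_piM algc_central.
Qed.

HB.instance Definition _ := isPzAlgebra.Build K alg_quot
  qalgc1 qalgcB qalgcM qalgc_central.

End TwoSidedQuotient.

Section FreeAlgebra.
Variables (K : comNzRingType) (X : choiceType).

Definition free_alg : Type := {malg K[{fmonom X}]}.

HB.instance Definition _ := GRing.Lalgebra.on free_alg.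

Lemma free_alg_scaleAr (c : K) (x y : free_alg) : c *: (x * y) = x * (c *: y).
Proof.
have cC (z : {malg K[{fmonom X}]}) : c%:MP * z = z * c%:MP.
  rewrite !malgM_def fgmulUg fgmulgU; apply: eq_bigr => k _.
  by rewrite mul1m mulm1 mulrC.
suff h (u w : {malg K[{fmonom X}]}) : c *: (u * w) = u * (c *: w) by exact: h.
by rewrite -!mul_malgC mulrA cC mulrA.
Qed.

HB.instance Definition _ := GRing.Lalgebra_isAlgebra.Build K free_alg
  free_alg_scaleAr.

Lemma free_algc_central c (x : free_alg) : c%:A * x = x * c%:A.
Proof. by rewrite mulr_algl -scalerAr mulr1. Qed.

HB.instance Definition _ := isPzAlgebra.Build K free_alg
  (rmorph1 (in_alg free_alg)) (rmorphB (in_alg free_alg))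
  (rmorphM (in_alg free_alg)) free_algc_central.

Definition free_gen (x : X) : free_alg := << fmu x >>.

End FreeAlgebra.

Record quiver := Quiver {
  qvert : finType;
  qarr : choiceType;
  qsrc : qarr -> qvert;
  qtgt : qarr -> qvert
}.

Section PathAlgebra.
Variable Q : quiver.
Implicit Types (v : qvert Q) (s : seq (qarr Q)).

(* Paths are composed like functions: the path e1 e2 ... el, which runs through
   el first, is the pair (tgt e1, [:: e1; e2; ...; el]); the trivial path at v
   is (v, [::]). *)
Fixpoint is_path v s : bool :=
  if s is e :: s' then (qtgt e == v) && is_path (qsrc e) s' else true.

Fixpoint path_start v s : qvert Q :=
  if s is e :: s' then path_start (qsrc e) s' else v.

Lemma is_path_cat v s t :
  is_path v (s ++ t) = is_path v s && is_path (path_start v s) t.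
Proof. by elim: s v => //= e s IHs v; rewrite IHs andbA. Qed.

Lemma path_start_cat v s t :
  path_start v (s ++ t) = path_start (path_start v s) t.
Proof. by elim: s v => //=. Qed.

Definition qpath : Type := {w : qvert Q * seq (qarr Q) | is_path w.1 w.2}.
HB.instance Definition _ := Choice.on qpath.
HB.instance Definition _ := SubType.on qpath.

Definition ptgt (w : qpath) : qvert Q := (val w).1.
Definition parrows (w : qpath) : seq (qarr Q) := (val w).2.
Definition psrc (w : qpath) : qvert Q := path_start (ptgt w) (parrows w).

Definition ptriv v : qpath := Sub (v, [::]) isT.

Definition pcomp (u w : qpath) : option qpath :=
  if psrc u == ptgt w then insub (ptgt u, parrows u ++ parrows w) else None.

Variant pcomp_spec (u w : qpath) : option qpath -> Type :=
| PcompSome x of psrc u = ptgt w & ptgt x = ptgt u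
    & parrows x = parrows u ++ parrows w : pcomp_spec u w (Some x)
| PcompNone of psrc u != ptgt w : pcomp_spec u w None.

Lemma pcompP u w : pcomp_spec u w (pcomp u w).
Proof.
rewrite /pcomp; case: eqP => [e|/eqP]; last exact: PcompNone.
case: insubP => [x _ ex|]; first by apply: PcompSome; rewrite // /ptgt /parrows ex.
by rewrite /= is_path_cat (valP u) /= -/(psrc u) e (valP w).
Qed.

Lemma qpathP (u w : qpath) : ptgt u = ptgt w -> parrows u = parrows w -> u = w.
Proof.
rewrite /ptgt /parrows => e1 e2; apply: val_inj.
by case: (val u) (val w) e1 e2 => ? ? [? ?] /= -> ->.
Qed.

Lemma pcomp1p w : pcomp (ptriv (ptgt w)) w = Some w.
Proof.
case: pcompP => [x _ e1 e2|]; last by rewrite eqxx.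
by congr Some; apply: qpathP.
Qed.

Lemma pcompp1 w : pcomp w (ptriv (psrc w)) = Some w.
Proof.
case: pcompP => [x _ e1 e2|]; last by rewrite eqxx.
by congr Some; apply: qpathP; rewrite // e2 cats0.
Qed.

Lemma pcompE u w : psrc u = ptgt w ->
  exists2 x, pcomp u w = Some x &
    [/\ ptgt x = ptgt u, parrows x = parrows u ++ parrows w & psrc x = psrc w].
Proof.
case: pcompP => [x e e1 e2 _|/eqP//]; exists x => //; split=> //.
by rewrite /psrc e1 e2 path_start_cat -/(psrc u) e.
Qed.

Lemma pcompN u w : psrc u <> ptgt w -> pcomp u w = None.
Proof. by case: pcompP. Qed.

Lemma pcompA u w x :
  obind (pcomp u) (pcomp w x) = obind (pcomp^~ x) (pcomp u w).
Proof.
case: (eqVneq (psrc u) (ptgt w)) => [euw|/eqP nuw]; last first.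
  rewrite (pcompN nuw); case: pcompP => //= y _ e _.
  by apply: pcompN; rewrite e.
case: (eqVneq (psrc w) (ptgt x)) => [ewx|/eqP nwx]; last first.
  have [y -> [_ _ e]] := pcompE euw.
  by rewrite (pcompN nwx) /= pcompN // e.
have [y -> [y1 y2 y3]] := pcompE ewx; have [z -> [z1 z2 z3]] := pcompE euw.
have [|t /= -> [t1 t2 _]] := @pcompE u y; first by rewrite y1.
have [|t' -> [t1' t2' _]] := @pcompE z x; first by rewrite z3.
by congr Some; apply: qpathP; rewrite ?t1 ?t1' // t2 t2' y2 z2 catA.
Qed.

Variable K : comNzRingType.

Definition path_alg : Type := {malg K[qpath]}.
HB.instance Definition _ := GRing.Lmodule.on path_alg.

Implicit Types f g : path_alg.

Definition path_elt (w : qpath) : path_alg := << w >>.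

Definition bmul (u w : qpath) : path_alg := oapp path_elt 0 (pcomp u w).

Definition pmul f g : path_alg :=
  \sum_(u <- msupp f) \sum_(w <- msupp g) (f@_u * g@_w) *: bmul u w.
Arguments pmul : simpl never.

Definition pone : path_alg := \sum_v path_elt (ptriv v).

Lemma pmulw (d1 d2 : {fset qpath}) f g :
  (msupp f `<=` d1)%fset -> (msupp g `<=` d2)%fset ->
  pmul f g = \sum_(u <- d1) \sum_(w <- d2) (f@_u * g@_w) *: bmul u w.
Proof.
move=> le1 le2; rewrite /pmul (big_fset_incl _ le1) /=.
  apply/eq_bigr=> u _; apply/big_fset_incl => // w _ /mcoeff_outdom ->.
  by rewrite mulr0 scale0r.
move=> u _ /mcoeff_outdom fu.
by rewrite big1 => // w _; rewrite fu mul0r scale0r.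
Qed.

Lemma pmulDl : left_distributive pmul +%R.
Proof.
move=> f1 f2 g; set D := (msupp f1 `|` msupp f2)%fset.
rewrite (@pmulw D (msupp g)) ?msuppD_le //.
rewrite (@pmulw D (msupp g) f1) ?fsubsetUl // (@pmulw D (msupp g) f2) ?fsubsetUr //.
rewrite -big_split /=; apply: eq_bigr => u _.
rewrite -big_split /=; apply: eq_bigr => w _.
by rewrite mcoeffD mulrDl scalerDl.
Qed.

Lemma pmulDr : right_distributive pmul +%R.
Proof.
move=> g f1 f2; set D := (msupp f1 `|` msupp f2)%fset.
rewrite (@pmulw (msupp g) D) ?msuppD_le //.
rewrite (@pmulw (msupp g) D g f1) ?fsubsetUl // (@pmulw (msupp g) D g f2) ?fsubsetUr //.
rewrite -big_split /=; apply: eq_bigr => u _.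
rewrite -big_split /=; apply: eq_bigr => w _.
by rewrite mcoeffD mulrDr scalerDl.
Qed.

Lemma pmul0f f : pmul 0 f = 0.
Proof. by rewrite /pmul msupp0 big_seq_fset0. Qed.

Lemma pmulf0 f : pmul f 0 = 0.
Proof. by rewrite /pmul big1 // => u _; rewrite msupp0 big_seq_fset0. Qed.

Lemma pmulZl c f g : pmul (c *: f) g = c *: pmul f g.
Proof.
rewrite (@pmulw (msupp f) (msupp g)) ?msuppZ_le // scaler_sumr.
apply: eq_bigr => u _; rewrite scaler_sumr; apply: eq_bigr => w _.
by rewrite mcoeffZ scalerA mulrA.
Qed.

Lemma pmulZr c f g : pmul f (c *: g) = c *: pmul f g.
Proof.
rewrite (@pmulw (msupp f) (msupp g)) ?msuppZ_le // scaler_sumr.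
apply: eq_bigr => u _; rewrite scaler_sumr; apply: eq_bigr => w _.
by rewrite mcoeffZ scalerA mulrCA.
Qed.

Lemma pmul_sumr I (r : seq I) (F : I -> path_alg) f :
  pmul f (\sum_(i <- r) F i) = \sum_(i <- r) pmul f (F i).
Proof. by apply: (big_morph (pmul f)) => [x y|]; rewrite ?pmulDr ?pmulf0. Qed.

Lemma pmul_suml I (r : seq I) (F : I -> path_alg) f :
  pmul (\sum_(i <- r) F i) f = \sum_(i <- r) pmul (F i) f.
Proof.
by apply: (big_morph (pmul^~ f)) => [x y|]; rewrite ?pmulDl ?pmul0f.
Qed.

Lemma pmulUU u w : pmul (path_elt u) (path_elt w) = bmul u w.
Proof.
rewrite (@pmulw [fset u]%fset [fset w]%fset) ?msuppU_le //.
by rewrite !big_seq_fset1 !mcoeffUU mulr1 scale1r.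
Qed.

Lemma path_algE f : f = \sum_(w <- msupp f) f@_w *: path_elt w.
Proof.
rewrite {1}[f]monalgE; apply: eq_bigr => w _; apply/malgP => x.
by rewrite mcoeffZ !mcoeffU mulrnAr mulr1.
Qed.

Lemma pmulUb u w x : pmul (path_elt u) (bmul w x) = pmul (bmul u w) (path_elt x).
Proof.
have := pcompA u w x; rewrite /bmul.
case: (pcomp w x) (pcomp u w) => [y|] [z|] //=;
  rewrite ?pmulUU ?pmul0f ?pmulf0 // /bmul.
- by move=> ->.
- by move=> ->.
- by move=> <-.
Qed.

Lemma pmulA : associative pmul.
Proof.
have UUp u w h : pmul (path_elt u) (pmul (path_elt w) h) =
    pmul (pmul (path_elt u) (path_elt w)) h.
  rewrite [h]path_algE (pmul_sumr _ _ (path_elt w)) (pmul_sumr _ _ (path_elt u)).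
  rewrite (pmul_sumr _ _ (pmul _ _)); apply: eq_bigr => x _.
  by rewrite !pmulZr !pmulUU pmulUb.
have Upp u g h : pmul (path_elt u) (pmul g h) = pmul (pmul (path_elt u) g) h.
  rewrite [g]path_algE (pmul_suml _ _ h) !(pmul_sumr _ _ (path_elt u)).
  rewrite (pmul_suml _ _ h); apply: eq_bigr => w _.
  by rewrite pmulZl !pmulZr pmulZl UUp.
move=> f g h; rewrite [f]path_algE (pmul_suml _ _ g) (pmul_suml _ _ (pmul g h)).
rewrite (pmul_suml _ _ h); apply: eq_bigr => u _.
by rewrite !pmulZl Upp.
Qed.

Lemma pmul1p : left_id pone pmul.
Proof.
move=> f; rewrite [f]path_algE pmul_sumr; apply: eq_bigr => w _.
rewrite pmulZr; congr (_ *: _); rewrite pmul_suml (bigD1 (ptgt w)) //=.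
rewrite pmulUU /bmul pcomp1p big1 ?addr0 // => v nv.
by rewrite pmulUU /bmul pcompN //; apply/eqP.
Qed.

Lemma pmulp1 : right_id pone pmul.
Proof.
move=> f; rewrite [f]path_algE pmul_suml; apply: eq_bigr => w _.
rewrite pmulZl; congr (_ *: _); rewrite pmul_sumr (bigD1 (psrc w)) //=.
rewrite pmulUU /bmul pcompp1 big1 ?addr0 // => v nv.
by rewrite pmulUU /bmul pcompN //; apply/eqP; rewrite eq_sym.
Qed.

HB.instance Definition _ := GRing.Zmodule_isPzRing.Build path_alg
  pmulA pmul1p pmulp1 pmulDl pmulDr.

Definition path_algc (c : K) : path_alg := c *: pone.

Lemma path_algc1 : path_algc 1 = 1.
Proof. exact: scale1r. Qed.

Lemma path_algcB : {morph path_algc : a b / a - b}.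
Proof. by move=> a b; apply: scalerBl. Qed.

Lemma path_algcM : {morph path_algc : a b / a * b}.
Proof.
by move=> a b; rewrite [RHS]pmulZl pmul1p scalerA.
Qed.

Lemma path_algc_central c f : path_algc c * f = f * path_algc c.
Proof. by rewrite [LHS]pmulZl [RHS]pmulZr pmul1p pmulp1. Qed.

HB.instance Definition _ := isPzAlgebra.Build K path_alg
  path_algc1 path_algcB path_algcM path_algc_central.

End PathAlgebra.

Record category := Category {
  cobj :> Type;
  chom : cobj -> cobj -> Type;
  cid : forall X, chom X X;
  ccomp : forall X Y Z, chom Y Z -> chom X Y -> chom X Z;
  ccompA : forall W X Y Z (f : chom Y Z) (g : chom X Y) (h : chom W X),
    ccomp f (ccomp g h) = ccomp (ccomp f g) h;
  ccomp1m : forall X Y (f : chom X Y), ccomp (cid Y) f = f;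
  ccompm1 : forall X Y (f : chom X Y), ccomp f (cid X) = f
}.
Arguments cid {c} X.

Record functor (C D : category) := Functor {
  fobj :> C -> D;
  farr : forall X Y, chom X Y -> chom (fobj X) (fobj Y);
  farr_id : forall X, farr (cid X) = cid (fobj X);
  farr_comp : forall X Y Z (f : chom Y Z) (g : chom X Y),
    farr (ccomp f g) = ccomp (farr f) (farr g)
}.
Arguments farr {C D} _ {X Y} _.

Definition fun_id (C : category) : functor C C :=
  @Functor C C id (fun _ _ => id) (fun _ => erefl) (fun _ _ _ _ _ => erefl).

Section FunctorComposition.
Variables (C D E : category) (F : functor D E) (G : functor C D).

Lemma fun_comp_id X : farr F (farr G (cid X)) = cid (F (G X)).
Proof. by rewrite !farr_id. Qed.

Lemma fun_comp_comp X Y Z (f : chom Y Z) (g : chom X Y) :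
  farr F (farr G (ccomp f g)) = ccomp (farr F (farr G f)) (farr F (farr G g)).
Proof. by rewrite !farr_comp. Qed.

Definition fun_comp : functor C E :=
  @Functor C E (fun X => F (G X)) (fun X Y f => farr F (farr G f))
    fun_comp_id fun_comp_comp.
End FunctorComposition.

Record natiso (C D : category) (F G : functor C D) := NatIso {
  nat_fwd : forall X, chom (F X) (G X);
  nat_bwd : forall X, chom (G X) (F X);
  nat_square : forall X Y (f : chom X Y),
    ccomp (nat_fwd Y) (farr F f) = ccomp (farr G f) (nat_fwd X);
  nat_fwdK : forall X, ccomp (nat_bwd X) (nat_fwd X) = cid (F X);
  nat_bwdK : forall X, ccomp (nat_fwd X) (nat_bwd X) = cid (G X)
}.

Definition nat_isomorphic (C D : category) (F G : functor C D) : Prop :=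
  inhabited (natiso F G).

Definition quasi_inverse (C D : category) (F : functor C D) (G : functor D C) :=
  nat_isomorphic (fun_comp G F) (fun_id C) /\
  nat_isomorphic (fun_comp F G) (fun_id D).

(* The data of a Z-category.  Being abelian with exact shifts is a property of
   these data which the notions of Z-functor and Z-equivalence do not involve. *)
Record zcategory := ZCategory {
  zcat :> category;
  zshift : int -> functor zcat zcat;
  zshiftD : forall i j : int,
    natiso (fun_comp (zshift i) (zshift j)) (zshift (i + j))
}.

Definition zfunctor (C D : zcategory) (F : functor C D) : Prop :=
  forall i : int,
    nat_isomorphic (fun_comp F (zshift C i)) (fun_comp (zshift D i) F).

Definition zequivalence (C D : zcategory) (F : functor C D) : Prop :=
  zfunctor F /\ exists2 G : functor D C, zfunctor G & quasi_inverse F G.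

Section ModuleCategory.
Variables (K : pzRingType) (A : pzAlgType K).

Lemma linear_eqP (U V : lmodType A) (f g : {linear U -> V}) : f =1 g -> f = g.
Proof.
case: f g => [f cf] [g cg] /= /funext efg; rewrite -{}efg in cg *.
congr GRing.Linear.Pack; case: cf cg => [[f1] [f2]] [[g1] [g2]].
by congr GRing.Linear.Class; f_equal; apply: Prop_irrelevance.
Qed.

Definition mod_id (U : lmodType A) : {linear U -> U} := idfun.
Definition mod_comp (U V W : lmodType A) (f : {linear V -> W})
  (g : {linear U -> V}) : {linear U -> W} := f \o g.

Definition mod_cat : category.
Proof.
apply: (@Category (lmodType A) (fun U V => {linear U -> V}) mod_id mod_comp).
- by move=> *; apply: linear_eqP.
- by move=> *; apply: linear_eqP.
- by move=> *; apply: linear_eqP.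
Defined.

End ModuleCategory.

Section Morita.
Variables (K : pzRingType) (A B : pzAlgType K).

(* Equality [h = c f + g] in the K-space Hom_A(U, V), stated pointwise. *)
Definition klinear (F : functor (mod_cat A) (mod_cat B)) : Prop :=
  forall (U V : lmodType A) (c : K) (f g h : {linear U -> V}),
    (forall x, h x = (algc c : A) *: f x + g x) ->
  let F1 (f : {linear U -> V}) : {linear (F U : lmodType B) -> (F V : lmodType B)}
    := @farr _ _ F U V f in
  forall y, F1 h y = (algc c : B) *: F1 f y + F1 g y.

(* Equivalence of the K-linear categories of all left modules; the inverse of a
   K-linear equivalence is automatically K-linear. *)
Definition morita_equivalent : Prop :=
  exists2 F : functor (mod_cat A) (mod_cat B), klinear F &
    exists G : functor (mod_cat B) (mod_cat A), quasi_inverse F G.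

End Morita.

Section GradedModules.
Variables (K : pzRingType) (A : pzAlgType K).
Implicit Types (M : lmodType A).

Definition ksubspace M (P : M -> Prop) : Prop :=
  P 0 /\ forall (c : K) x y, P x -> P y -> P ((algc c : A) *: x + y).

Definition direct_decomposition M (C : int -> M -> Prop) : Prop :=
  [/\ forall j, ksubspace (C j),
      forall m, exists (s : seq int) (x : int -> M),
        (forall j, C j (x j)) /\ m = \sum_(j <- s) x j
    & forall (s : seq int) (x : int -> M), uniq s -> (forall j, C j (x j)) ->
        \sum_(j <- s) x j = 0 -> {in s, forall j, x j = 0}].

Definition finitely_generated M : Prop :=
  exists s : seq M, forall m, exists c : nat -> A,
    m = \sum_(i < size s) c i *: s`_i.

(* [P M C] is the condition imposed on the action of A on M = (+)_j C j. *)
Variable P : forall M, (int -> M -> Prop) -> Prop.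

Record grmod := GrMod {
  gr_mod :> lmodType A;
  gr_comp : int -> gr_mod -> Prop;
  gr_direct : direct_decomposition gr_comp;
  gr_fg : finitely_generated gr_mod;
  gr_action : P gr_comp
}.

Record grhom (M N : grmod) := GrHom {
  gr_lin :> {linear M -> N};
  gr_deg : forall j x, @gr_comp M j x -> @gr_comp N j (gr_lin x)
}.

Lemma grhomP (M N : grmod) (f g : grhom M N) : f =1 g -> f = g.
Proof.
case: f g => [f hf] [g hg] /= /linear_eqP efg.
by rewrite -{}efg in hg *; congr GrHom; apply: Prop_irrelevance.
Qed.

Definition gr_id (M : grmod) : grhom M M :=
  @GrHom M M (idfun : {linear M -> M}) (fun _ _ Cx => Cx).

Definition gr_compose (M N L : grmod) (f : grhom N L) (g : grhom M N) :
    grhom M L :=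
  @GrHom M L (f \o g : {linear M -> L})
    (fun j x Cx => gr_deg f (gr_deg g Cx)).

Definition gr_cat : category.
Proof.
apply: (@Category grmod grhom gr_id gr_compose).
- by move=> *; apply: grhomP.
- by move=> *; apply: grhomP.
- by move=> *; apply: grhomP.
Defined.

(* The shifts (M[i])_j = M_(j - step i). *)
Variable step : int.

Definition shift_comp M (C : int -> M -> Prop) (i : int) : int -> M -> Prop :=
  fun j => C (j - step * i).

Hypothesis P_shift : forall M (C : int -> M -> Prop) i,
  P C -> P (shift_comp C i).

Lemma shift_direct M (C : int -> M -> Prop) i :
  direct_decomposition C -> direct_decomposition (shift_comp C i).
Proof.
move=> [C1 C2 C3]; set t := step * i; split=> [j|m|s x us Cx s0 j js].
- exact: C1.
- have [s [x [Cx ->]]] := C2 m; exists [seq j + t | j <- s], (fun j => x (j - t)).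
  split=> [j|]; first exact: Cx.
  by rewrite big_map; apply: eq_bigr => j _; rewrite addrK.
- have := C3 [seq j - t | j <- s] (fun j => x (j + t)); rewrite big_map.
  have -> : \sum_(j <- s) x (j - t + t) = 0.
    by rewrite -[RHS]s0; apply: eq_bigr => k _; rewrite subrK.
  move=> /(_ _ _ erefl (j - t)); rewrite subrK; apply.
  + by rewrite map_inj_uniq //; apply: addIr.
  + by move=> k; have := Cx (k + t); rewrite /shift_comp addrK.
  + exact: map_f.
Qed.

Definition gr_shift_obj (i : int) (M : grmod) : grmod :=
  GrMod (shift_direct i (@gr_direct M)) (@gr_fg M) (P_shift i (@gr_action M)).

Definition gr_shift_hom (i : int) (M N : grmod) (f : grhom M N) :
    grhom (gr_shift_obj i M) (gr_shift_obj i N) :=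
  @GrHom (gr_shift_obj i M) (gr_shift_obj i N) (f : {linear M -> N})
    (fun j x Cx => @gr_deg M N f (j - step * i) x Cx).

Definition gr_shift (i : int) : functor gr_cat gr_cat.
Proof.
apply: (@Functor gr_cat gr_cat (gr_shift_obj i) (gr_shift_hom i)).
- by move=> *; apply: grhomP.
- by move=> *; apply: grhomP.
Defined.

Lemma gr_shiftDE (M : grmod) (i j l : int) x :
  @gr_comp (gr_shift i (gr_shift j M)) l x <-> @gr_comp (gr_shift (i + j) M) l x.
Proof. by rewrite /= /shift_comp mulrDr opprD addrA. Qed.

(* The identity map of M is an isomorphism M[j][i] -> M[i + j]. *)
Definition gr_shiftD (i j : int) :
  natiso (fun_comp (gr_shift i) (gr_shift j)) (gr_shift (i + j)).
Proof.
refine (@NatIso gr_cat gr_cat (fun_comp (gr_shift i) (gr_shift j))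
  (gr_shift (i + j))
  (fun M : grmod => @GrHom (gr_shift i (gr_shift j M)) (gr_shift (i + j) M)
     (idfun : {linear gr_mod M -> gr_mod M}) (fun l x => proj1 (@gr_shiftDE M i j l x)))
  (fun M : grmod => @GrHom (gr_shift (i + j) M) (gr_shift i (gr_shift j M))
     (idfun : {linear gr_mod M -> gr_mod M}) (fun l x => proj2 (@gr_shiftDE M i j l x))) _ _ _).
- by move=> *; apply: grhomP.
- by move=> *; apply: grhomP.
- by move=> *; apply: grhomP.
Defined.

Definition gr_zcat : zcategory := ZCategory gr_shiftD.

End GradedModules.

Inductive tgen := ga | gb | gh.

Definition tgen_code (g : tgen) : nat :=
  match g with ga => 0 | gb => 1 | gh => 2 end%N.
Definition tgen_decode (n : nat) : option tgen :=
  match n with 0 => Some ga | 1 => Some gb | 2 => Some gh | _ => None end%N.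
Lemma tgen_codeK : pcancel tgen_code tgen_decode.
Proof. by case. Qed.
HB.instance Definition _ := Choice.copy tgen (pcan_type tgen_codeK).

Section TAlgebra.
Variables (K : fieldType) (v : {poly K}) (p : nat).

Local Notation FA := (free_alg K tgen).
Local Notation a := (free_gen K ga).
Local Notation b := (free_gen K gb).
Local Notation h := (free_gen K gh).

Variant T_rel : FA -> Prop :=
| T_rel_ha : T_rel (h * a - a * (h + 1))
| T_rel_hb : T_rel (h * b - b * (h - 1))
| T_rel_ba : T_rel (b * a - horner_alg h v)
| T_rel_ab : T_rel (a * b - horner_alg (h - 1) v).

Definition T_alg : pzAlgType K := alg_quot T_rel.

Definition T_gen (g : tgen) : T_alg := quot_pi T_rel (free_gen K g).

Variant t_rel : T_alg -> Prop :=
| t_rel_a : t_rel (T_gen ga ^+ p)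
| t_rel_b : t_rel (T_gen gb ^+ p)
| t_rel_h : t_rel (T_gen gh ^+ p - T_gen gh).

Definition t_alg : pzAlgType K := alg_quot t_rel.

Definition t_gen (g : tgen) : t_alg := quot_pi t_rel (T_gen g).

(* The degree of v. *)
Local Notation n := (size v).-1.

Definition t_action (M : lmodType t_alg) (C : int -> M -> Prop) : Prop :=
  forall j x, C j x ->
    [/\ C (j + n%:Z) (t_gen ga *: x), C (j - n%:Z) (t_gen gb *: x)
      & t_gen gh *: x = algc (j%:~R * (n%:R)^-1 : K) *: x].

Hypothesis charK : p \in [pchar K].

Lemma t_action_shift (M : lmodType t_alg) (C : int -> M -> Prop) (i : int) :
  t_action C -> t_action (shift_comp p%:Z C i).
Proof.
move=> tC j x /tC[Ca Cb ->]; split.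
- by rewrite /shift_comp addrAC.
- by rewrite /shift_comp addrAC.
- by rewrite rmorphB rmorphM /= -pmulrn (pcharf0 charK) mul0r subr0.
Qed.

Definition t_grmod : zcategory := gr_zcat t_action_shift.

End TAlgebra.

(* [inl i] is the arrow a_i : i -> i + 1 and [inr i] is b_i : i + 1 -> i;
   [ordS] is the successor modulo k. *)
Definition cyclic_quiver (k : nat) : quiver :=
  @Quiver 'I_k ('I_k + 'I_k)%type
    (fun e => match e with inl i => i | inr i => ordS i end)
    (fun e => match e with inl i => ordS i | inr i => i end).

Section NoCycleAlgebra.
Variables (K : fieldType) (k : nat).

Local Notation Q := (cyclic_quiver k).

Variant nocycle_rel : path_alg Q K -> Prop :=
| NocycleRel (w : qpath Q) of parrows w <> [::] & psrc w = ptgt w :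
    nocycle_rel (path_elt K w).

Definition nocycle_alg : pzAlgType K := alg_quot nocycle_rel.

Definition arrow_deg (e : qarr Q) : int :=
  match e with inl _ => -1 | inr _ => 1 end.

Definition path_deg (w : qpath Q) : int := \sum_(e <- parrows w) arrow_deg e.

Definition nocycle_homog (d : int) (y : nocycle_alg) : Prop :=
  exists2 f : path_alg Q K, (forall w, w \in msupp f -> path_deg w = d) &
    y = quot_pi nocycle_rel f.

Definition nocycle_action (M : lmodType nocycle_alg) (C : int -> M -> Prop) :
    Prop :=
  forall d y j x, nocycle_homog d y -> C j x -> C (d + j) (y *: x).

Lemma nocycle_action_shift (M : lmodType nocycle_alg) (C : int -> M -> Prop)
    (i : int) :
  nocycle_action C -> nocycle_action (shift_comp 1 C i).
Proof.
by move=> nC d y j x hy /(nC d y _ _ hy); rewrite /shift_comp addrA.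
Qed.

Definition nocycle_grmod : zcategory := gr_zcat nocycle_action_shift.

End NoCycleAlgebra.

(* Only r_1, ..., r_(n-1) are used; [gap 0] is r_0 = p - (r_1 + ... + r_(n-1)). *)
Section RootData.
Variables (p n : nat) (r : nat -> nat).

Definition gap (i : nat) : nat :=
  if i is 0 then (p - \sum_(1 <= j < n) r j)%N else r i.

Definition num_nonzero_gaps : nat := count (fun i => gap i != 0%N) (iota 0 n).

Definition v_poly (K : fieldType) : {poly K} :=
  \prod_(i < n) ('X - (\sum_(1 <= j < i.+1) (r j)%:R)%:P).

End RootData.

(* Main.v *)
Require Import Defs.
From HB Require Import structures.
From mathcomp Require Import all_boot all_order all_algebra.
From mathcomp Require Import finmap boolp zify ring.
From mathcomp.multinomials Require Import monalg.

(* Both algebras are generated by orthogonal idempotents E_i (i in Z/m) with sum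
   1 and by elements [up] : E_i -> E_(i+1) and [dn] back, such that dn up = u_i
   on E_i and up ^ m = dn ^ m = 0, and both are universal for these relations.
   In t(v), m = p, E_i is the projection onto the eigenvalue i + 1 of h, up = a,
   dn = b and u_i = v(i + 1), so that u_i = 0 exactly when i + 1 is a root; in
   the no-cycle algebra, m = k, u = 0, up is the sum of the arrows b_i and dn
   that of the a_i.  Cutting Z/p after each zero of u gives k segments.  Since
   up is invertible inside a segment, the module (+)_i E_i M is determined by its
   components at the first points of the segments, on which up ^ length and a
   multiple of dn ^ length act as the arrows; conversely, a representation of the
   no-cycle algebra is extended along each segment by identity maps.  If k = n,
   the degree m at the vertex s corresponds to the degree n (q + 1) + p (m - s)
   at each point q of the segment s. *)

Set Implicit Arguments.
Unset Strict Implicit.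
Unset Printing Implicit Defensive.

Import GRing.Theory.
Local Open Scope ring_scope.

(** The two functors are one construction, [pull], for two coverings, and the two natural
    isomorphisms are one lemma with the coverings exchanged; hence the equivalences are proved for
    arbitrary weights u and arbitrary coverings. The delicate point is dn. Across a segment of
    length L, dn ^ L up ^ L is the product of all the weights and vanishes because of the last one,
    whereas up ^ (L - 1) dn ^ L is dn times the product of the other weights, which are nonzero.
    Dividing by that product gives the arrow of the no-cycle algebra and brings dn back unchanged on
    both round trips. The degrees are forced: h acts on degree D as D / n and on E_q as q + 1, so D
    = n (q + 1) modulo p; up adds n to D and the shift [1] adds p. A turn around Z/p lowers n (q +
    1) by n p and lowers s by k, which raises p (m - s) by p k. The correspondence of degrees is
    thus consistent around the circle exactly when k = n. *)

HB.instance Definition _ (K : pzRingType) (A : pzAlgType K) :=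
  GRing.isZmodMorphism.Build K A (@algc K A) (@algcB K A).
HB.instance Definition _ (K : pzRingType) (A : pzAlgType K) :=
  GRing.isMonoidMorphism.Build K A (@algc K A) (conj (@algc1 K A) (@algcM K A)).

(** * Module structures as morphisms into endomorphism algebras *)

Section Endomorphisms.
Variables (K : comNzRingType) (V : lmodType K).

(** A [pzAlgType] even for V = 0, so that the universal property of an algebra A, applied with
    target [kend V], produces A-modules on any K-module V. *)
Definition kend : Type := {linear V -> V}.

Lemma kend_eqP (f g : kend) :
  (forall x, (f : {linear V -> V}) x = (g : {linear V -> V}) x) -> f = g.
Proof.
case: f g => [f cf] [g cg] /= /funext efg; rewrite -{}efg in cg *.
congr GRing.Linear.Pack; case: cf cg => [[f1] [f2]] [[g1] [g2]].
by congr GRing.Linear.Class; f_equal; apply: Prop_irrelevance.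
Qed.

HB.instance Definition _ := gen_eqMixin kend.
HB.instance Definition _ := gen_choiceMixin kend.

Definition kend0 : kend := \0.
Definition kendD (f g : kend) : kend := f \+ g.
Definition kendN (f : kend) : kend := \- f.
Definition kend1 : kend := idfun.
Definition kendM (f g : kend) : kend := f \o g.

Fact kendDA : associative kendD.
Proof. by move=> f g h; apply: kend_eqP => x; apply: addrA. Qed.
Fact kendDC : commutative kendD.
Proof. by move=> f g; apply: kend_eqP => x; apply: addrC. Qed.
Fact kend0D : left_id kend0 kendD.
Proof. by move=> f; apply: kend_eqP => x; apply: add0r. Qed.
Fact kendND : left_inverse kend0 kendN kendD.
Proof. by move=> f; apply: kend_eqP => x; apply: addNr. Qed.
HB.instance Definition _ := GRing.isZmodule.Build kend kendDA kendDC kend0D kendND.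

Fact kendMA : associative kendM.
Proof. by move=> f g h; apply: kend_eqP => x. Qed.
Fact kend1M : left_id kend1 kendM.
Proof. by move=> f; apply: kend_eqP => x. Qed.
Fact kendM1 : right_id kend1 kendM.
Proof. by move=> f; apply: kend_eqP => x. Qed.
Fact kendMDl : left_distributive kendM kendD.
Proof. by move=> f g h; apply: kend_eqP => x. Qed.
Fact kendMDr : right_distributive kendM kendD.
Proof. by move=> f g h; apply: kend_eqP => x; apply: raddfD. Qed.
HB.instance Definition _ := GRing.Zmodule_isPzRing.Build kend
  kendMA kend1M kendM1 kendMDl kendMDr.

Definition kendc (c : K) : kend := c \*: (idfun : {linear V -> V}).
Fact kendc1 : kendc 1 = 1.
Proof. by apply: kend_eqP => x; apply: scale1r. Qed.
Fact kendcB : {morph kendc : a b / a - b}.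
Proof. by move=> a b; apply: kend_eqP => x; apply: scalerBl. Qed.
Fact kendcM : {morph kendc : a b / a * b}.
Proof. by move=> a b; apply: kend_eqP => x; rewrite /= -scalerA. Qed.
Fact kendc_central c (f : kend) : kendc c * f = f * kendc c.
Proof. by apply: kend_eqP => x; rewrite /= linearZ. Qed.
HB.instance Definition _ := isPzAlgebra.Build K kend kendc1 kendcB kendcM kendc_central.

Definition kapp (f : kend) : V -> V := (f : {linear V -> V}).

Lemma kappM f g x : kapp (f * g) x = kapp f (kapp g x). Proof. by []. Qed.
Lemma kapp1 x : kapp 1 x = x. Proof. by []. Qed.
Lemma kapp0 x : kapp 0 x = 0. Proof. by []. Qed.
Lemma kappc c x : kapp (algc c) x = c *: x. Proof. by []. Qed.
Lemma kapp_sum I r (P : pred I) (F : I -> kend) x :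
  kapp (\sum_(i <- r | P i) F i) x = \sum_(i <- r | P i) kapp (F i) x.
Proof. by apply: (big_morph (kapp^~ x)). Qed.

End Endomorphisms.

Section ActionModule.
Variables (K : comNzRingType) (A : pzAlgType K) (V : lmodType K).

(** A copy of V that records [phi], so that instance inference finds the action given by [phi] on
    it. *)
Definition act_type (phi : {rmorphism A -> kend V}) : Type := V.

Variable phi : {rmorphism A -> kend V}.
Local Notation actmod := (act_type phi).

HB.instance Definition _ := GRing.Zmodule.copy actmod V.
Definition act (a : A) (x : actmod) : actmod := kapp (phi a) x.
Fact actA a b x : act a (act b x) = act (a * b) x.
Proof. by rewrite /act rmorphM. Qed.
Fact act1 : left_id 1 act.
Proof. by move=> x; rewrite /act rmorph1. Qed.
Fact actDr : right_distributive act +%R.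
Proof. by move=> a x y; apply: raddfD. Qed.
Fact actDl x : {morph act^~ x : a b / a + b}.
Proof. by move=> a b; rewrite /act rmorphD. Qed.
HB.instance Definition _ := GRing.Zmodule_isLmodule.Build A actmod actA act1 actDr actDl.

Definition act_mod : lmodType A := actmod.
Lemma actmodE a (x : act_mod) : a *: x = kapp (phi a) x.
Proof. by []. Qed.
End ActionModule.

Section RestrictScalars.
Variables (K : comNzRingType) (A : pzAlgType K) (M : lmodType A).

Definition kmod : Type := M.
HB.instance Definition _ := GRing.Zmodule.on kmod.
Definition kscale (c : K) (x : kmod) : kmod := (algc c : A) *: (x : M).
Fact kscaleA a b x : kscale a (kscale b x) = kscale (a * b) x.
Proof. by rewrite /kscale scalerA rmorphM. Qed.
Fact kscale1 : left_id 1 kscale.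
Proof. by move=> x; rewrite /kscale rmorph1 scale1r. Qed.
Fact kscaleDr : right_distributive kscale +%R.
Proof. by move=> a x y; apply: scalerDr. Qed.
Fact kscaleDl x : {morph kscale^~ x : a b / a + b}.
Proof. by move=> a b; rewrite /kscale rmorphD; apply: scalerDl. Qed.
HB.instance Definition _ := GRing.Zmodule_isLmodule.Build K kmod kscaleA kscale1 kscaleDr kscaleDl.

Lemma kmodE (c : K) (x : kmod) : c *: x = (algc c : A) *: (x : M) :> M.
Proof. by []. Qed.

End RestrictScalars.

(** * Cyclic algebras by generators and relations *)

Lemma algcC (K : pzRingType) (A : pzAlgType K) c (x : A) : algc c * x = x * algc c.
Proof. exact: algc_central. Qed.

(** Generation as an induction principle: it is applied to the set of all elements with which a
    given map or subspace is compatible. *)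
Definition alg_generated (K : pzRingType) (A : pzAlgType K) (G : A -> Prop) : Prop :=
  forall P : A -> Prop, (forall c, P (algc c)) ->
  (forall x y, P x -> P y -> P (x + y)) -> (forall x y, P x -> P y -> P (x * y)) ->
  (forall g, G g -> P g) -> forall x, P x.

Section Cyclic.
Variable K : comNzRingType.

Record cyc_rel (S : pzAlgType K) (m : nat) (u : 'I_m -> K) (E : 'I_m -> S)
    (up dn : S) : Prop := CycRel {
  cycE : forall i j, E i * E j = if i == j then E i else 0;
  cyc1 : \sum_i E i = 1;
  cyc_up : forall i, up * E i = E (ordS i) * up;
  cyc_dn : forall i, E i * dn = dn * E (ordS i);
  cyc_dnup : forall i, dn * up * E i = algc (u i) * E i;
  cyc_updn : forall i, up * dn * E (ordS i) = algc (u i) * E (ordS i);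
  cyc_upm : up ^+ m = 0;
  cyc_dnm : dn ^+ m = 0
}.

(** [c_lift] is data rather than mere existence because it defines the action on pulled-back
    modules; [c_gen] then allows linearity to be tested on the E_i, up and dn alone. *)
Record cyc_alg (A : pzAlgType K) (m : nat) (u : 'I_m -> K) := CycAlg {
  cE : 'I_m -> A;
  cup : A;
  cdn : A;
  c_rel : cyc_rel u cE cup cdn;
  c_gen : alg_generated (fun x => [\/ exists i, x = cE i, x = cup | x = cdn]);
  c_lift : forall (S : pzAlgType K) (E : 'I_m -> S) (up dn : S), cyc_rel u E up dn ->
    {phi : {rmorphism A -> S} | [/\ forall c, phi (algc c) = algc c,
       forall i, phi (cE i) = E i, phi cup = up & phi cdn = dn]}
}.

Section Theory.
Variables (A : pzAlgType K) (m : nat) (u : 'I_m -> K) (E : 'I_m -> A) (up dn : A).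
Hypothesis R : cyc_rel u E up dn.

(** The total weight of e steps up from i: the scalar by which [dn ^+ e * up ^+ e] acts on E_i. *)
Definition uprod (i : 'I_m) (e : nat) : K := \prod_(t < e) u (iter t (@ordS _) i).

Lemma uprod0 i : uprod i 0 = 1. Proof. exact: big_ord0. Qed.
Lemma uprodS i e : uprod i e.+1 = uprod i e * u (iter e (@ordS _) i).
Proof. exact: big_ord_recr. Qed.
Lemma uprodSl i e : uprod i e.+1 = u i * uprod (ordS i) e.
Proof.
rewrite /uprod big_ord_recl; congr (_ * _); apply: eq_bigr => t _.
by rewrite lift0 iterSr.
Qed.

Lemma upXE i e : up ^+ e * E i = E (iter e (@ordS _) i) * up ^+ e.
Proof.
elim: e => [|e IH]; first by rewrite mul1r mulr1.
by rewrite exprS -mulrA IH mulrA (cyc_up R) -mulrA.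
Qed.

Lemma dnXE i e : E i * dn ^+ e = dn ^+ e * E (iter e (@ordS _) i).
Proof.
elim: e => [|e IH]; first by rewrite mul1r mulr1.
by rewrite exprSr mulrA IH -mulrA (cyc_dn R) mulrA.
Qed.

(** The innermost pair [dn * up] stands at the last step, where E_i has become E_(i+e), and turns
    into the last weight. *)
Lemma dnupX i e : dn ^+ e * up ^+ e * E i = algc (uprod i e) * E i.
Proof.
elim: e => [|e IH]; first by rewrite !mul1r uprod0 rmorph1 mul1r.
rewrite exprSr exprS -!mulrA upXE.
rewrite (mulrA up) (mulrA dn) (mulrA dn) (cyc_dnup R) -mulrA -upXE.
rewrite (mulrA (dn ^+ e)) -algcC -!mulrA [dn ^+ e * (up ^+ e * _)]mulrA IH.
by rewrite uprodS rmorphM !mulrA !(algcC (uprod i e)).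
Qed.

(** The innermost pair [up * dn] stands at the first step from i, so the induction moves i and
    splits off the first weight. *)
Lemma updnX i e :
  up ^+ e * dn ^+ e * E (iter e (@ordS _) i) = algc (uprod i e) * E (iter e (@ordS _) i).
Proof.
elim: e i => [|e IH] i; first by rewrite !mul1r uprod0 rmorph1 mul1r.
rewrite iterSr exprSr exprS -!mulrA -dnXE.
rewrite (mulrA dn) (mulrA up) (mulrA up) (cyc_updn R) -mulrA dnXE.
rewrite (mulrA (up ^+ e)) -algcC -!mulrA [up ^+ e * (dn ^+ e * _)]mulrA IH.
by rewrite uprodSl rmorphM !mulrA.
Qed.

Lemma upX0 e : (m <= e)%N -> up ^+ e = 0.
Proof. by move=> /subnK <-; rewrite exprD (cyc_upm R) mulr0. Qed.
Lemma dnX0 e : (m <= e)%N -> dn ^+ e = 0.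
Proof. by move=> /subnK <-; rewrite exprD (cyc_dnm R) mulr0. Qed.

Lemma cyc_ext (x y : A) : (forall i, x * E i = y * E i) -> x = y.
Proof.
move=> xy; rewrite -[x]mulr1 -[y]mulr1 -(cyc1 R) !mulr_sumr.
exact: eq_bigr.
Qed.

End Theory.
End Cyclic.

(** * Coverings and pulled-back modules *)

Section MakeEndomorphism.
Variables (K : comNzRingType) (V : lmodType K) (f : V -> V).
Hypothesis flin : forall c x y, f (c *: x + y) = c *: f x + f y.
Definition kend_fun := f.
Fact kend_fun_linear : linear kend_fun.
Proof. exact: flin. Qed.
HB.instance Definition _ := GRing.isLinear.Build K V V *:%R kend_fun kend_fun_linear.
Definition mk_kend : kend V := kend_fun.
Lemma mk_kendE x : kapp mk_kend x = f x. Proof. by []. Qed.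
End MakeEndomorphism.

Lemma iter_ordS l t (j : 'I_l) : iter t (@ordS _) j = ((j + t) %% l)%N :> nat.
Proof.
elim: t => [|t IH]; first by rewrite addn0 modn_small.
by rewrite iterS /= IH -addn1 modnDml addn1 addnS.
Qed.

Lemma iter_ordS_full l (j : 'I_l) : iter l (@ordS _) j = j.
Proof. by apply: val_inj; rewrite /= iter_ordS modnDr modn_small. Qed.

(* From a module M over the cyclic algebra on Z/m one gets a module over the one
   on Z/l: the sum over j of the E_(cs j) M, where up acts on the j-th summand by
   up ^ (ce j), and dn acts back to it by cc j times dn ^ (ce j). *)
Record covering (K : Type) (m l : nat) :=
  Covering { cs : 'I_l -> 'I_m; ce : 'I_l -> nat; cc : 'I_l -> K }.

Section Lengths.
Variables (K : comNzRingType) (m l : nat) (d : covering K m l).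
(** t steps from j on Z/l amount to [clen] steps on Z/m; [ccoef] is the scalar that dn collects on
    the way. *)
Definition clen (j : 'I_l) (t : nat) : nat := \sum_(i < t) ce d (iter i (@ordS _) j).
Definition ccoef (j : 'I_l) (t : nat) : K := \prod_(i < t) cc d (iter i (@ordS _) j).
Lemma clenS j t : clen j t.+1 = (clen j t + ce d (iter t (@ordS _) j))%N.
Proof. exact: big_ord_recr. Qed.
Lemma ccoefS j t : ccoef j t.+1 = ccoef j t * cc d (iter t (@ordS _) j).
Proof. exact: big_ord_recr. Qed.
End Lengths.

(** Exactly what the relations on the pulled-back module require: consecutive steps fit together,
    one step has weight w, and a full turn on Z/l covers at least m steps, so that the l-th powers
    of up and dn vanish. *)
Definition cov_ok (K : comNzRingType) m l (u : 'I_m -> K) (w : 'I_l -> K)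
  (d : covering K m l) : Prop :=
  [/\ forall j, iter (ce d j) (@ordS _) (cs d j) = cs d (ordS j),
      forall j, cc d j * uprod u (cs d j) (ce d j) = w j
    & forall j, (m <= clen d j l)%N].

Section Pull.
Variables (K : comNzRingType) (A : pzAlgType K) (M : lmodType A).
Variables (m : nat) (u : 'I_m -> K) (E : 'I_m -> A) (up dn : A).
Hypothesis R : cyc_rel u E up dn.
Variables (l : nat) (w : 'I_l -> K) (d : covering K m l).
Hypothesis d_ok : cov_ok u w d.

(** x lies in E_i M exactly when E_i x = x. Families indexed by j are used instead of a submodule of
    M because [cs] need not be injective: extension along a segment repeats one summand at each of
    its points. *)
Definition pull_pred (g : {ffun 'I_l -> kmod M}) : bool :=
  [forall j, (E (cs d j) *: (g j : M) : M) == g j].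

Fact pull_pred_submod : submod_closed pull_pred.
Proof.
split; first by apply/forallP => j; rewrite ffunE scaler0.
move=> c f g /forallP fP /forallP gP; apply/forallP => j.
rewrite !ffunE scalerDr (eqP (gP j)) kmodE scalerA -algcC -scalerA.
by rewrite (eqP (fP j)).
Qed.

HB.instance Definition _ := GRing.isSubmodClosed.Build K {ffun 'I_l -> kmod M}
  pull_pred pull_pred_submod.

Definition pull : Type := {g : {ffun 'I_l -> kmod M} | pull_pred g}.
HB.instance Definition _ := SubType.on pull.
HB.instance Definition _ := Choice.on pull.
HB.instance Definition _ := [SubChoice_isSubLmodule of pull by <:].

Definition pv (g : pull) (j : 'I_l) : M := val g j.

Lemma pvE g j : E (cs d j) *: pv g j = pv g j.
Proof. by have /forallP/(_ j)/eqP := valP g. Qed.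
Lemma pv_ext g h : (forall j, pv g j = pv h j) -> g = h.
Proof. by move=> gh; apply: val_inj; apply/ffunP. Qed.
Lemma pvD g h j : pv (g + h) j = pv g j + pv h j.
Proof. by rewrite /pv raddfD /= ffunE. Qed.
Lemma pv0 j : pv 0 j = 0.
Proof. by rewrite /pv raddf0 ffunE. Qed.
Lemma pvZ (c : K) g j : pv (c *: g) j = (algc c : A) *: pv g j.
Proof. by rewrite /pv linearZ /= ffunE. Qed.
Lemma pv_sum I r (P : pred I) (F : I -> pull) j :
  pv (\sum_(i <- r | P i) F i) j = \sum_(i <- r | P i) pv (F i) j.
Proof. by apply: (big_morph (pv^~ j)) => [x y|]; rewrite ?pvD ?pv0. Qed.

Section Make.
Variables (f : 'I_l -> M) (hf : forall j, E (cs d j) *: f j = f j).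
Fact mk_pull_subproof : pull_pred [ffun j => f j].
Proof. by apply/forallP => j; rewrite ffunE hf. Qed.
Definition mk_pull : pull := Sub _ mk_pull_subproof.
Lemma mk_pullE j : pv mk_pull j = f j.
Proof. by rewrite /pv SubK ffunE. Qed.
End Make.

Definition pE_fun (i : 'I_l) (g : pull) : pull.
Proof.
apply: (@mk_pull (fun j => if i == j then pv g j else 0)) => j.
by case: ifP; rewrite ?pvE ?scaler0.
Defined.
Lemma pE_funE i g j : pv (pE_fun i g) j = if i == j then pv g j else 0.
Proof. exact: mk_pullE. Qed.

Definition pup_fun (g : pull) : pull.
Proof.
apply: (@mk_pull (fun j => up ^+ ce d (ord_pred j) *: pv g (ord_pred j))) => j.
case: d_ok => ds _ _.
by rewrite -{1}[j]ord_predK -ds scalerA -(upXE R) -scalerA pvE.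
Defined.
Lemma pup_funE g j : pv (pup_fun g) (ordS j) = up ^+ ce d j *: pv g j.
Proof. by rewrite mk_pullE ordSK. Qed.

Definition pdn_fun (g : pull) : pull.
Proof.
apply: (@mk_pull (fun j => (algc (cc d j) * dn ^+ ce d j) *: pv g (ordS j))) => j.
case: d_ok => ds _ _.
by rewrite scalerA mulrA -algcC -mulrA (dnXE R) ds mulrA -scalerA pvE.
Defined.
Lemma pdn_funE g j : pv (pdn_fun g) j = (algc (cc d j) * dn ^+ ce d j) *: pv g (ordS j).
Proof. exact: mk_pullE. Qed.

Lemma scalerCA (c : K) (a : A) (x : M) : a *: (algc c *: x) = algc c *: (a *: x).
Proof. by rewrite !scalerA algcC. Qed.

Fact pE_lin i c x y : pE_fun i (c *: x + y) = c *: pE_fun i x + pE_fun i y.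
Proof.
apply: pv_ext => j; rewrite pvD pvZ !pE_funE pvD pvZ.
by case: ifP => _ //; rewrite scaler0 addr0.
Qed.
Fact pup_lin c x y : pup_fun (c *: x + y) = c *: pup_fun x + pup_fun y.
Proof.
apply: pv_ext => j; rewrite -[j]ord_predK pvD pvZ !pup_funE pvD pvZ.
by rewrite scalerDr scalerCA.
Qed.
Fact pdn_lin c x y : pdn_fun (c *: x + y) = c *: pdn_fun x + pdn_fun y.
Proof.
apply: pv_ext => j; rewrite pvD pvZ !pdn_funE pvD pvZ.
by rewrite scalerDr scalerCA.
Qed.

Definition pE i : kend pull := mk_kend (pE_lin i).
Definition pup : kend pull := mk_kend pup_lin.
Definition pdn : kend pull := mk_kend pdn_lin.

Lemma pupX t g j : pv (kapp (pup ^+ t) g) (iter t (@ordS _) j) = up ^+ clen d j t *: pv g j.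
Proof.
elim: t => [|t IH]; first by rewrite /clen big_ord0 scale1r.
by rewrite exprS kappM iterS mk_kendE pup_funE IH scalerA -exprD clenS addnC.
Qed.

Lemma pdnX t g j : pv (kapp (pdn ^+ t) g) j =
  (algc (ccoef d j t) * dn ^+ clen d j t) *: pv g (iter t (@ordS _) j).
Proof.
elim: t g => [|t IH] g; first by rewrite /clen /ccoef !big_ord0 rmorph1 mul1r scale1r.
rewrite exprSr kappM iterS IH mk_kendE pdn_funE scalerA clenS ccoefS rmorphM exprD.
by rewrite -!mulrA (mulrA (dn ^+ _) (algc _)) -algcC -!mulrA.
Qed.

(** Checked on coordinates. The weight relations come from [dnupX] and [updnX], whose scalar [uprod]
    times [cc] is w by [cov_ok]; after l steps the exponent of up or dn is at least m. *)
Lemma pull_rel : cyc_rel w pE pup pdn.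
Proof.
have [ds dw dm] := d_ok.
split.
- move=> i j; apply: kend_eqP => g; rewrite -!/(kapp _ _) kappM !mk_kendE.
  apply: pv_ext => k; rewrite !pE_funE.
  case: (eqVneq i j) => [->|ij].
    by rewrite mk_kendE pE_funE; case: eqP.
  rewrite kapp0 pv0; case: eqP => // <-.
  by rewrite eq_sym (negbTE ij).
- apply: kend_eqP => g; rewrite -!/(kapp _ _) kapp_sum kapp1.
  apply: pv_ext => k; rewrite pv_sum (bigD1 k) //= pE_funE eqxx big1 ?addr0 // => i ik.
  by rewrite pE_funE (negbTE ik).
- move=> i; apply: kend_eqP => g; rewrite -!/(kapp _ _) !kappM !mk_kendE.
  apply: pv_ext => k; rewrite -[k]ord_predK pE_funE !pup_funE pE_funE.
  by rewrite (inj_eq (@ordS_inj _)); case: ifP => _ //; rewrite scaler0.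
- move=> i; apply: kend_eqP => g; rewrite -!/(kapp _ _) !kappM !mk_kendE.
  apply: pv_ext => k; rewrite pE_funE !pdn_funE pE_funE.
  by rewrite (inj_eq (@ordS_inj _)); case: ifP => _ //; rewrite scaler0.
- move=> i; apply: kend_eqP => g; rewrite -!/(kapp _ _) !kappM !mk_kendE.
  apply: pv_ext => k; rewrite kappc pvZ pdn_funE !pup_funE !pE_funE.
  case: (eqVneq i k) => [->|_]; last by rewrite !scaler0.
  rewrite -(pvE g) !scalerA -!mulrA (mulrA (dn ^+ _)) (dnupX R) mulrA -rmorphM.
  by rewrite dw.
- move=> i; apply: kend_eqP => g; rewrite -!/(kapp _ _) !kappM !mk_kendE.
  apply: pv_ext => k; rewrite -[k]ord_predK kappc pvZ pup_funE !pdn_funE !pE_funE.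
  rewrite (inj_eq (@ordS_inj _)).
  case: (eqVneq i _) => [->|_]; last by rewrite !scaler0.
  rewrite -(pvE g) -ds !scalerA -!mulrA (mulrA (up ^+ _)) -algcC.
  by rewrite -!mulrA (mulrA (up ^+ _)) (updnX R) mulrA -rmorphM dw.
- apply: kend_eqP => g; rewrite -!/(kapp _ _) kapp0; apply: pv_ext => k.
  (* Writing k as its own l-th successor puts the coordinate in the form of [pupX]. *)
  by rewrite -[k]iter_ordS_full pupX pv0 (upX0 R) ?dm // scale0r.
- apply: kend_eqP => g; rewrite -!/(kapp _ _) kapp0; apply: pv_ext => k.
  by rewrite pdnX pv0 (dnX0 R) ?dm // mulr0 scale0r.
Qed.

End Pull.

Section PullModule.
Variables (K : comNzRingType) (A A' : pzAlgType K).
Variables (m : nat) (u : 'I_m -> K) (l : nat) (w : 'I_l -> K).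
Variables (CA : cyc_alg A u) (CA' : cyc_alg A' w) (d : covering K m l).
Hypothesis d_ok : cov_ok u w d.
Implicit Types M N : lmodType A.

Definition pull_rho M : {rmorphism A' -> kend (pull M (cE CA) d)} :=
  sval (c_lift CA' (pull_rel M (c_rel CA) d_ok)).
Definition pullmod M : lmodType A' := act_mod (pull_rho M).

(** Later arguments compute with these coordinates: [ev_ext] and the rules for scalars, E, up and dn
    hide how the action was obtained from [c_lift]. *)
Definition ev M (g : pullmod M) (j : 'I_l) : M := @pv K A M m (cE CA) l d g j.

Lemma evD M (g h : pullmod M) j : ev (g + h) j = ev g j + ev h j.
Proof. exact: pvD. Qed.
Lemma ev0 M j : ev (0 : pullmod M) j = 0.
Proof. exact: pv0. Qed.
Lemma ev_sum M I r (P : pred I) (F : I -> pullmod M) j :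
  ev (\sum_(i <- r | P i) F i) j = \sum_(i <- r | P i) ev (F i) j.
Proof. by apply: (big_morph (fun g => @ev M g j)) => [x y|]; rewrite ?evD ?ev0. Qed.
Lemma ev_ext M (g h : pullmod M) : (forall j, ev g j = ev h j) -> g = h.
Proof. exact: pv_ext. Qed.
Lemma evE M (g : pullmod M) j : cE CA (cs d j) *: ev g j = ev g j.
Proof. exact: pvE. Qed.
Definition mkp M (f : 'I_l -> M) (hf : forall j, cE CA (cs d j) *: f j = f j) : pullmod M :=
  mk_pull hf.
Lemma mkpE M (f : 'I_l -> M) (hf : forall j, cE CA (cs d j) *: f j = f j) j :
  ev (mkp hf) j = f j.
Proof. exact: mk_pullE. Qed.

Lemma ev_c M c (g : pullmod M) j : ev ((algc c : A') *: g) j = (algc c : A) *: ev g j.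
Proof.
rewrite /ev actmodE /pull_rho; case: c_lift => phi [hc _ _ _] /=.
by rewrite hc kappc pvZ.
Qed.
Lemma ev_E M i (g : pullmod M) j : ev (cE CA' i *: g) j = if i == j then ev g j else 0.
Proof.
rewrite /ev actmodE /pull_rho; case: c_lift => phi [_ hE _ _] /=.
by rewrite hE mk_kendE pE_funE.
Qed.
Lemma ev_up M (g : pullmod M) j : ev (cup CA' *: g) (ordS j) = cup CA ^+ ce d j *: ev g j.
Proof.
rewrite /ev actmodE /pull_rho; case: c_lift => phi [_ _ hu _] /=.
by rewrite hu mk_kendE pup_funE.
Qed.
Lemma ev_dn M (g : pullmod M) j :
  ev (cdn CA' *: g) j = (algc (cc d j) * cdn CA ^+ ce d j) *: ev g (ordS j).
Proof.
rewrite /ev actmodE /pull_rho; case: c_lift => phi [_ _ _ hd] /=.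
by rewrite hd mk_kendE pdn_funE.
Qed.

Lemma ev_upX M t (g : pullmod M) j :
  ev (cup CA' ^+ t *: g) (iter t (@ordS _) j) = cup CA ^+ clen d j t *: ev g j.
Proof.
rewrite /ev actmodE /pull_rho; case: c_lift => phi [_ _ hu _] /=.
by rewrite rmorphXn /= hu pupX.
Qed.
Lemma ev_dnX M t (g : pullmod M) j : ev (cdn CA' ^+ t *: g) j =
  (algc (ccoef d j t) * cdn CA ^+ clen d j t) *: ev g (iter t (@ordS _) j).
Proof.
rewrite /ev actmodE /pull_rho; case: c_lift => phi [_ _ _ hd] /=.
by rewrite rmorphXn /= hd pdnX.
Qed.

End PullModule.

(** * Linear maps and the functor of a covering *)

Section CyclicHom.
Variables (K : comNzRingType) (A : pzAlgType K) (m : nat) (u : 'I_m -> K).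
Variables (CA : cyc_alg A u) (U V : lmodType A) (f : U -> V).
Hypotheses (fD : forall x y, f (x + y) = f x + f y)
  (fc : forall c x, f ((algc c : A) *: x) = (algc c : A) *: f x)
  (fE : forall i x, f (cE CA i *: x) = cE CA i *: f x)
  (fup : forall x, f (cup CA *: x) = cup CA *: f x)
  (fdn : forall x, f (cdn CA *: x) = cdn CA *: f x).

Definition cyc_hom_fun := f.

(** The elements of A that commute with f are closed under sums and products, so [c_gen] reduces the
    claim to the generators. *)
Fact cyc_hom_linear : linear cyc_hom_fun.
Proof.
move=> a x y; rewrite /cyc_hom_fun fD; congr (_ + _); move: a x.
apply: (@c_gen _ _ _ _ CA (fun a => forall x, f (a *: x) = a *: f x)); first exact: fc.
- by move=> a b ha hb x; rewrite !scalerDl fD ha hb.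
- by move=> a b ha hb x; rewrite -!scalerA ha hb.
by move=> g [[i ->]|->|->] x.
Qed.
HB.instance Definition _ := GRing.isLinear.Build A U V *:%R cyc_hom_fun cyc_hom_linear.
Definition cyc_hom : {linear U -> V} := cyc_hom_fun.
End CyclicHom.

Section InverseLinear.
Variables (A : pzRingType) (U V : lmodType A) (f : {linear U -> V}) (g : V -> U).
Hypotheses (fK : cancel f g) (gK : cancel g f).
Definition inv_hom_fun := g.
Fact inv_hom_linear : linear inv_hom_fun.
Proof. by move=> a x y; apply: (can_inj fK); rewrite /inv_hom_fun linearP !gK. Qed.
HB.instance Definition _ := GRing.isLinear.Build A V U *:%R inv_hom_fun inv_hom_linear.
Definition inv_hom : {linear V -> U} := inv_hom_fun.
End InverseLinear.

Section PullFunctor.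
Variables (K : comNzRingType) (A A' : pzAlgType K).
Variables (m : nat) (u : 'I_m -> K) (l : nat) (w : 'I_l -> K).
Variables (CA : cyc_alg A u) (CA' : cyc_alg A' w) (d : covering K m l).
Hypothesis d_ok : cov_ok u w d.
Local Notation F := (pullmod CA CA' d_ok).

Definition pull_map (M N : lmodType A) (f : {linear M -> N}) (g : F M) : F N.
Proof.
by apply: (@mkp _ _ _ _ _ _ _ CA CA' d d_ok N (fun j => f (ev g j))) => j; rewrite -linearZ /= evE.
Defined.
Lemma pull_mapE M N f g j : ev (@pull_map M N f g) j = f (ev g j).
Proof. exact: mkpE. Qed.

Definition pull_hom (M N : lmodType A) (f : {linear M -> N}) : {linear F M -> F N}.
Proof.
apply: (@cyc_hom _ _ _ _ CA' _ _ (pull_map f)).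
- by move=> x y; apply: ev_ext => j; rewrite evD !pull_mapE evD linearD.
- by move=> c x; apply: ev_ext => j; rewrite ev_c !pull_mapE ev_c linearZ.
- move=> i x; apply: ev_ext => j; rewrite ev_E !pull_mapE ev_E.
  by case: ifP => //; rewrite linear0.
- by move=> x; apply: ev_ext => j; rewrite -[j]ord_predK ev_up !pull_mapE ev_up linearZ.
- by move=> x; apply: ev_ext => j; rewrite ev_dn !pull_mapE ev_dn linearZ.
Defined.
Lemma pull_homE M N f g j : ev (@pull_hom M N f g) j = f (ev g j).
Proof. exact: mkpE. Qed.

Definition pull_functor : functor (mod_cat A) (mod_cat A').
Proof.
apply: (@Functor (mod_cat A) (mod_cat A') F pull_hom).
- move=> M; apply: linear_eqP => g; apply: (@ev_ext _ _ _ _ _ _ _ CA CA' d d_ok) => j.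
  by rewrite pull_homE.
- move=> M N L f h; apply: linear_eqP => g.
  by apply: (@ev_ext _ _ _ _ _ _ _ CA CA' d d_ok) => j; rewrite /= !pull_homE.
Defined.

Lemma pull_klinear : klinear pull_functor.
Proof.
move=> U V c f g h hE F1 y; apply: (@ev_ext _ _ _ _ _ _ _ CA CA' d d_ok) => j.
by rewrite /F1 /= evD ev_c !pull_homE hE.
Qed.

Lemma cov_iter j t : iter (clen d j t) (@ordS _) (cs d j) = cs d (iter t (@ordS _) j).
Proof.
have [ds _ _] := d_ok; elim: t => [|t IH]; first by rewrite /clen big_ord0.
by rewrite clenS addnC iterD IH ds.
Qed.

End PullFunctor.

(* These conditions make the maps up ^ (del q) from E_(cs d1 (cs d2 q)) to E_q an
   isomorphism from the doubly pulled-back module to M. *)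
Record comp_ok (K : comNzRingType) m l (u : 'I_m -> K) (d1 : covering K m l)
    (d2 : covering K l m) (del : 'I_m -> nat) (kinv : 'I_m -> K) : Prop := CompOk {
  comp_s : forall q, iter (del q) (@ordS _) (cs d1 (cs d2 q)) = q;
  comp_u : forall q, kinv q * uprod u (cs d1 (cs d2 q)) (del q) = 1;
  comp_up : forall q, (del (ordS q) + clen d1 (cs d2 q) (ce d2 q) = (del q).+1)%N;
  comp_dn : forall q,
    (clen d1 (cs d2 q) (ce d2 q) = 0%N /\
     cc d2 q * ccoef d1 (cs d2 q) (ce d2 q) = u q) \/
    (del (ordS q) = 0%N /\ cc d2 q * ccoef d1 (cs d2 q) (ce d2 q) *
       uprod u (cs d1 (cs d2 q)) (del q) = 1)
}.

Lemma algc_mulACA (K : comNzRingType) (A : pzAlgType K) (a b : K) (x y : A) :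
  algc a * x * (algc b * y) = algc (a * b) * (x * y).
Proof. by rewrite rmorphM !mulrA -(mulrA _ x) -(algcC b x) !mulrA. Qed.

(** * The composite of two coverings *)

Section Composite.
Variables (K : comNzRingType) (A A' : pzAlgType K).
Variables (m : nat) (u : 'I_m -> K) (l : nat) (w : 'I_l -> K).
Variables (CA : cyc_alg A u) (CA' : cyc_alg A' w).
Variables (d1 : covering K m l) (d2 : covering K l m).
Hypotheses (ok1 : cov_ok u w d1) (ok2 : cov_ok w u d2).
Variables (del : 'I_m -> nat) (kinv : 'I_m -> K).
Hypothesis ok : comp_ok u d1 d2 del kinv.
Local Notation F := (pullmod CA CA' ok1).
Local Notation G := (pullmod CA' CA ok2).
Local Notation R := (c_rel CA).

Section OneModule.
Variable M : lmodType A.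
Implicit Type g : G (F M).

(** The element [ev g q] of F M is fixed by the idempotent at [cs d2 q], so all its other
    coordinates are zero ([ev2E]) and this one determines it. *)
Definition corner g q : M := ev (ev g q) (cs d2 q).

Lemma corner_E g q : cE CA (cs d1 (cs d2 q)) *: corner g q = corner g q.
Proof. exact: evE. Qed.

Lemma ev2E g q j : ev (ev g q) j = if cs d2 q == j then corner g q else 0.
Proof. by rewrite -[in LHS](evE g q) ev_E; case: eqP => // <-. Qed.

Definition lifted g q : M := cup CA ^+ del q *: corner g q.

Lemma lifted_E g q : cE CA q *: lifted g q = lifted g q.
Proof.
by rewrite /lifted scalerA -{1}(comp_s ok q) -(upXE R) -scalerA corner_E.
Qed.

Definition glue g : M := \sum_q lifted g q.

Lemma glue_E g q : cE CA q *: glue g = lifted g q.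
Proof.
rewrite /glue scaler_sumr (bigD1 q) //= lifted_E big1 ?addr0 // => i iq.
by rewrite -lifted_E scalerA (cycE R) eq_sym (negbTE iq) scale0r.
Qed.

Lemma lifted_up g q : lifted (cup CA *: g) (ordS q) = cup CA *: lifted g q.
Proof.
have [s2E _ _] := ok2; rewrite /lifted /corner ev_up -s2E ev_upX !scalerA -exprD.
by rewrite (comp_up ok) exprS.
Qed.

(** In the first case of [comp_dn] the composed step is empty, and both sides are [u q] times up ^
    (del q) of the same corner. In the second, dn descends del q + 1 steps and up climbs back del q
    of them; the weight of these del q steps is cancelled by the coefficient, and a single dn is
    left. *)
Lemma lifted_dn g q : lifted (cdn CA *: g) q = cdn CA *: lifted g (ordS q).
Proof.
have [s2E _ _] := ok2.
rewrite /lifted {1}/corner ev_dn -scalerA ev_c ev_dnX s2E -/(corner g (ordS q)).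
rewrite !scalerA -algcC algc_mulACA.
have := comp_up ok q; case: (comp_dn ok q) => [[e0 cE0]|[e0 cE0]].
- rewrite e0 addn0 => ->; rewrite expr0 mulr1 cE0.
  have sE : cs d1 (cs d2 (ordS q)) = cs d1 (cs d2 q).
    by rewrite -s2E -(cov_iter ok1) e0.
  rewrite -corner_E sE !scalerA exprS -!mulrA (upXE R) (comp_s ok).
  by rewrite !mulrA (cyc_dnup R).
- rewrite e0 add0n => ->; rewrite expr0 mulr1.
  have sE : cs d1 (cs d2 (ordS q)) = ordS q by have := comp_s ok (ordS q); rewrite e0.
  rewrite -corner_E sE !scalerA exprSr -!mulrA -(cyc_dn R).
  have h := updnX R (cs d1 (cs d2 q)) (del q); rewrite (comp_s ok) in h.
  rewrite (mulrA (cdn CA ^+ _)) (mulrA (cup CA ^+ _)) (mulrA (cup CA ^+ _)) h.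
  by rewrite !mulrA -rmorphM cE0 rmorph1 mul1r.
Qed.

Lemma reindex_ordS (f : 'I_m -> M) : \sum_q f q = \sum_q f (ordS q).
Proof. by rewrite (reindex_inj (@ordS_inj m)). Qed.

Definition glue_hom : {linear G (F M) -> M}.
Proof.
apply: (@cyc_hom _ _ _ _ CA _ _ glue).
- move=> x y; rewrite /glue -big_split; apply: eq_bigr => q _ /=.
  by rewrite /lifted /corner !evD scalerDr.
- move=> c x; rewrite /glue scaler_sumr; apply: eq_bigr => q _ /=.
  by rewrite /lifted /corner !ev_c !scalerA algcC.
- move=> i x; rewrite glue_E /glue (bigD1 i) //= big1 => [|q qi].
    by rewrite addr0 /lifted /corner ev_E eqxx.
  by rewrite /lifted /corner ev_E eq_sym (negbTE qi) ev0 scaler0.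
- move=> x; rewrite /glue scaler_sumr reindex_ordS; apply: eq_bigr => q _.
  exact: lifted_up.
- move=> x; rewrite /glue scaler_sumr [RHS]reindex_ordS; apply: eq_bigr => q _.
  exact: lifted_dn.
Defined.
Lemma glue_homE g : glue_hom g = glue g. Proof. by []. Qed.

(** On the image of E_q, [kinv q] times dn ^ (del q) inverts the climb up ^ (del q), by [dnupX],
    [updnX] and [comp_u]. *)
Definition cut_val (x : M) q (j : 'I_l) : M :=
  if cs d2 q == j then (algc (kinv q) * cdn CA ^+ del q * cE CA q) *: x else 0.

Fact cut_val1 x q j : cE CA (cs d1 j) *: cut_val x q j = cut_val x q j.
Proof.
rewrite /cut_val; case: eqP => [<-|_]; last by rewrite scaler0.
by rewrite scalerA !mulrA -algcC -(mulrA _ _ (cdn CA ^+ _)) (dnXE R) (comp_s ok)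
  -!mulrA (cycE R) eqxx.
Qed.

Definition cut1 x q : F M := mkp CA' ok1 (cut_val1 x q).
Fact cut_val2 x q : cE CA' (cs d2 q) *: cut1 x q = cut1 x q.
Proof.
apply: ev_ext => j; rewrite ev_E !mkpE /cut_val.
by case: eqP => // ->; rewrite eqxx.
Qed.
Definition cut x : G (F M) := mkp CA ok2 (cut_val2 x).

Lemma cutE x q j : ev (ev (cut x) q) j = cut_val x q j.
Proof. by rewrite !mkpE. Qed.

Lemma glueK : cancel glue_hom cut.
Proof.
move=> g; apply: ev_ext => q; apply: ev_ext => j; rewrite cutE ev2E /cut_val glue_homE.
case: eqP => // _; rewrite -scalerA glue_E /lifted -corner_E !scalerA -!mulrA.
by rewrite (mulrA (cdn CA ^+ _)) (dnupX R) mulrA -rmorphM (comp_u ok) rmorph1 mul1r.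
Qed.

Lemma cutK : cancel cut glue_hom.
Proof.
move=> x; rewrite glue_homE /glue -[RHS]scale1r -(cyc1 R) scaler_suml.
apply: eq_bigr => q _; rewrite /lifted /corner cutE /cut_val eqxx scalerA !mulrA.
rewrite -algcC -!mulrA (mulrA (cup CA ^+ _)).
have := updnX R (cs d1 (cs d2 q)) (del q); rewrite (comp_s ok) => ->.
by rewrite mulrA -rmorphM (comp_u ok) rmorph1 mul1r.
Qed.

Definition cut_hom : {linear M -> G (F M)} := inv_hom glueK cutK.
Lemma cut_homE x : cut_hom x = cut x. Proof. by []. Qed.

End OneModule.

Lemma glue_nat (M N : lmodType A) (f : {linear M -> N}) g :
  glue_hom N (pull_hom CA' CA ok2 (pull_hom CA CA' ok1 f) g) = f (glue_hom M g).
Proof.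
rewrite !glue_homE /glue linear_sum; apply: eq_bigr => q _.
by rewrite /lifted /corner !pull_homE linearZ.
Qed.

Lemma comp_natiso :
  nat_isomorphic (fun_comp (pull_functor CA' CA ok2) (pull_functor CA CA' ok1))
    (fun_id (mod_cat A)).
Proof.
constructor; unshelve refine (@NatIso (mod_cat A) (mod_cat A)
  (fun_comp (pull_functor CA' CA ok2) (pull_functor CA CA' ok1)) (fun_id (mod_cat A))
  glue_hom cut_hom _ _ _).
- by move=> M N f; apply: linear_eqP => g; apply: glue_nat.
- by move=> M; apply: linear_eqP => g; apply: glueK.
- by move=> M; apply: linear_eqP => g; apply: cutK.
Qed.

End Composite.

(** Exchanging the coverings turns one natural isomorphism into the other, whence the two [comp_ok]
    hypotheses. *)
Theorem cyc_morita (K : comNzRingType) (A A' : pzAlgType K) m (u : 'I_m -> K)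
    l (w : 'I_l -> K) (d1 : covering K m l) (d2 : covering K l m) del kinv del' kinv' :
  cyc_alg A u -> cyc_alg A' w -> cov_ok u w d1 -> cov_ok w u d2 ->
  comp_ok u d1 d2 del kinv -> comp_ok w d2 d1 del' kinv' ->
  morita_equivalent A A'.
Proof.
move=> CA CA' ok1 ok2 c1 c2; exists (pull_functor CA CA' ok1).
  exact: pull_klinear.
exists (pull_functor CA' CA ok2); split; [exact: comp_natiso c1|exact: comp_natiso c2].
Qed.

(** * Finite generation *)

Section FiniteGeneration.
Variables (K : comNzRingType) (A : pzAlgType K).

Definition span_closed (Sc : A -> Prop) (M : lmodType A) (P : M -> Prop) : Prop :=
  [/\ P 0, forall x y, P x -> P y -> P (x + y) & forall a x, Sc a -> P x -> P (a *: x)].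

(** With [Sc] everything this is generation as an A-module, with [scalars] it is spanning over K;
    the common form lets one pass between the two. *)
Definition generates (Sc : A -> Prop) (M : lmodType A) (s : seq M) : Prop :=
  forall P : M -> Prop, span_closed Sc P -> (forall x, x \in s -> P x) -> forall x, P x.

Definition scalars (a : A) : Prop := exists c, a = algc c.

Lemma fg_generates M : finitely_generated M <-> exists s, @generates (fun=> True) M s.
Proof.
split=> -[s sM]; exists s.
  move=> P [P0 PD PZ] Ps x; have [c ->] := sM x.
  by apply: (big_ind P) => // i _; apply: PZ => //; apply/Ps/mem_nth.
apply: sM => [|x xs]; last first.
  exists (fun i => if i == index x s then 1 else 0).
  have xs' : (index x s < size s)%N by rewrite index_mem.
  rewrite (bigD1 (Ordinal xs')) //= eqxx scale1r nth_index // big1 ?addr0 //.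
  by move=> i; rewrite -val_eqE /= => /negbTE ->; rewrite scale0r.
split.
- by exists (fun=> 0); rewrite big1 // => i _; rewrite scale0r.
- move=> x y [c ->] [c' ->]; exists (fun i => c i + c' i).
  by rewrite -big_split; apply: eq_bigr => i _; rewrite scalerDl.
- move=> a x _ [c ->]; exists (fun i => a * c i).
  by rewrite scaler_sumr; apply: eq_bigr => i _; rewrite scalerA.
Qed.

Variables (m : nat) (u : 'I_m -> K) (CA : cyc_alg A u).
Local Notation R := (c_rel CA).
Local Notation E := (cE CA).
Local Notation up := (cup CA).
Local Notation dn := (cdn CA).

Lemma iter_ordS_surj t (i : 'I_m) : exists j, i = iter t (@ordS _) j.
Proof.
elim: t => [|t [j jE]]; first by exists i.
by exists (ord_pred j); rewrite iterSr ord_predK.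
Qed.

(** The bound t <= m, rather than t < m, leaves room to lengthen a word once before it is known to
    vanish. *)
Definition word (a : A) : Prop :=
  exists t i, (t <= m)%N /\ (a = up ^+ t * E i \/ a = dn ^+ t * E i).

(** An idempotent keeps or kills a word; a letter of the same direction lengthens it, or kills it
    beyond m; a letter of the opposite direction cancels one letter and leaves a weight. *)
Lemma word_mul g a : [\/ exists i, g = E i, g = up | g = dn] -> word a ->
  exists c b, word b /\ g * a = algc c * b.
Proof.
move=> hg [t [i [tm ha]]].
have m0 : (0 < m)%N by apply: leq_ltn_trans (ltn_ord i).
have zero : g * a = 0 -> exists c b, word b /\ g * a = algc c * b.
  by move=> ->; exists 0, a; split; [exists t, i|rewrite rmorph0 mul0r].
have wup t' i' : (t' <= m)%N -> word (up ^+ t' * E i').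
  by move=> tm'; exists t', i'; split=> //; left.
have wdn t' i' : (t' <= m)%N -> word (dn ^+ t' * E i').
  by move=> tm'; exists t', i'; split=> //; right.
have one b : word b -> g * a = b -> exists c b, word b /\ g * a = algc c * b.
  by move=> wb ->; exists 1, b; rewrite rmorph1 mul1r.
case: hg => [[j gE]|gE|gE]; case: ha => aE; rewrite gE aE in zero one *.
- move: zero one; rewrite (upXE R) mulrA (cycE R).
  case: eqP => [->|_] zero one; last by apply: zero; rewrite mul0r.
  by apply: one erefl; rewrite -(upXE R); apply: wup.
- move: zero one; rewrite mulrA (dnXE R) -mulrA (cycE R).
  case: eqP => [->|_] zero one; last by apply: zero; rewrite mulr0.
  by apply: one erefl; apply: wdn.
- move: zero one; rewrite mulrA -exprS; case: (ltnP t m) => mt zero one.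
    by apply: one erefl; apply: wup.
  by apply: zero; rewrite (upX0 R) ?mul0r // ltnW.
- case: t tm aE zero one => [|t] tm aE zero one.
    by apply: (one (up ^+ 1 * E i)); [apply: wup|rewrite mul1r].
  have [j ij] := iter_ordS_surj t.+1 i; exists (u j), (dn ^+ t * E i).
  split; first by apply: wdn; apply: ltnW.
  rewrite ij exprS iterSr -mulrA -(dnXE R) !mulrA (cyc_updn R).
  by rewrite -!mulrA (dnXE R).
- case: t tm aE zero one => [|t] tm aE zero one.
    by apply: (one (dn ^+ 1 * E i)); [apply: wdn|rewrite mul1r].
  exists (u (iter t (@ordS _) i)), (up ^+ t * E i).
  split; first by apply: wup; apply: ltnW.
  by rewrite exprS -mulrA (upXE R) !mulrA (cyc_dnup R).
- move: zero one; rewrite mulrA -exprS; case: (ltnP t m) => mt zero one.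
    by apply: one erefl; apply: wdn.
  by apply: zero; rewrite (dnX0 R) ?mul0r // ltnW.
Qed.

Definition words : seq A :=
  [seq up ^+ t * E i | t <- iota 0 m.+1, i <- enum 'I_m] ++
  [seq dn ^+ t * E i | t <- iota 0 m.+1, i <- enum 'I_m].

Lemma wordsP a : reflect (word a) (a \in words).
Proof.
rewrite mem_cat; apply: (iffP orP) => [[] /allpairsP[[t i] [ht _ ->]]|].
- by exists t, i; split; [move: ht; rewrite mem_iota ltnS|left].
- by exists t, i; split; [move: ht; rewrite mem_iota ltnS|right].
case=> t [i [tm [->|->]]]; [left|right]; apply/allpairsP; exists (t, i);
  by rewrite mem_iota mem_enum ltnS tm.
Qed.

(* A is spanned over K by [words], so that M is spanned by [words * s]. *)
Lemma generates_scalars (M : lmodType A) :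
  (exists s, @generates (fun=> True) M s) <-> exists s, @generates scalars M s.
Proof.
split=> -[s sM]; last first.
  by exists s => P [P0 PD PZ]; apply: sM; split=> // a x _; apply: PZ.
pose s' := [seq w *: x | w <- words, x <- s].
(* [Q x] says that x lies in the K-span of [s']. It remains to see that this span is stable under A,
   which [c_gen] and [word_mul] reduce to single generators acting on words. *)
exists s'; pose Q (x : M) := forall P : M -> Prop,
  span_closed scalars P -> (forall x, x \in s' -> P x) -> P x.
suff QT x : Q x by move=> P Pcl Ps x; apply: QT.
have [Q0 QD QZ] : span_closed scalars Q.
  split=> [P []|x0 y Qx Qy P Pcl Ps|a x0 Sa Qx P Pcl Ps] //.
    by have [_ PD _] := Pcl; apply: PD; [apply: Qx|apply: Qy].
  by have [_ _ PZ] := Pcl; apply: PZ => //; apply: Qx.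
have Qw w y : word w -> y \in s -> Q (w *: y).
  by move=> /wordsP ww ys P _; apply; apply/allpairsP; exists (w, y).
apply: (sM Q) => [|y ys]; last first.
  rewrite -[y]scale1r -(cyc1 R) scaler_suml; apply: (big_ind Q) => // i _.
  by rewrite -[E i]mul1r; apply: Qw => //; exists 0%N, i; split=> //; left.
split=> // a y _; move: y; have := @c_gen _ _ _ _ CA (fun a => forall y, Q y -> Q (a *: y)).
apply=> [c y|b c Qb Qc y Qy|b c Qb Qc y Qy|g gG y Qy]; first by apply: QZ; exists c.
- by rewrite scalerDl; apply: QD; auto.
- by rewrite -scalerA; auto.
apply: (Qy (fun y => Q (g *: y))) => [|z /allpairsP[[w v] /= [/wordsP ww vs ->]]].
  split=> [|z t Qz Qt|_ z [c ->] Qz]; first by rewrite scaler0.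
    by rewrite scalerDr; apply: QD.
  by rewrite scalerA -algcC -scalerA; apply: QZ => //; exists c.
have [c [b [wb e]]] := word_mul gG ww.
by rewrite scalerA e -scalerA; apply: QZ; [exists c|apply: Qw].
Qed.

End FiniteGeneration.

Section PullGeneration.
Variables (K : comNzRingType) (A A' : pzAlgType K).
Variables (m : nat) (u : 'I_m -> K) (l : nat) (w : 'I_l -> K).
Variables (CA : cyc_alg A u) (CA' : cyc_alg A' w) (d : covering K m l).
Hypothesis d_ok : cov_ok u w d.
Local Notation F := (pullmod CA CA' d_ok).
Local Notation R := (c_rel CA).
Variable M : lmodType A.

Fact delta_subproof (j : 'I_l) (x : M) (i : 'I_l) :
  cE CA (cs d i) *: (if j == i then cE CA (cs d i) *: x else 0) =
  if j == i then cE CA (cs d i) *: x else 0.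
Proof. by case: eqP; rewrite ?scaler0 // scalerA (cycE R) eqxx. Qed.
Definition delta j x : F M := mkp CA' d_ok (delta_subproof j x).
Lemma deltaE j x i : ev (delta j x) i = if j == i then cE CA (cs d i) *: x else 0.
Proof. exact: mkpE. Qed.

Lemma deltaD j x y : delta j (x + y) = delta j x + delta j y.
Proof.
apply: ev_ext => i; rewrite evD !deltaE scalerDr.
by case: eqP; rewrite ?addr0.
Qed.
Lemma deltaZ j c x : delta j ((algc c : A) *: x) = (algc c : A') *: delta j x.
Proof.
apply: ev_ext => i; rewrite ev_c !deltaE.
by case: eqP; rewrite ?scaler0 // !scalerA algcC.
Qed.
Lemma delta0 j : delta j 0 = 0.
Proof. by apply: ev_ext => i; rewrite ev0 deltaE scaler0; case: eqP. Qed.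
Lemma sum_delta g : g = \sum_j delta j (ev g j).
Proof.
apply: ev_ext => i; rewrite ev_sum (bigD1 i) //= deltaE eqxx evE big1 ?addr0 // => j ji.
by rewrite deltaE (negbTE ji).
Qed.

(** Being spanned by finitely many elements over K does not involve the algebra, so finiteness
    passes from A to A' through K: placing the elements of a spanning family of M at each j spans
    the pulled-back module. *)
Lemma pull_fg : finitely_generated M -> finitely_generated (F M).
Proof.
move=> /fg_generates/(generates_scalars CA)[s sM].
apply/fg_generates/(generates_scalars CA').
exists [seq delta j x | j <- enum 'I_l, x <- s] => P [P0 PD PZ] Ps g.
rewrite [g]sum_delta; apply: (big_ind P) => // j _.
apply: (sM (fun x => P (delta j x))) => [|x xs]; last first.
  by apply/Ps/allpairs_f; rewrite ?mem_enum.
split=> [|x y|_ x [c ->]]; first by rewrite delta0.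
  by rewrite deltaD; apply: PD.
by rewrite deltaZ; apply: PZ; exists c.
Qed.

End PullGeneration.

(** * Gradings and the graded equivalence *)

Section Decomposition.
Variables (K : comNzRingType) (A : pzAlgType K) (M : lmodType A) (C : int -> M -> Prop).
Hypothesis Csub : forall j, ksubspace (C j).

Lemma ksub0 j : C j 0. Proof. by case: (Csub j). Qed.
Lemma ksubD j x y : C j x -> C j y -> C j (x + y).
Proof. by case: (Csub j) => _ h hx hy; have := h 1 _ _ hx hy; rewrite rmorph1 scale1r. Qed.
Lemma ksubZ j c x : C j x -> C j ((algc c : A) *: x).
Proof. by case: (Csub j) => h0 h hx; have := h c _ _ hx h0; rewrite addr0. Qed.

Definition homog_span (x : M) : Prop := forall P : M -> Prop,
  P 0 -> (forall y z, P y -> P z -> P (y + z)) -> (forall j y, C j y -> P y) -> P x.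

(** A sum of homogeneous elements may repeat degrees; collecting equal degrees yields the single
    function of the degree that [direct_decomposition] asks for. *)
Lemma homog_spanP x : homog_span x ->
  exists (s : seq int) (y : int -> M), (forall j, C j (y j)) /\ x = \sum_(j <- s) y j.
Proof.
move=> hx; suff [L [CL ->]] : exists L : seq (int * M), (forall t, t \in L -> C t.1 t.2)
    /\ x = \sum_(t <- L) t.2.
  exists (undup (map fst L)), (fun j => \sum_(t <- L | t.1 == j) t.2); split.
    move=> j; rewrite big_seq_cond; apply: (big_ind (C j)).
    - exact: ksub0.
    - exact: ksubD.
    - by move=> t /andP[/CL Ct /eqP <-].
  rewrite (exchange_big_dep xpredT) //= big_seq_cond [RHS]big_seq_cond.
  apply: eq_bigr => t /andP[tL _].
  rewrite big_mkcond (bigD1_seq t.1) ?undup_uniq ?mem_undup ?map_f //= eqxx.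
  by rewrite big1 ?addr0 // => j; rewrite eq_sym => /negbTE ->.
apply: (hx (fun x => exists L : seq (int * M), (forall t, t \in L -> C t.1 t.2)
    /\ x = \sum_(t <- L) t.2)) => [|y z [L1 [C1 ->]] [L2 [C2 ->]]|j y Cy].
- by exists [::]; rewrite big_nil.
- exists (L1 ++ L2); rewrite big_cat; split=> // t; rewrite mem_cat => /orP[]; auto.
- by exists [:: (j, y)]; rewrite big_seq1; split=> // t; rewrite inE => /eqP ->.
Qed.

Lemma direct_span : direct_decomposition C -> forall x, homog_span x.
Proof.
move=> [_ C2 _] x P P0 PD PC; have [s [y [Cy ->]]] := C2 x.
by apply: (big_ind P) => // j _; apply: PC (Cy j).
Qed.

(** Independence for summands labelled by something other than their degree, as happens on
    pulled-back modules, where the label is the new degree and [deg] the old one. *)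
Lemma direct_inj (T : eqType) (s : seq T) (deg : T -> int) (y : T -> M) :
  direct_decomposition C -> uniq s -> {in s &, injective deg} ->
  (forall t, t \in s -> C (deg t) (y t)) -> \sum_(t <- s) y t = 0 ->
  forall t, t \in s -> y t = 0.
Proof.
move=> [_ _ C3] us dinj Cy y0.
pose z j := \sum_(t <- s | deg t == j) y t.
have zE t : t \in s -> z (deg t) = y t.
  move=> ts; rewrite /z big_mkcond (bigD1_seq t) //= eqxx big1_seq ?addr0 // => t'.
  case/andP=> t't t's; case: eqP => // /dinj; rewrite t's => /(_ isT ts) /eqP.
  by rewrite (negbTE t't).
have Cz j : C j (z j).
  rewrite /z big_seq_cond; apply: (big_ind (C j)).
  - exact: ksub0.
  - exact: ksubD.
  - by move=> t /andP[/Cy Ct /eqP <-].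
have := C3 (map deg s) z; rewrite map_inj_in_uniq // => /(_ us Cz).
rewrite big_map (eq_big_seq y) // => /(_ y0) h t ts.
by rewrite -zE // h // map_f.
Qed.

End Decomposition.

(* [S j i] says that the component of degree j may be nonzero at E_i. *)
Definition cyc_graded (K : comNzRingType) (A : pzAlgType K) m (u : 'I_m -> K)
    (CA : cyc_alg A u) (du : int) (S : int -> 'I_m -> Prop)
    (M : lmodType A) (C : int -> M -> Prop) : Prop :=
  forall j x, C j x -> [/\ C (j + du) (cup CA *: x), C (j - du) (cdn CA *: x),
    forall i, C j (cE CA i *: x) & forall i, ~ S j i -> cE CA i *: x = 0].

(* [R j D m]: the degree D at the vertex [cs d j] becomes the degree m at j. *)
Record graded_covering (K : comNzRingType) m l (d : covering K m l)
    (du du' step step' : int) (S : int -> 'I_m -> Prop) (S' : int -> 'I_l -> Prop)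
    (R : 'I_l -> int -> int -> Prop) : Prop := GradedCovering {
  gcov_inj : forall j D D' m, R j D m -> R j D' m -> D = D';
  gcov_fun : forall j D m m', R j D m -> R j D m' -> m = m';
  gcov_surj : forall j D, S D (cs d j) -> exists m, R j D m;
  gcov_supp : forall j D m, R j D m -> S' m j;
  gcov_up : forall j D m, R j D m -> R (ordS j) (D + du *+ ce d j) (m + du');
  gcov_dn : forall j D m, R (ordS j) D m -> R j (D - du *+ ce d j) (m - du');
  gcov_shift : forall j D m i, R j D m -> R j (D + step * i) (m + step' * i)
}.

Section CycGraded.
Variables (K : comNzRingType) (A : pzAlgType K) (m : nat) (u : 'I_m -> K).
Variables (CA : cyc_alg A u) (du : int) (S : int -> 'I_m -> Prop).
Variables (M : lmodType A) (C : int -> M -> Prop).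
Hypothesis grC : cyc_graded CA du S C.

Lemma gr_upX j x e : C j x -> C (j + du *+ e) (cup CA ^+ e *: x).
Proof.
move=> Cx; elim: e => [|e IH]; first by rewrite addr0 scale1r.
by rewrite exprS -scalerA mulrSr addrA; have [] := grC IH.
Qed.
Lemma gr_dnX j x e : C j x -> C (j - du *+ e) (cdn CA ^+ e *: x).
Proof.
move=> Cx; elim: e => [|e IH]; first by rewrite subr0 scale1r.
by rewrite exprS -scalerA mulrSr opprD addrA; have [] := grC IH.
Qed.
End CycGraded.

Section GradedPull.
Variables (K : comNzRingType) (A A' : pzAlgType K).
Variables (m : nat) (u : 'I_m -> K) (l : nat) (w : 'I_l -> K).
Variables (CA : cyc_alg A u) (CA' : cyc_alg A' w) (d : covering K m l).
Hypothesis d_ok : cov_ok u w d.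
Variables (du du' step step' : int) (S : int -> 'I_m -> Prop) (S' : int -> 'I_l -> Prop).
Variables (R : 'I_l -> int -> int -> Prop).
Hypothesis Rok : graded_covering d du du' step step' S S' R.
Local Notation F := (pullmod CA CA' d_ok).

(** The alternative [ev g j = 0] covers the indices j at which no degree D corresponds to n. *)
Definition pull_comp (M : lmodType A) (C : int -> M -> Prop) (n : int) (g : F M) : Prop :=
  forall j, ev g j = 0 \/ exists2 D, R j D n & C D (ev g j).

Section OneModule.
Variables (M : lmodType A) (C : int -> M -> Prop).
Hypotheses (Cdir : direct_decomposition C) (grC : cyc_graded CA du S C).

Let Csub j : ksubspace (C j). Proof. by case: Cdir. Qed.

Lemma pull_comp_sub n : ksubspace (@pull_comp M C n).
Proof.
split=> [j|c x y Cx Cy j]; first by left; rewrite ev0.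
rewrite evD ev_c; case: (Cx j) => [->|[D RD CD]].
  by rewrite scaler0 add0r; apply: Cy.
right; exists D => //; apply: (ksubD Csub); first exact: (ksubZ Csub).
case: (Cy j) => [->|[D' RD' CD']]; first exact: (ksub0 Csub).
by rewrite (gcov_inj Rok RD RD').
Qed.

(** A homogeneous y placed at j is homogeneous by [gcov_surj], or it vanishes there because its
    degree is excluded at [cs d j]. Independence is tested at a fixed j, where distinct new degrees
    come from distinct old ones by [gcov_fun]. *)
Lemma pull_direct : direct_decomposition (@pull_comp M C).
Proof.
split; first exact: pull_comp_sub.
- move=> g; apply: (homog_spanP pull_comp_sub) => P P0 PD PC.
  rewrite [g]sum_delta; apply: (big_ind P) => // j _; move: (ev g j).
  have spanM := direct_span Cdir; move=> x; apply: (spanM x (fun x => P (delta CA CA' d_ok j x))).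
  + by rewrite delta0.
  + by move=> y z Py Pz; rewrite deltaD; apply: PD.
  move=> D y Cy; have [_ _ CE CS] := grC Cy.
  have [/(gcov_surj Rok)[n Rn]|nS] := pselect (S D (cs d j)).
    apply: (PC n) => i; rewrite deltaE; case: eqP => [<-|]; last by left.
    by right; exists D.
  suff -> : delta CA CA' d_ok j y = 0 by [].
  by apply: ev_ext => i; rewrite ev0 deltaE; case: eqP => // <-; apply: CS.
- move=> s x us Cx x0 n ns; apply: ev_ext => j; rewrite ev0.
  pose s' := [seq k <- s | ev (x k) j != 0].
  have [//|xn0] := eqVneq (ev (x n) j) 0.
  pose Q k D := R j D k /\ C D (ev (x k) j).
  (* The old degree is chosen for each k whose coordinate at j is nonzero; the default 0 is never
     met on [s']. *)
  pose deg k := if pselect (exists D, Q k D) is left e then sval (boolp.cid e) else 0.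
  have degP k : k \in s' -> Q k (deg k).
    rewrite mem_filter => /andP[xk _]; rewrite /deg; case: pselect => [e|[]].
      exact: svalP (boolp.cid e).
    by case: (Cx k j) => [e|[D RD CD]]; [rewrite e eqxx in xk|exists D].
  apply: (direct_inj Csub (deg := deg) (s := s') (y := fun k => ev (x k) j)) => //.
  + exact: filter_uniq.
  + move=> k k' /degP[Rk _] /degP[Rk' _] e; rewrite e in Rk.
    exact: (gcov_fun Rok Rk Rk').
  + by move=> k /degP[].
  + have := congr1 (fun g => ev g j) x0; rewrite ev_sum ev0 /s' big_filter.
    by rewrite (bigID (fun k => ev (x k) j == 0)) /= big1 ?add0r // => k /eqP.
  + by rewrite mem_filter xn0.
Qed.

Lemma pull_graded : cyc_graded CA' du' S' (@pull_comp M C).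
Proof.
move=> n g Cg; split.
- move=> j; rewrite -[j]ord_predK ev_up.
  case: (Cg (ord_pred j)) => [->|[D RD CD]]; first by left; rewrite scaler0.
  right; exists (D + du *+ ce d (ord_pred j)); first exact: (gcov_up Rok).
  exact: (gr_upX grC).
- move=> j; rewrite ev_dn; case: (Cg (ordS j)) => [->|[D RD CD]].
    by left; rewrite scaler0.
  right; exists (D - du *+ ce d j); first exact: (gcov_dn Rok).
  by rewrite -scalerA; apply: (ksubZ Csub); apply: (gr_dnX grC).
- move=> i j; rewrite ev_E; case: eqP => _; [exact: Cg|by left].
- move=> i nS; apply: ev_ext => j; rewrite ev_E ev0; case: eqP => // <-.
  by case: (Cg i) => // -[D /(gcov_supp Rok)].
Qed.
End OneModule.

Lemma pull_comp_hom (M N : lmodType A) (C : int -> M -> Prop) (C' : int -> N -> Prop)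
    (f : {linear M -> N}) : (forall j x, C j x -> C' j (f x)) ->
  forall n g, pull_comp C n g -> pull_comp C' n (pull_hom CA CA' d_ok f g).
Proof.
move=> hf n g Cg j; rewrite pull_homE; case: (Cg j) => [->|[D RD CD]].
  by left; rewrite linear0.
by right; exists D => //; apply: hf.
Qed.

Lemma pull_comp_shift (M : lmodType A) (C : int -> M -> Prop) i n (g : F M) :
  pull_comp (shift_comp step C i) n g <-> shift_comp step' (pull_comp C) i n g.
Proof.
split=> Cg j; case: (Cg j) => [|[D RD CD]]; (try by left); right.
  by exists (D - step * i) => //; rewrite -!mulrN; apply: (gcov_shift Rok).
exists (D + step * i); last by rewrite /shift_comp addrK.
by rewrite -[n](subrK (step' * i)); apply: (gcov_shift Rok).
Qed.

Variables (P : forall M : lmodType A, (int -> M -> Prop) -> Prop).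
Variables (P' : forall M : lmodType A', (int -> M -> Prop) -> Prop).
Hypothesis P_graded : forall M C, direct_decomposition C ->
  @P M C -> cyc_graded CA du S C.
Hypothesis graded_P' : forall M C, direct_decomposition C ->
  cyc_graded CA' du' S' C -> @P' M C.
Hypothesis P_shift : forall (M : lmodType A) (C : int -> M -> Prop) i,
  @P M C -> P (shift_comp step C i).
Hypothesis P'_shift : forall (M : lmodType A') (C : int -> M -> Prop) i,
  @P' M C -> P' (shift_comp step' C i).

Definition gpull_obj (M : grmod P) : grmod P' :=
  let grM := P_graded (@gr_direct _ _ _ M) (@gr_action _ _ _ M) in
  GrMod (pull_direct (@gr_direct _ _ _ M) grM) (pull_fg CA CA' d_ok (@gr_fg _ _ _ M))
   (graded_P' (pull_direct (@gr_direct _ _ _ M) grM) (pull_graded (@gr_direct _ _ _ M) grM)).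

Definition gpull_hom (M N : grmod P) (f : grhom M N) : grhom (gpull_obj M) (gpull_obj N) :=
  @GrHom _ _ _ (gpull_obj M) (gpull_obj N) (pull_hom CA CA' d_ok f)
    (pull_comp_hom (@gr_deg _ _ _ M N f)).

Definition gpull : functor (gr_zcat P_shift) (gr_zcat P'_shift).
Proof.
apply: (@Functor (gr_cat P) (gr_cat P') gpull_obj gpull_hom).
- move=> M; apply: grhomP => g; apply: (@ev_ext _ _ _ _ _ _ _ CA CA' d d_ok) => j.
  by rewrite /= pull_homE.
- move=> M N L f h; apply: grhomP => g; apply: (@ev_ext _ _ _ _ _ _ _ CA CA' d d_ok) => j.
  by rewrite /= !pull_homE.
Defined.

Lemma gpull_zfunctor : zfunctor gpull.
Proof.
move=> i; constructor.
unshelve refine (@NatIso (gr_cat P) (gr_cat P') (fun_comp gpull (gr_shift P_shift i))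
   (fun_comp (gr_shift P'_shift i) gpull)
  (fun M : grmod P => @GrHom _ _ _ (gpull (gr_shift P_shift i M)) (gr_shift P'_shift i (gpull M))
    (idfun : {linear F M -> F M}) _)
  (fun M : grmod P => @GrHom _ _ _ (gr_shift P'_shift i (gpull M)) (gpull (gr_shift P_shift i M)) 
    (idfun : {linear F M -> F M}) _) _ _ _).
- by move=> n g /= /pull_comp_shift.
- by move=> n g /= h; apply/pull_comp_shift.
- by move=> M N f; apply: grhomP.
- by move=> M; apply: grhomP.
- by move=> M; apply: grhomP.
Qed.

End GradedPull.

Section GradedComposite.
Variables (K : comNzRingType) (A A' : pzAlgType K).
Variables (m : nat) (u : 'I_m -> K) (l : nat) (w : 'I_l -> K).
Variables (CA : cyc_alg A u) (CA' : cyc_alg A' w).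
Variables (d1 : covering K m l) (d2 : covering K l m).
Hypotheses (ok1 : cov_ok u w d1) (ok2 : cov_ok w u d2).
Variables (del : 'I_m -> nat) (kinv : 'I_m -> K).
Hypothesis ok : comp_ok u d1 d2 del kinv.
Variables (du du' step step' : int) (S : int -> 'I_m -> Prop) (S' : int -> 'I_l -> Prop).
Variables (R1 : 'I_l -> int -> int -> Prop) (R2 : 'I_m -> int -> int -> Prop).
Hypotheses (Rok1 : graded_covering d1 du du' step step' S S' R1)
  (Rok2 : graded_covering d2 du' du step' step S' S R2).
Hypothesis Rcomp : forall q D D' n, R1 (cs d2 q) D D' -> R2 q D' n -> n = D + du *+ del q.
Local Notation F := (pullmod CA CA' ok1).
Local Notation G := (pullmod CA' CA ok2).

Section OneModule.
Variables (M : lmodType A) (C : int -> M -> Prop).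
Hypotheses (Csub : forall j, ksubspace (C j)) (grC : cyc_graded CA du S C).
Local Notation GF := (pull_comp (d_ok := ok2) (CA := CA') (CA' := CA) R2
  (pull_comp (d_ok := ok1) (CA := CA) (CA' := CA') R1 C)).

Lemma glue_deg n (g : G (F M)) : GF n g -> C n (glue_hom CA CA' ok1 ok2 ok M g).
Proof.
move=> Cg; rewrite glue_homE /glue; apply: (big_ind (C n)).
- exact: ksub0.
- exact: ksubD.
move=> q _; rewrite /lifted /corner; case: (Cg q) => [->|[D' R2D' CD']].
  by rewrite ev0 scaler0; apply: ksub0.
case: (CD' (cs d2 q)) => [->|[D R1D CD]]; first by rewrite scaler0; apply: ksub0.
by rewrite (Rcomp R1D R2D'); apply: (gr_upX grC).
Qed.

(** A nonzero component of the cut has an admissible degree, so [gcov_surj] lifts this degree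
    through both coverings, and [Rcomp] shows that the result is n. *)
Lemma cut_deg n x : C n x -> GF n (cut_hom CA CA' ok1 ok2 ok M x).
Proof.
move=> Cx q; rewrite cut_homE.
set x' := (algc (kinv q) * cdn CA ^+ del q * cE CA q) *: x.
have [x'0|x'n0] := eqVneq x' 0.
  by left; apply: ev_ext => j; rewrite cutE ev0 /cut_val -/x' x'0; case: ifP.
have Cx' : C (n - du *+ del q) x'.
  rewrite /x' -!scalerA; apply: (ksubZ Csub); apply: (gr_dnX grC).
  by have [_ _ h _] := grC Cx; apply: h.
(* x' is nonzero and fixed by the idempotent at this vertex, so the support clause of [cyc_graded]
   admits its degree there. *)
have Sx' : S (n - du *+ del q) (cs d1 (cs d2 q)).
  apply: contrapT => nS; have [_ _ _ h] := grC Cx'; move/h: nS; rewrite /x' scalerA.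
  rewrite !mulrA -algcC -(mulrA _ _ (cdn CA ^+ _)) (dnXE (c_rel CA)) (comp_s ok).
  rewrite -!mulrA (cycE (c_rel CA)) eqxx !mulrA => e; by rewrite /x' e eqxx in x'n0.
have [D' R1D'] := gcov_surj Rok1 Sx'.
have [n' R2n] := gcov_surj Rok2 (gcov_supp Rok1 R1D').
have nn : n' = n by rewrite (Rcomp R1D' R2n) subrK.
rewrite nn in R2n; right; exists D' => // j; rewrite cutE /cut_val -/x'.
by case: eqP => [<-|]; [right; exists (n - du *+ del q)|left].
Qed.
End OneModule.

Variables (P : forall M : lmodType A, (int -> M -> Prop) -> Prop).
Variables (P' : forall M : lmodType A', (int -> M -> Prop) -> Prop).
Hypothesis P_graded : forall M C, direct_decomposition C ->
  @P M C <-> cyc_graded CA du S C.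
Hypothesis P'_graded : forall M C, direct_decomposition C ->
  @P' M C <-> cyc_graded CA' du' S' C.
Hypothesis P_shift : forall (M : lmodType A) (C : int -> M -> Prop) i,
  @P M C -> P (shift_comp step C i).
Hypothesis P'_shift : forall (M : lmodType A') (C : int -> M -> Prop) i,
  @P' M C -> P' (shift_comp step' C i).

Definition gF := gpull ok1 Rok1 (fun M C dC => proj1 (@P_graded M C dC))
  (fun M C dC => proj2 (@P'_graded M C dC)) P_shift P'_shift.
Definition gG := gpull ok2 Rok2 (fun M C dC => proj1 (@P'_graded M C dC))
  (fun M C dC => proj2 (@P_graded M C dC)) P'_shift P_shift.

Lemma grmod_sub (M : grmod P) j : ksubspace (@gr_comp _ _ _ M j).
Proof. by have [] := @gr_direct _ _ _ M. Qed.
Lemma grmod_graded (M : grmod P) : cyc_graded CA du S (@gr_comp _ _ _ M).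
Proof. by apply/P_graded; [apply: gr_direct|apply: gr_action]. Qed.

Definition gglue (M : grmod P) : grhom (gG (gF M)) M :=
  @GrHom _ _ _ (gG (gF M)) M (glue_hom CA CA' ok1 ok2 ok M)
   (fun n g => glue_deg (@grmod_sub M) (@grmod_graded M) (n := n) (g := g)).
Definition gcut (M : grmod P) : grhom M (gG (gF M)) :=
  @GrHom _ _ _ M (gG (gF M)) (cut_hom CA CA' ok1 ok2 ok M)
   (fun n g => cut_deg (@grmod_sub M) (@grmod_graded M) (n := n) (x := g)).

Lemma gcomp_natiso : nat_isomorphic (fun_comp gG gF) (fun_id (gr_cat P)).
Proof.
constructor; unshelve refine (@NatIso (gr_cat P) (gr_cat P) (fun_comp gG gF)
  (fun_id (gr_cat P)) gglue gcut _ _ _).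
- by move=> M N f; apply: grhomP => g; apply: glue_nat.
- by move=> M; apply: grhomP => g; apply: glueK.
- by move=> M; apply: grhomP => g; apply: cutK.
Qed.

End GradedComposite.

(** [P] and [P'] are the action conditions of the two categories. They are compared with
    [cyc_graded] for direct decompositions only, since the comparison uses that each component is a
    K-subspace. *)
Theorem cyc_zequivalence (K : comNzRingType) (A A' : pzAlgType K) m (u : 'I_m -> K)
    l (w : 'I_l -> K) (CA : cyc_alg A u) (CA' : cyc_alg A' w)
    (d1 : covering K m l) (d2 : covering K l m) del kinv del' kinv'
    (du du' step step' : int) (S : int -> 'I_m -> Prop) (S' : int -> 'I_l -> Prop)
    (R1 : 'I_l -> int -> int -> Prop) (R2 : 'I_m -> int -> int -> Prop)
    (P : forall M : lmodType A, (int -> M -> Prop) -> Prop)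
    (P' : forall M : lmodType A', (int -> M -> Prop) -> Prop)
    (P_shift : forall (M : lmodType A) (C : int -> M -> Prop) i,
      P M C -> P M (shift_comp step C i))
    (P'_shift : forall (M : lmodType A') (C : int -> M -> Prop) i,
      P' M C -> P' M (shift_comp step' C i)) :
  cov_ok u w d1 -> cov_ok w u d2 ->
  comp_ok u d1 d2 del kinv -> comp_ok w d2 d1 del' kinv' ->
  graded_covering d1 du du' step step' S S' R1 ->
  graded_covering d2 du' du step' step S' S R2 ->
  (forall q D D' n, R1 (cs d2 q) D D' -> R2 q D' n -> n = D + du *+ del q) ->
  (forall q D D' n, R2 (cs d1 q) D D' -> R1 q D' n -> n = D + du' *+ del' q) ->
  (forall (M : lmodType A) (C : int -> M -> Prop), direct_decomposition C ->
    P M C <-> cyc_graded CA du S C) ->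
  (forall (M : lmodType A') (C : int -> M -> Prop), direct_decomposition C ->
    P' M C <-> cyc_graded CA' du' S' C) ->
  exists Phi : functor (gr_zcat P_shift) (gr_zcat P'_shift), zequivalence Phi.
Proof.
move=> ok1 ok2 c1 c2 Rok1 Rok2 R12 R21 gP gP'.
exists (gF ok1 Rok1 gP gP' P_shift P'_shift); split; first exact: gpull_zfunctor.
exists (gG ok2 Rok2 gP gP' P_shift P'_shift); first exact: gpull_zfunctor.
split; first exact: (gcomp_natiso ok1 ok2 c1 Rok1 Rok2 R12 gP gP' P_shift P'_shift).
exact: (gcomp_natiso ok2 ok1 c2 Rok2 Rok1 R21 gP' gP P'_shift P_shift).
Qed.

(** * Universal properties of quotients and free algebras *)

Section QuotientLift.
Variables (K : pzRingType) (A : pzAlgType K) (S : A -> Prop).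

Lemma quot_pi_zmod : zmod_morphism (quot_pi S).
Proof. by move=> x y; rewrite /quot_pi raddfB. Qed.
Lemma quot_pi_monoid : monoid_morphism (quot_pi S).
Proof. by split=> // x y; apply: quot_piM. Qed.
HB.instance Definition _ := GRing.isZmodMorphism.Build A (alg_quot S) (quot_pi S) quot_pi_zmod.
HB.instance Definition _ := GRing.isMonoidMorphism.Build A (alg_quot S) (quot_pi S) quot_pi_monoid.

Lemma quot_pi_rel x : S x -> quot_pi S x = 0.
Proof.
move=> Sx; rewrite -(raddf0 (quot_pi S)); apply/quot_piE; rewrite subr0 ideal_predE.
by apply/asboolP => I _; apply.
Qed.

Lemma quot_ind (P : alg_quot S -> Prop) : (forall x, P (quot_pi S x)) -> forall x, P x.
Proof. by move=> h x; rewrite -(quot_pi_rep x). Qed.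

Variables (B : pzAlgType K) (phi : {rmorphism A -> B}).
Hypothesis phi0 : forall x, S x -> phi x = 0.

Definition quot_lift_fun (x : alg_quot S) : B :=
  phi (repr (x : Quotient.quot (ideal_pred S))).

Lemma quot_lift_pi x : quot_lift_fun (quot_pi S x) = phi x.
Proof.
apply/eqP; rewrite -subr_eq0 /quot_lift_fun -raddfB.
have : repr (quot_pi S x : Quotient.quot (ideal_pred S)) - x \in ideal_pred S.
  by apply/quot_piE; rewrite quot_pi_rep.
(* The kernel of [phi] is one of the ideals over which [ideal_gen] quantifies. *)
rewrite ideal_predE => /asboolP /(_ (fun x => phi x = 0)) h; apply/eqP/h => //.
split=> [|y z hy hz|a y hy|a y hy]; first exact: raddf0.
- by rewrite rmorphD hy hz addr0.
- by rewrite rmorphM hy mulr0.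
- by rewrite rmorphM hy mul0r.
Qed.

Fact quot_lift_zmod : zmod_morphism quot_lift_fun.
Proof.
move=> x y; move: x; apply: quot_ind => x; move: y; apply: quot_ind => y.
by rewrite -raddfB !quot_lift_pi raddfB.
Qed.
Fact quot_lift_monoid : monoid_morphism quot_lift_fun.
Proof.
split=> [|x y]; first by rewrite -(rmorph1 (quot_pi S)) quot_lift_pi rmorph1.
move: x; apply: quot_ind => x; move: y; apply: quot_ind => y.
by rewrite -rmorphM !quot_lift_pi rmorphM.
Qed.
HB.instance Definition _ := GRing.isZmodMorphism.Build (alg_quot S) B
  quot_lift_fun quot_lift_zmod.
HB.instance Definition _ := GRing.isMonoidMorphism.Build (alg_quot S) B
  quot_lift_fun quot_lift_monoid.
Definition quot_lift : {rmorphism alg_quot S -> B} := quot_lift_fun.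
Lemma quot_liftE x : quot_lift (quot_pi S x) = phi x. Proof. exact: quot_lift_pi. Qed.
End QuotientLift.

Lemma quot_generated (K : pzRingType) (A : pzAlgType K) (S G : A -> Prop) :
  alg_generated G -> alg_generated (fun x : alg_quot S => exists2 y, G y & x = quot_pi S y).
Proof.
move=> gA P Pc PD PM PG; apply: quot_ind.
apply: (gA (fun x => P (quot_pi S x))) => [c|x y Px Py|x y Px Py|g Gg]; first exact: Pc.
- by rewrite rmorphD; apply: PD.
- by rewrite rmorphM; apply: PM.
- by apply: PG; exists g.
Qed.

Section LinearExtension.
Variables (K : comNzRingType) (X : choiceType) (B : pzAlgType K) (g : X -> B).
Implicit Types f : {malg K[X]}.

Definition lext f : B := \sum_(w <- msupp f) algc f@_w * g w.

Lemma lextw (d : {fset X}) f : (msupp f `<=` d)%fset ->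
  lext f = \sum_(w <- d) algc f@_w * g w.
Proof.
move=> le; rewrite /lext (big_fset_incl _ le) // => w _ /mcoeff_outdom ->.
by rewrite rmorph0 mul0r.
Qed.

Lemma lextD f1 f2 : lext (f1 + f2) = lext f1 + lext f2.
Proof.
rewrite (@lextw (msupp f1 `|` msupp f2)%fset) ?msuppD_le //.
rewrite (@lextw (msupp f1 `|` msupp f2)%fset f1) ?fsubsetUl //.
rewrite (@lextw (msupp f1 `|` msupp f2)%fset f2) ?fsubsetUr //.
by rewrite -big_split; apply: eq_bigr => w _; rewrite mcoeffD rmorphD mulrDl.
Qed.

Lemma lextZ c f : lext (c *: f) = algc c * lext f.
Proof.
rewrite (@lextw (msupp f)) ?msuppZ_le // mulr_sumr.
by apply: eq_bigr => w _; rewrite mcoeffZ rmorphM mulrA.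
Qed.

Lemma lextU w : lext << w >> = g w.
Proof.
rewrite (@lextw [fset w]%fset) ?msuppU_le // big_seq_fset1.
by rewrite mcoeffUU rmorph1 mul1r.
Qed.

Lemma malg_ind (P : {malg K[X]} -> Prop) : P 0 -> (forall x y, P x -> P y -> P (x + y)) ->
  (forall c x, P x -> P (c *: x)) -> (forall w, P << w >>) -> forall f, P f.
Proof.
move=> P0 PD PZ PU f; rewrite [f]monalgE; apply: (big_ind P) => // w _.
suff -> : << f@_w *g w >> = f@_w *: << w >> :> {malg K[X]} by apply/PZ/PU.
by apply/malgP => x; rewrite mcoeffZ !mcoeffU mulrnAr mulr1.
Qed.
End LinearExtension.

Section MakeMorphism.
Variables (K : comNzRingType) (A B : pzAlgType K) (X : Type) (bas : X -> A) (f : A -> B).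
Hypothesis bas_ind : forall P : A -> Prop, P 0 -> (forall x y, P x -> P y -> P (x + y)) ->
  (forall c x, P x -> P (algc c * x)) -> (forall w, P (bas w)) -> forall x, P x.
Hypotheses (fD : forall x y, f (x + y) = f x + f y)
  (fZ : forall c x, f (algc c * x) = algc c * f x) (f1 : f 1 = 1)
  (fM : forall v w, f (bas v * bas w) = f (bas v) * f (bas w)).

Definition alg_hom_fun := f.
Fact alg_hom0 : f 0 = 0.
Proof. by apply: (addIr (f 0)); rewrite -fD !add0r. Qed.
Fact alg_hom_zmod : zmod_morphism alg_hom_fun.
Proof.
move=> x y; rewrite /alg_hom_fun; apply/eqP; rewrite -subr_eq0.
have fN : f (- y) = - f y by apply/eqP; rewrite -addr_eq0 -fD addNr alg_hom0.
by rewrite fD fN subrr.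
Qed.
(** Both sides of multiplicativity are bilinear, so an induction on each factor leaves only products
    of basis elements. *)
Fact alg_hom_monoid : monoid_morphism alg_hom_fun.
Proof.
split; rewrite /alg_hom_fun // => x y; move: x.
apply: bas_ind => [|x1 x2 e1 e2|c x e|v]; first by rewrite !mul0r alg_hom0 mul0r.
- by rewrite mulrDl !fD e1 e2 mulrDl.
- by rewrite -mulrA !fZ e mulrA.
move: y; apply: bas_ind => [|x1 x2 e1 e2|c x e|w]; last exact: fM.
- by rewrite !mulr0 alg_hom0 mulr0.
- by rewrite mulrDr !fD e1 e2 mulrDr.
- by rewrite mulrA -algcC -mulrA !fZ e mulrA algcC -mulrA.
Qed.
HB.instance Definition _ := GRing.isZmodMorphism.Build A B alg_hom_fun alg_hom_zmod.
HB.instance Definition _ := GRing.isMonoidMorphism.Build A B alg_hom_fun alg_hom_monoid.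
Definition alg_hom : {rmorphism A -> B} := alg_hom_fun.
Lemma alg_homE x : alg_hom x = f x. Proof. by []. Qed.
Lemma alg_hom_c c : alg_hom (algc c) = algc c.
Proof. by rewrite alg_homE -[algc c]mulr1 fZ f1 mulr1. Qed.
End MakeMorphism.

Section FreeAlgebraLift.
Variables (K : comNzRingType) (X : choiceType).
Local Notation FA := (free_alg K X).

Lemma free_algcE (c : K) (x : FA) : algc c * x = c *: x.
Proof. exact: mulr_algl. Qed.

Definition free_word (w : {fmonom X}) : FA := << w >>.

Lemma free_word1 : 1 = free_word (@mone {fmonom X}).
Proof. by []. Qed.
Lemma free_wordM u w : free_word u * free_word w = free_word (mmul u w).
Proof.
suff h (x y : {fmonom X}) : << x >> * << y >> = << mmul x y >> :> {malg K[{fmonom X}]}.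
  exact: h.
by rewrite malgM_def fgmulUU mulr1.
Qed.

Lemma free_ind (P : FA -> Prop) : P 0 -> (forall x y, P x -> P y -> P (x + y)) ->
  (forall c x, P x -> P (algc c * x)) -> (forall w, P (free_word w)) -> forall x, P x.
Proof.
move=> P0 PD PZ PU; apply: (@malg_ind K _ (P : {malg K[{fmonom X}]} -> Prop)) => //.
by move=> c x Px; rewrite -[c *: x]free_algcE; apply: PZ.
Qed.

Lemma free_generated : alg_generated (fun x : FA => exists g, x = free_gen K g).
Proof.
move=> P Pc PD PM PG; apply: free_ind => //.
- by have := Pc 0; rewrite rmorph0.
- by move=> c x Px; apply: PM.
case; elim=> [|g s IH]; first by have := Pc 1; rewrite rmorph1 -fmoneE.
have -> : FMonom (g :: s) = fmmul (fmu g) (FMonom s) by rewrite fmmulE fmuE.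
rewrite -[free_word _]free_wordM; apply: PM => //; apply: PG; by exists g.
Qed.

Variables (B : pzAlgType K) (f : X -> B).

Definition free_lift_word (w : {fmonom X}) : B := \prod_(g <- (w : seq X)) f g.

Lemma free_lift : {phi : {rmorphism FA -> B} | (forall c, phi (algc c) = algc c) /\
  forall g, phi (free_gen K g) = f g}.
Proof.
pose F (x : FA) : B := lext free_lift_word x.
have FU w : F (free_word w) = free_lift_word w by exact: lextU.
have FD x y : F (x + y) = F x + F y by exact: lextD.
have FZ c x : F (algc c * x) = algc c * F x by rewrite free_algcE; apply: lextZ.
have F1 : F 1 = 1 by rewrite free_word1 FU /free_lift_word fm1 big_nil.
have FM u w : F (free_word u * free_word w) = F (free_word u) * F (free_word w).
  by rewrite free_wordM !FU /free_lift_word fmM big_cat.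
exists (alg_hom free_ind FD FZ F1 FM); split; first exact: alg_hom_c.
move=> g; rewrite alg_homE -[free_gen K g]/(free_word (fmu g)) FU.
by rewrite /free_lift_word fmuE /= big_seq1.
Qed.
End FreeAlgebraLift.

(** * Eigenspaces of h and the presentation of t(v) *)

Section PolynomialEvaluation.
Variables (K : fieldType) (B : pzAlgType K).
Implicit Types (v q : {poly K}) (x y : B).

(** [horner_alg] serves the free algebra, which is an [algType]; quotients and endomorphism algebras
    may be zero, so evaluation in a [pzAlgType] is given by the explicit sum. *)
Definition peval v x : B := \sum_(i < size v) algc v`_i * x ^+ i.

Lemma pevalw n v x : (size v <= n)%N -> peval v x = \sum_(i < n) algc v`_i * x ^+ i.
Proof.
move=> le; rewrite /peval (big_ord_widen n (fun i => algc v`_i * x ^+ i) le).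
rewrite [LHS]big_mkcond; apply: eq_bigr => i _; case: ltnP => // si.
by rewrite nth_default // rmorph0 mul0r.
Qed.

Lemma pevalD v q x : peval (v + q) x = peval v x + peval q x.
Proof.
pose n := maxn (size v) (size q).
rewrite (@pevalw n (v + q)) ?size_polyD // (@pevalw n v) ?leq_maxl //.
rewrite (@pevalw n q) ?leq_maxr // -big_split; apply: eq_bigr => i _.
by rewrite coefD rmorphD mulrDl.
Qed.

Lemma pevalZ c v x : peval (c *: v) x = algc c * peval v x.
Proof.
rewrite (@pevalw (size v)) ?size_scale_leq // mulr_sumr; apply: eq_bigr => i _.
by rewrite coefZ rmorphM mulrA.
Qed.

Lemma pevalMX v x : peval (v * 'X) x = peval v x * x.
Proof.
rewrite (@pevalw (size v).+1); last first.
  by case: (eqVneq v 0) => [->|v0]; rewrite ?mul0r ?size_poly0 ?size_mulX.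
rewrite big_ord_recl coefMX rmorph0 mul0r add0r mulr_suml.
by apply: eq_bigr => i _; rewrite coefMX lift0 /= exprSr mulrA.
Qed.

Lemma pevalC c x : peval c%:P x = algc c.
Proof. by rewrite (@pevalw 1%N) ?size_polyC_leq1 // big_ord1 coefC mulr1. Qed.

Lemma pevalM v q x : peval (v * q) x = peval v x * peval q x.
Proof.
have xC (w : {poly K}) : peval w x * x = x * peval w x.
  rewrite mulr_suml mulr_sumr; apply: eq_bigr => i _.
  by rewrite -mulrA -exprSr exprS !mulrA algcC.
elim/poly_ind: v => [|v c IH]; first by rewrite mul0r -polyC0 pevalC rmorph0 mul0r.
rewrite mulrDl mulrAC mul_polyC !pevalD pevalZ !pevalMX IH pevalC mulrDl.
by rewrite -!mulrA xC.
Qed.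

Lemma pevalX x : peval 'X x = x.
Proof. by rewrite -[X in peval X]mul1r pevalMX -polyC1 pevalC rmorph1 mul1r. Qed.

Lemma peval_sum I (r : seq I) (F : I -> {poly K}) x :
  peval (\sum_(i <- r) F i) x = \sum_(i <- r) peval (F i) x.
Proof.
apply: (big_morph (peval^~ x)) => [v q|]; first exact: pevalD.
by rewrite -polyC0 pevalC rmorph0.
Qed.

Lemma pevalXn n x : peval 'X^n x = x ^+ n.
Proof.
elim: n => [|n IH]; first by rewrite expr0 -polyC1 pevalC rmorph1.
by rewrite !exprSr pevalMX IH.
Qed.

Lemma peval_eigen v x y c : x * y = algc c * y -> peval v x * y = algc v.[c] * y.
Proof.
move=> xy; have xn n : x ^+ n * y = algc (c ^+ n) * y.
  elim: n => [|n IH]; first by rewrite !expr0 rmorph1.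
  by rewrite exprSr -mulrA xy mulrA -algcC -mulrA IH mulrA -rmorphM exprS.
rewrite horner_coef rmorph_sum !mulr_suml; apply: eq_bigr => i _.
by rewrite -mulrA xn mulrA -rmorphM.
Qed.
End PolynomialEvaluation.

Lemma peval_morph (K : fieldType) (A B : pzAlgType K) (phi : {rmorphism A -> B}) :
  (forall c, phi (algc c) = algc c) -> forall v x, phi (peval v x) = peval v (phi x).
Proof.
move=> phic v x; rewrite rmorph_sum; apply: eq_bigr => i _.
by rewrite rmorphM rmorphXn phic.
Qed.

Section PrimeField.
Variables (K : fieldType) (p : nat).
Hypothesis charK : p \in [pchar K].

(** The offset puts the eigenvalue 0 at the last index p - 1. As 0 is always a root of [v_poly], no
    segment will wrap around. *)
Definition lam (i : 'I_p) : K := i.+1%:R.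

Let p_prime : prime p := pcharf_prime charK.

Lemma natr_pchar_inj (i j : nat) : (i <= p)%N -> (j <= p)%N -> (0 < i)%N -> (0 < j)%N ->
  i%:R = j%:R :> K -> i = j.
Proof.
move=> ip jp i0 j0 /eqP.
wlog le : i j ip jp i0 j0 / (i <= j)%N => [h|].
  by case/orP: (leq_total i j) => le e; [apply: h|apply/esym/h => //; rewrite eq_sym].
rewrite eq_sym -subr_eq0 -natrB // -(dvdn_pcharf charK) => /dvdnP[[|c] e].
  by apply/eqP; rewrite eqn_leq le -subn_eq0 e mul0n.
have : (j - i < p)%N by rewrite ltn_subLR // (leq_ltn_trans jp) // -addn1 addnC leq_add2r.
by rewrite e ltnNge mulSn leq_addr.
Qed.

Lemma lam_inj : injective lam.
Proof.
move=> i j /natr_pchar_inj e; apply/val_inj/succn_inj/e => //; exact: ltn_ord.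
Qed.

Lemma lamS i : lam (ordS i) = lam i + 1.
Proof.
rewrite /lam -natr1 /=; have [lt|] := ltnP i.+1 p.
  by rewrite modn_small.
move=> ge; have -> : i.+1 = p by apply/eqP; rewrite eqn_leq ge ltn_ord.
by rewrite modnn (pcharf0 charK).
Qed.

Lemma lamX i : lam i ^+ p = lam i.
Proof. by rewrite -(pFrobenius_autE charK) pFrobenius_aut_nat. Qed.

(** The Lagrange interpolation polynomial of the prime field: by Fermat, x ^ (p - 1) = 1 for every
    nonzero x in it. *)
Definition lagr (i : 'I_p) : {poly K} := 1 - ('X - (lam i)%:P) ^+ p.-1.

(** Stated for any mu fixed by Frobenius so as to apply to the weights j / n of graded modules as
    well. *)
Lemma lagr_fixed i (mu : K) : mu ^+ p = mu -> (lagr i).[mu] = (lam i == mu)%:R.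
Proof.
move=> mup; rewrite /lagr !hornerE; case: (eqVneq (lam i) mu) => [->|ij].
  rewrite subrr expr0n (_ : p.-1 == 0%N = false) ?subr0 //.
  by case: (p) (prime_gt1 p_prime) => [|[]].
have nz : mu - lam i != 0 by rewrite subr_eq0 eq_sym.
suff -> : (mu - lam i) ^+ p.-1 = 1 by rewrite subrr.
apply: (mulfI nz); rewrite mulr1 -exprS prednK ?prime_gt0 //.
by rewrite -(pFrobenius_autE charK) rmorphB /= !pFrobenius_autE lamX mup.
Qed.

Lemma lagrE i j : (lagr i).[lam j] = (i == j)%:R.
Proof. by rewrite lagr_fixed ?lamX // (inj_eq lam_inj). Qed.

Section Idempotents.
Variables (B : pzAlgType K) (h : B).
Hypothesis hp : h ^+ p = h.

(** X^p - X is the product of the linear factors of the prime field, hence divides every v that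
    vanishes there, and it kills h. *)
Lemma peval_vanish v : (forall i, v.[lam i] = 0) -> peval v h = 0.
Proof.
move=> v0; pose rs := [seq lam i | i <- enum 'I_p].
have urs : uniq_roots rs by rewrite uniq_rootsE map_inj_uniq ?enum_uniq //; apply: lam_inj.
have vr : all (root v) rs by apply/allP => _ /mapP[i _ ->]; apply/eqP.
have [q ->] := uniq_roots_prod_XsubC vr urs.
pose f : {poly K} := 'X^p - 'X.
have fr : all (root f) rs.
  by apply/allP => _ /mapP[i _ ->]; rewrite rootE /f !hornerE lamX subrr.
have sf : size f = (size rs).+1.
  rewrite size_map size_enum_ord /f size_polyDl ?size_polyXn // size_polyN size_polyX.
  by rewrite ltnS prime_gt1.
have := all_roots_prod_XsubC sf fr urs.
have -> : lead_coef f = 1.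
  by rewrite /f lead_coefDl ?lead_coefXn // size_polyN size_polyX size_polyXn ltnS prime_gt1.
rewrite scale1r pevalM => <-.
rewrite /f -['X]scale1r -scaleNr pevalD pevalZ scale1r pevalXn pevalX hp.
by rewrite rmorphN rmorph1 mulN1r subrr mulr0.
Qed.

Lemma peval_eq v q : (forall i, v.[lam i] = q.[lam i]) -> peval v h = peval q h.
Proof.
move=> vq; have := @peval_vanish (v - q) _; rewrite -scaleN1r pevalD pevalZ.
rewrite rmorphN rmorph1 mulN1r => e; apply/eqP; rewrite -subr_eq0; apply/eqP/e => i.
by rewrite !hornerE vq mulN1r subrr.
Qed.

Definition idem (i : 'I_p) : B := peval (lagr i) h.

Lemma idemM i j : idem i * idem j = if i == j then idem i else 0.
Proof.
rewrite /idem -pevalM; case: eqP => [<-|/eqP ij].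
  by apply: peval_eq => k; rewrite hornerM lagrE -natrM mulnb andbb.
apply: peval_vanish => k; rewrite hornerM !lagrE -natrM mulnb.
by case: eqP => [<-|] //; rewrite eq_sym (negbTE ij).
Qed.

Lemma sum_idem : \sum_i idem i = 1.
Proof.
have <- : peval 1 h = 1 by rewrite -polyC1 pevalC rmorph1.
rewrite -peval_sum; apply: peval_eq => k.
rewrite horner_sum (bigD1 k) //= lagrE eqxx big1 ?addr0 ?hornerE // => i ik.
by rewrite lagrE (negbTE ik).
Qed.

Lemma idem_eigen i : h * idem i = algc (lam i) * idem i.
Proof.
rewrite /idem -[X in X * _](pevalX h) -pevalM -pevalZ; apply: peval_eq => k.
by rewrite hornerM hornerX hornerZ lagrE; case: eqP => [->|]; rewrite ?mulr1 ?mulr0.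
Qed.

(** x maps the i-th eigenspace into the one of [s i], so [idem (s i) * x * idem j] is zero unless s
    j = s i, that is j = i; summing over j gives the claim. *)
Lemma idem_shift (s : 'I_p -> 'I_p) x : injective s ->
  (forall i, h * (x * idem i) = algc (lam (s i)) * (x * idem i)) ->
  forall i, x * idem i = idem (s i) * x.
Proof.
move=> sI hx; have key i j : idem j * (x * idem i) = if j == s i then x * idem i else 0.
  rewrite /idem (peval_eigen _ (hx i)) lagrE; case: eqP => _.
    by rewrite rmorph1 mul1r.
  by rewrite rmorph0 mul0r.
move=> i; rewrite -[RHS]mulr1 -sum_idem [RHS]mulr_sumr [RHS](bigD1 i) //= -mulrA key eqxx.
rewrite [X in _ + X]big1 ?addr0 // => j ji; rewrite -mulrA key (inj_eq sI) eq_sym.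
by rewrite (negbTE ji).
Qed.
End Idempotents.

Variable v : {poly K}.

Record t_rels (A : pzAlgType K) (a b h : A) : Prop := TRels {
  t_ha : h * a = a * (h + 1);
  t_hb : h * b = b * (h - 1);
  t_ba : b * a = peval v h;
  t_ab : a * b = peval v (h - 1);
  t_ap : a ^+ p = 0;
  t_bp : b ^+ p = 0;
  t_hp : h ^+ p = h
}.

Definition t_wt (i : 'I_p) : K := v.[lam i].

(** The commutation rules say that a raises and b lowers the eigenvalue of h by 1. Since h - 1 acts
    on [idem h (ordS i)] as [lam i], the relation for ab gives there the same weight as the relation
    for ba at i. *)
Lemma t_rels_cyc (A : pzAlgType K) (a b h : A) :
  t_rels a b h -> cyc_rel t_wt (idem h) a b.
Proof.
case=> ha hb ba ab ap bp hp.
have eig := idem_eigen hp.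
have eig1 i : (h - 1) * idem h (ordS i) = algc (lam i) * idem h (ordS i).
  by rewrite mulrBl eig lamS rmorphD rmorph1 mulrDl mul1r addrK.
have aE i : a * idem h i = idem h (ordS i) * a.
  apply: (idem_shift hp (s := @ordS _)) => [|{}i]; first exact: ordS_inj.
  by rewrite mulrA ha -mulrA mulrDl eig mul1r -{2}[idem h i]mul1r -mulrDl
    -(rmorph1 (@algc K A)) -rmorphD -lamS !mulrA algcC.
have bE i : b * idem h i = idem h (ord_pred i) * b.
  apply: (idem_shift hp (s := @ord_pred _)) => [|{}i]; first exact: ord_pred_inj.
  have := eig1 (ord_pred i); rewrite ord_predK => e.
  by rewrite mulrA hb -mulrA e !mulrA algcC.
split=> //.
- exact: (idemM hp).
- exact: (sum_idem hp).
- by move=> i; rewrite bE ordSK.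
- by move=> i; rewrite ba (peval_eigen _ (eig i)).
- by move=> i; rewrite ab (peval_eigen _ (eig1 i)).
Qed.

(** h is rebuilt from its spectral decomposition, and by [cyc_ext] each relation needs checking on
    the E_i only. *)
Lemma cyc_t_rels (A : pzAlgType K) (E : 'I_p -> A) (up dn : A) :
  cyc_rel t_wt E up dn -> let h := \sum_i algc (lam i) * E i in
  t_rels up dn h /\ forall i, idem h i = E i.
Proof.
move=> R h; have eig i : h * E i = algc (lam i) * E i.
  rewrite /h mulr_suml (bigD1 i) //= -mulrA (cycE R) eqxx big1 ?addr0 // => j ji.
  by rewrite -mulrA (cycE R) (negbTE ji) mulr0.
have eigS i : h * E (ordS i) = algc (lam i + 1) * E (ordS i) by rewrite eig lamS.
have eig1 i : (h - 1) * E (ordS i) = algc (lam i) * E (ordS i).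
  by rewrite mulrBl eigS rmorphD rmorph1 mulrDl mul1r addrK.
split; last first.
  move=> i; apply: (cyc_ext R) => j; rewrite /idem (peval_eigen _ (eig j)) lagrE (cycE R).
  by case: eqP => [->|_]; rewrite ?rmorph1 ?mul1r ?rmorph0 ?mul0r.
split; [| | | |exact: (cyc_upm R)|exact: (cyc_dnm R)|]; apply: (cyc_ext R) => i.
- rewrite -!mulrA (cyc_up R) mulrA eigS mulrDl eig mul1r mulrDr !mulrA -algcC.
  by rewrite -!mulrA (cyc_up R) rmorphD rmorph1 mulrDl mul1r.
- rewrite -[i]ord_predK -!mulrA -(cyc_dn R) mulrA eig eig1 !mulrA -algcC.
  by rewrite -!mulrA -(cyc_dn R).
- by rewrite (cyc_dnup R) (peval_eigen _ (eig i)).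
- by rewrite -[i]ord_predK (cyc_updn R) (peval_eigen _ (eig1 _)).
- have e := eig i; rewrite e -{1}(lamX i) -(pevalXn p h) (peval_eigen _ e).
  by rewrite !hornerE.
Qed.

(** The two dictionaries translate one universal property into the other. The values of E, up and dn
    are kept in the statement because the gradings refer to a, b and h. *)
Lemma t_pres_cyc (A : pzAlgType K) (a b h : A) : t_rels a b h ->
  alg_generated (fun x => [\/ x = a, x = b | x = h]) ->
  (forall (S : pzAlgType K) (a' b' h' : S), t_rels a' b' h' ->
    {phi : {rmorphism A -> S} | [/\ forall c, phi (algc c) = algc c,
       phi a = a', phi b = b' & phi h = h']}) ->
  {C : cyc_alg A t_wt | [/\ forall i, cE C i = idem h i, cup C = a & cdn C = b]}.
Proof.
move=> tR gen lift; have R := t_rels_cyc tR.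
unshelve eexists; first unshelve eapply (@CycAlg _ _ _ _ (idem h) a b R).
- move=> P Pc PD PM PG; apply: gen => // g [->|->|->]; [| |].
  + by apply: PG; apply: Or32.
  + by apply: PG; apply: Or33.
  rewrite -[h]mulr1 -(sum_idem (t_hp tR)) mulr_sumr; apply: (big_ind P) => //.
    by have := Pc 0; rewrite rmorph0.
  move=> i _; rewrite (idem_eigen (t_hp tR)); apply: PM => //.
  by apply: PG; apply: Or31; exists i.
- move=> S E up dn /cyc_t_rels[tR' idE]; have [phi [pc pa pb ph]] := lift _ _ _ _ tR'.
  by exists phi; split=> // i; rewrite /idem (peval_morph pc) ph -idE.
by [].
Qed.
End PrimeField.

Lemma horner_alg_sum (K : comNzRingType) (A : algType K) (x : A) (v : {poly K}) :
  horner_alg x v = \sum_(i < size v) v`_i *: x ^+ i.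
Proof.
rewrite /horner_alg /= /horner_morph (@horner_coef_wide _ (size v)) ?size_poly //.
apply: eq_bigr => i _; rewrite coef_map /=; exact: mulr_algl.
Qed.

Section TwoQuotients.
Variables (K : fieldType) (v : {poly K}) (p : nat) (FA : pzAlgType K) (a b h hv hv' : FA).
Variables (R1 : FA -> Prop) (R2 : alg_quot R1 -> Prop).
Local Notation pi1 := (quot_pi R1).
Local Notation pi2 := (quot_pi R2).
Hypothesis R1E : forall x, R1 x <->
  [\/ x = h * a - a * (h + 1), x = h * b - b * (h - 1), x = b * a - hv | x = a * b - hv'].
Hypothesis R2E : forall x, R2 x <->
  [\/ x = pi1 a ^+ p, x = pi1 b ^+ p | x = pi1 h ^+ p - pi1 h].
Hypothesis gen : alg_generated (fun x => [\/ x = a, x = b | x = h]).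
Hypothesis lift : forall (S : pzAlgType K) (a' b' h' : S), {phi : {rmorphism FA -> S} |
  [/\ forall c, phi (algc c) = algc c, phi a = a', phi b = b' & phi h = h']}.
Hypothesis eval : forall (S : pzAlgType K) (phi : {rmorphism FA -> S}),
  (forall c, phi (algc c) = algc c) ->
  phi hv = peval v (phi h) /\ phi hv' = peval v (phi h - 1).

(** [hv] and [hv'] stand for v(h) and v(h - 1) in the free algebra, known only through their images
    under algebra morphisms. *)
Lemma two_quot_rels : t_rels p v (pi2 (pi1 a)) (pi2 (pi1 b)) (pi2 (pi1 h)).
Proof.
have rel1 x : R1 x -> pi2 (pi1 x) = 0 by move=> /quot_pi_rel ->; rewrite rmorph0.
have [e1 e2] := eval (phi := (pi2 \o pi1 : {rmorphism _ -> _})) (fun=> erefl).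
have sub0 (S : zmodType) (x y : S) : x - y = 0 -> x = y by move/eqP; rewrite subr_eq0 => /eqP.
split.
- have /rel1 : R1 (h * a - a * (h + 1)) by apply/R1E; apply: Or41.
  by rewrite !(rmorphB, rmorphM, rmorphD, rmorph1) => /sub0.
- have /rel1 : R1 (h * b - b * (h - 1)) by apply/R1E; apply: Or42.
  by rewrite !(rmorphB, rmorphM, rmorphD, rmorph1) => /sub0.
- have /rel1 : R1 (b * a - hv) by apply/R1E; apply: Or43.
  by rewrite !(rmorphB, rmorphM) => /sub0 ->.
- have /rel1 : R1 (a * b - hv') by apply/R1E; apply: Or44.
  by rewrite !(rmorphB, rmorphM) => /sub0 ->.
- have /quot_pi_rel : R2 (pi1 a ^+ p) by apply/R2E; apply: Or31.
  by rewrite rmorphXn.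
- have /quot_pi_rel : R2 (pi1 b ^+ p) by apply/R2E; apply: Or32.
  by rewrite rmorphXn.
- have /quot_pi_rel : R2 (pi1 h ^+ p - pi1 h) by apply/R2E; apply: Or33.
  by rewrite rmorphB rmorphXn => /sub0.
Qed.

Lemma two_quot_gen : alg_generated
  (fun x => [\/ x = pi2 (pi1 a), x = pi2 (pi1 b) | x = pi2 (pi1 h)]).
Proof.
move=> P Pc PD PM PG; apply: (quot_generated (quot_generated gen)) => //.
move=> _ [_ [x [->|->|->] ->] ->]; apply: PG; by [apply: Or31|apply: Or32|apply: Or33].
Qed.

Lemma two_quot_lift (S : pzAlgType K) (a' b' h' : S) : t_rels p v a' b' h' ->
  {phi : {rmorphism alg_quot R2 -> S} | [/\ forall c, phi (algc c) = algc c,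
    phi (pi2 (pi1 a)) = a', phi (pi2 (pi1 b)) = b' & phi (pi2 (pi1 h)) = h']}.
Proof.
case=> ha hb ba ab ap bp hp; have [phi [pc pa pb ph]] := lift a' b' h'.
have [e1 e2] := eval pc; rewrite ph in e1 e2.
have z1 x : R1 x -> phi x = 0.
  by move=> /R1E[->|->|->|->]; rewrite !(rmorphB, rmorphM, rmorphD, rmorph1) ?pa ?pb ?ph
    ?e1 ?e2 ?ha ?hb ?ba ?ab subrr.
pose phi1 := quot_lift z1; have phi1E x : phi1 (pi1 x) = phi x by exact: quot_liftE.
have z2 x : R2 x -> phi1 x = 0.
  by move=> /R2E[->|->|->]; rewrite ?rmorphB ?rmorphXn !phi1E ?pa ?pb ?ph // hp subrr.
pose phi2 := quot_lift z2; have phi2E x : phi2 (pi2 x) = phi1 x by exact: quot_liftE.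
exists phi2; split=> [c|||]; rewrite ?phi2E ?phi1E //.
Qed.
End TwoQuotients.

Section TAlgebraCyclic.
Variables (K : fieldType) (v : {poly K}) (p : nat).
Hypothesis charK : p \in [pchar K].

Lemma tgen_generated :
  alg_generated (fun x : free_alg K tgen =>
    [\/ x = free_gen K ga, x = free_gen K gb | x = free_gen K gh]).
Proof.
move=> P Pc PD PM PG; apply: free_generated => // _ [[] ->]; apply: PG;
  by [apply: Or31|apply: Or32|apply: Or33].
Qed.

Lemma tgen_lift (S : pzAlgType K) (a b h : S) :
  {phi : {rmorphism free_alg K tgen -> S} | [/\ forall c, phi (algc c) = algc c,
    phi (free_gen K ga) = a, phi (free_gen K gb) = b & phi (free_gen K gh) = h]}.
Proof.
have [phi [pc pg]] := @free_lift K tgen S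
  (fun g => match g with ga => a | gb => b | gh => h end).
by exists phi; split; rewrite ?pg.
Qed.

Lemma free_horner (X : choiceType) (S : pzAlgType K) (phi : {rmorphism free_alg K X -> S}) :
  (forall c, phi (algc c) = algc c) ->
  forall x, phi (horner_alg x v) = peval v (phi x).
Proof.
move=> pc x; rewrite horner_alg_sum rmorph_sum; apply: eq_bigr => i _.
by rewrite -free_algcE rmorphM rmorphXn pc.
Qed.

Lemma T_eval (S : pzAlgType K) (phi : {rmorphism free_alg K tgen -> S}) :
  (forall c, phi (algc c) = algc c) ->
  phi (horner_alg (free_gen K gh) v) = peval v (phi (free_gen K gh)) /\
  phi (horner_alg (free_gen K gh - 1) v) = peval v (phi (free_gen K gh) - 1).
Proof.
by move=> pc; rewrite !free_horner // rmorphB rmorph1.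
Qed.

Lemma T_relE x : T_rel v x <->
  [\/ x = free_gen K gh * free_gen K ga - free_gen K ga * (free_gen K gh + 1),
      x = free_gen K gh * free_gen K gb - free_gen K gb * (free_gen K gh - 1),
      x = free_gen K gb * free_gen K ga - horner_alg (free_gen K gh) v
    | x = free_gen K ga * free_gen K gb - horner_alg (free_gen K gh - 1) v].
Proof.
split=> [[]|[]]; first exact: Or41.
- exact: Or42.
- exact: Or43.
- exact: Or44.
- move=> ->; exact: T_rel_ha.
- move=> ->; exact: T_rel_hb.
- move=> ->; exact: T_rel_ba.
- move=> ->; exact: T_rel_ab.
Qed.

Lemma t_relE x : t_rel p x <->
  [\/ x = T_gen v ga ^+ p, x = T_gen v gb ^+ p | x = T_gen v gh ^+ p - T_gen v gh].
Proof.
split=> [[]|[]]; first exact: Or31.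
- exact: Or32.
- exact: Or33.
- move=> ->; exact: t_rel_a.
- move=> ->; exact: t_rel_b.
- move=> ->; exact: t_rel_h.
Qed.

Lemma t_cyc : {C : cyc_alg (t_alg v p) (@t_wt K p v) |
  [/\ forall i, cE C i = idem (t_gen v p gh) i, cup C = t_gen v p ga & cdn C = t_gen v p gb]}.
Proof.
apply: (t_pres_cyc charK).
- exact: (two_quot_rels T_relE t_relE T_eval).
- exact: (two_quot_gen tgen_generated).
- exact: (two_quot_lift T_relE t_relE tgen_lift T_eval).
Qed.

Section Graded.
Variables (A : pzAlgType K) (a b h : A) (CA : cyc_alg A (@t_wt K p v)).
Hypotheses (CE : forall i, cE CA i = idem h i) (Cup : cup CA = a) (Cdn : cdn CA = b).
Hypothesis hp : h ^+ p = h.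
Variables (n : nat) (M : lmodType A) (C : int -> M -> Prop).
Hypothesis Csub : forall j, ksubspace (C j).

Definition t_weight (j : int) (i : 'I_p) : Prop := lam K i = j%:~R / n%:R.

(** If h acts on C j as mu = j / n, then E_i, a Lagrange polynomial in h, acts as 1 when [lam i] is
    mu and as 0 otherwise. Conversely, h is the sum of the [lam i] times E_i, and only an i with
    [lam i] = mu contributes on C j. *)
Lemma t_graded_abs :
  (forall j x, C j x -> [/\ C (j + n%:Z) (a *: x), C (j - n%:Z) (b *: x)
     & h *: x = (algc (j%:~R * (n%:R)^-1 : K) : A) *: x]) <->
  cyc_graded CA n%:Z t_weight C.
Proof.
have muX (j : int) : (j%:~R / n%:R : K) ^+ p = j%:~R / n%:R.
  by rewrite -(pFrobenius_autE charK) rmorphM rmorph_int /= fmorphV rmorph_nat.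
split=> act j x Cx; have := act _ _ Cx.
- case=> Ca Cb hx; rewrite /cyc_graded Cup Cdn.
  have Ex i : cE CA i *: x = (algc (lam K i == j%:~R / n%:R)%:R : A) *: x.
    have xn k : h ^+ k *: x = (algc ((j%:~R / n%:R) ^+ k : K) : A) *: x.
      elim: k => [|k IH]; first by rewrite !expr0 rmorph1.
      by rewrite exprS -scalerA IH scalerA -algcC -scalerA hx scalerA -rmorphM -exprSr.
    rewrite CE /idem -(lagr_fixed charK) ?muX // horner_coef rmorph_sum !scaler_suml.
    by apply: eq_bigr => k _; rewrite -scalerA xn scalerA -rmorphM.
  split=> // i; first by rewrite Ex; apply: (ksubZ Csub).
  by move=> nS; rewrite Ex; case: eqP => // _; rewrite rmorph0 scale0r.
- rewrite Cup Cdn; case=> Ca Cb _ E0; split=> //.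
  rewrite -[h]mulr1 -[algc _]mulr1 -(cyc1 (c_rel CA)) !mulr_sumr !scaler_suml.
  apply: eq_bigr => i _; have [<-|nS] := pselect (t_weight j i).
    by rewrite CE (idem_eigen charK hp).
  by rewrite -!scalerA (E0 i nS) !scaler0.
Qed.
End Graded.

Lemma t_graded (CA : cyc_alg (t_alg v p) (@t_wt K p v)) :
  [/\ forall i, cE CA i = idem (t_gen v p gh) i, cup CA = t_gen v p ga & cdn CA = t_gen v p gb] ->
  forall (M : lmodType (t_alg v p)) (C : int -> M -> Prop), direct_decomposition C ->
  t_action C <-> cyc_graded CA (size v).-1%:Z (t_weight (size v).-1) C.
Proof.
case=> CE Cup Cdn M C [Csub _ _].
have hp : t_gen v p gh ^+ p = t_gen v p gh.
  exact: (t_hp (two_quot_rels T_relE t_relE T_eval)).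
exact: (t_graded_abs CE Cup Cdn hp (size v).-1 Csub).
Qed.
End TAlgebraCyclic.

(** * Path algebras and the no-cycle algebra *)

Section Paths.
Variables (K : comNzRingType) (Q : quiver).
Local Notation PA := (path_alg Q K).
Local Notation pe := (@path_elt Q K).

Lemma path_algcE (c : K) (f : PA) : algc c * f = c *: f.
Proof. by rewrite [LHS](pmulZl c (pone Q K) f) pmul1p. Qed.

Lemma path_ind (P : PA -> Prop) : P 0 -> (forall x y, P x -> P y -> P (x + y)) ->
  (forall c x, P x -> P (algc c * x)) -> (forall w, P (pe w)) -> forall x, P x.
Proof.
move=> P0 PD PZ PU; apply: (@malg_ind K _ (P : {malg K[qpath Q]} -> Prop)) => //.
by move=> c x Px; rewrite -[c *: x]path_algcE; apply: PZ.
Qed.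

Lemma peM u w : pe u * pe w = bmul K u w. Proof. exact: pmulUU. Qed.

Definition vtx (v : qvert Q) : PA := pe (ptriv v).
Fact arrow_path_subproof (e : qarr Q) : is_path (qtgt e) [:: e].
Proof. by rewrite /= eqxx. Qed.
Definition arrow_path (e : qarr Q) : qpath Q :=
  exist (fun w => is_path w.1 w.2) (qtgt e, [:: e]) (arrow_path_subproof e).
Definition arr (e : qarr Q) : PA := pe (arrow_path e).

Lemma peM_comp u w : psrc u = ptgt w -> exists x, [/\ pe u * pe w = pe x,
  ptgt x = ptgt u, parrows x = parrows u ++ parrows w & psrc x = psrc w].
Proof.
move=> e; have [x xE [h1 h2 h3]] := pcompE e; exists x; split=> //.
by rewrite peM /bmul xE.
Qed.
Lemma peM_eq u w x : psrc u = ptgt w -> ptgt x = ptgt u ->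
  parrows x = parrows u ++ parrows w -> pe u * pe w = pe x.
Proof.
move=> e t a; have [y [-> ty ay _]] := peM_comp e; congr path_elt.
by apply: qpathP; rewrite ?t ?ty // a.
Qed.
Lemma peM0 u w : psrc u <> ptgt w -> pe u * pe w = 0.
Proof. by move=> e; rewrite peM /bmul pcompN. Qed.

Lemma vtx_pe v w : vtx v * pe w = if v == ptgt w then pe w else 0.
Proof.
case: eqP => [->|e]; first by apply: peM_eq.
exact: peM0.
Qed.
Lemma pe_vtx v w : pe w * vtx v = if psrc w == v then pe w else 0.
Proof.
case: eqP => [<-|e]; first by apply: peM_eq; rewrite ?cats0.
exact: peM0.
Qed.
Lemma vtx_sum1 : \sum_v vtx v = 1. Proof. by []. Qed.

(** Induction on the length, removing the leftmost arrow, which is the last one travelled. x is any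
    path with the data of e after w, so that applications never build the dependent pair. *)
Lemma path_elim (P : qpath Q -> Prop) : (forall v, P (ptriv v)) ->
  (forall e w, qsrc e = ptgt w -> P w ->
    forall x, pe x = arr e * pe w -> ptgt x = qtgt e -> psrc x = psrc w ->
       parrows x = e :: parrows w -> P x) -> forall w, P w.
Proof.
move=> P0 PS w; have [n] := ubnP (size (parrows w)); elim: n w => // n IH w.
case wE: (parrows w) => [|e s].
  by move=> _; rewrite (_ : w = ptriv (ptgt w)) //; apply: qpathP.
move=> /= sn; have := valP w; rewrite /= -/(ptgt w) -/(parrows w) wE => /andP[/eqP te ps].
pose w' : qpath Q := exist (fun w => is_path w.1 w.2) (qsrc e, s) ps.
apply: (PS e w') => //; first exact: IH.
- by apply/esym/peM_eq.
- by rewrite /psrc wE.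
Qed.

Lemma path_generated : alg_generated
  (fun x : PA => (exists v, x = vtx v) \/ exists e, x = arr e).
Proof.
move=> P Pc PD PM PG; apply: path_ind => //.
- by have := Pc 0; rewrite rmorph0.
- by move=> c x Px; apply: PM.
apply: path_elim => [v|e w _ Pw x -> _ _ _]; first by apply: PG; left; exists v.
exact: (PM _ _ (PG _ (or_intror (ex_intro _ e erefl))) Pw).
Qed.

Section Lift.
Variables (B : pzAlgType K) (V : qvert Q -> B) (g : qarr Q -> B).
Hypotheses (VM : forall v w, V v * V w = if v == w then V v else 0)
  (V1 : \sum_v V v = 1) (Vg : forall e, V (qtgt e) * g e = g e)
  (gV : forall e, g e * V (qsrc e) = g e).

(** The factor [V (ptgt w)] gives the trivial paths their value; on longer paths the leftmost arrow
    absorbs it. *)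
Definition path_val (w : qpath Q) : B := V (ptgt w) * \prod_(e <- parrows w) g e.

Lemma path_val_cons e w x : qsrc e = ptgt w -> ptgt x = qtgt e ->
  parrows x = e :: parrows w -> path_val x = g e * path_val w.
Proof.
move=> s t a; rewrite /path_val t a big_cons mulrA Vg -s.
by rewrite mulrA gV.
Qed.

Lemma path_val_src w : path_val w * V (psrc w) = path_val w.
Proof.
elim/path_elim: w => [v|e w s IH x _ t sx a].
  by rewrite /path_val big_nil mulr1 VM eqxx.
by rewrite (path_val_cons s t a) sx -mulrA IH.
Qed.

Lemma path_val_tgt w : V (ptgt w) * path_val w = path_val w.
Proof. by rewrite /path_val mulrA VM eqxx. Qed.

Definition path_lift_fun (x : PA) : B := lext path_val x.

Lemma path_lift_pe w : path_lift_fun (pe w) = path_val w.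
Proof. exact: lextU. Qed.

Lemma path_lift : {phi : {rmorphism PA -> B} | (forall c, phi (algc c) = algc c) /\
  forall w, phi (pe w) = path_val w}.
Proof.
have FD x y : path_lift_fun (x + y) = path_lift_fun x + path_lift_fun y by exact: lextD.
have FZ c x : path_lift_fun (algc c * x) = algc c * path_lift_fun x.
  by rewrite path_algcE; apply: lextZ.
have F0 : path_lift_fun 0 = 0 by have := FZ 0 0; rewrite !rmorph0 !mul0r.
have F1 : path_lift_fun 1 = 1.
  rewrite -vtx_sum1 -V1 (big_morph path_lift_fun FD F0); apply: eq_bigr => v _.
  by rewrite path_lift_pe /path_val big_nil mulr1.
have FM u w : path_lift_fun (pe u * pe w) = path_lift_fun (pe u) * path_lift_fun (pe w).
  suff h : path_lift_fun (pe u * pe w) = path_val u * path_val w.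
    exact: (etrans h (esym (f_equal2 *%R (path_lift_pe u) (path_lift_pe w)))).
  have [e|ne] := eqVneq (psrc u) (ptgt w).
    have [x [-> t a s]] := peM_comp e; rewrite path_lift_pe.
    by rewrite {3}/path_val -e mulrA path_val_src /path_val t a big_cat mulrA.
  (* For paths that do not compose, the values multiply to zero because the idempotents at their
     ends are orthogonal. *)
  rewrite (peM0 (elimN eqP ne)) F0 -[path_val u]path_val_src -[path_val w]path_val_tgt.
  by rewrite -mulrA (mulrA (V _)) VM (negbTE ne) mul0r mulr0.
exists (alg_hom path_ind FD FZ F1 FM); split; first exact: alg_hom_c.
exact: path_lift_pe.
Qed.
End Lift.
End Paths.

Record path_rels (K : comNzRingType) (Q : quiver) (B : pzAlgType K)
    (V : qvert Q -> B) (g : qarr Q -> B) : Prop := PathRels {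
  p_VM : forall v w, V v * V w = if v == w then V v else 0;
  p_V1 : \sum_v V v = 1;
  p_Vg : forall e, V (qtgt e) * g e = g e;
  p_gV : forall e, g e * V (qsrc e) = g e;
  p_cycle : forall w, parrows w <> [::] -> psrc w = ptgt w -> path_val V g w = 0
}.

Section PathQuotient.
Variables (K : comNzRingType) (Q : quiver) (S : path_alg Q K -> Prop).
Hypothesis SE : forall x, S x <->
  exists w, [/\ parrows w <> [::], psrc w = ptgt w & x = path_elt K w].
Local Notation pi := (quot_pi S).

Let pi_M a b : pi (a * b) = pi a * pi b.
Proof. exact: (rmorphM (quot_pi S)). Qed.

Lemma quot_vtx_arr e : pi (vtx K (qtgt e)) * pi (arr K e) = pi (arr K e).
Proof.
apply: etrans (esym (pi_M _ _)) _; congr (pi _); apply: etrans (vtx_pe _ _ _) _.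
by rewrite ifT.
Qed.
Lemma quot_arr_vtx e : pi (arr K e) * pi (vtx K (qsrc e)) = pi (arr K e).
Proof.
apply: etrans (esym (pi_M _ _)) _; congr (pi _); apply: etrans (pe_vtx _ _ _) _.
by rewrite ifT.
Qed.

Lemma path_val_quot w : path_val (fun v => pi (vtx K v)) (fun e => pi (arr K e)) w =
  pi (path_elt K w).
Proof.
move: w; apply: (@path_elim K Q) => [v|e w s IH x xE t _ a].
  by rewrite /path_val /parrows /= big_nil mulr1.
rewrite (path_val_cons quot_vtx_arr quot_arr_vtx s t a) IH.
exact: esym (etrans (congr1 pi xE) (pi_M _ _)).
Qed.

Lemma path_quot_rels : path_rels (fun v => pi (vtx K v)) (fun e => pi (arr K e)).
Proof.
split.
- move=> v w; apply: etrans (esym (pi_M _ _)) _.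
  apply: etrans (congr1 pi (vtx_pe K v (ptriv w))) _.
  have -> : ptgt (ptriv w) = w by [].
  by case: eqP => [->//|_]; apply: rmorph0.
- by apply: etrans (esym (rmorph_sum pi _ _ _)) _; rewrite vtx_sum1; apply: rmorph1.
- exact: quot_vtx_arr.
- exact: quot_arr_vtx.
- move=> w wn wc; apply: etrans (path_val_quot w) _; apply: quot_pi_rel.
  by apply/SE; exists w.
Qed.

Lemma path_quot_generated :
  alg_generated (fun x => (exists v, x = pi (vtx K v)) \/ exists e, x = pi (arr K e)).
Proof.
move=> P Pc PD PM PG; apply: (quot_generated (@path_generated K Q)) => //.
by move=> _ [x [[v ->]|[e ->]] ->]; apply: PG; [left; exists v|right; exists e].
Qed.

Lemma path_quot_lift (B : pzAlgType K) V (g : qarr Q -> B) : path_rels V g ->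
  {phi : {rmorphism alg_quot S -> B} | [/\ forall c, phi (algc c) = algc c,
    forall v, phi (pi (vtx K v)) = V v & forall e, phi (pi (arr K e)) = g e]}.
Proof.
case=> VM V1 Vg gV cyc; have [phi [pc pw]] := path_lift VM V1 Vg gV.
have z x : S x -> phi x = 0 by move=> /SE[w [wn wc ->]]; rewrite pw cyc.
exists (quot_lift z); split=> [c|v|e]; rewrite ?quot_liftE.
- exact: pc.
- by rewrite pw /path_val big_nil mulr1.
- by rewrite pw /path_val big_seq1 Vg.
Qed.
End PathQuotient.

Lemma rev_ordS k (i : 'I_k) : ordS (rev_ord (ordS i)) = rev_ord i.
Proof.
apply: val_inj => /=; have [lt|ge] := ltnP i.+1 k.
  rewrite (modn_small lt) subnSK // modn_small //.
  by rewrite ltn_subrL (leq_ltn_trans _ lt).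
have -> : i.+1 = k by apply/eqP; rewrite eqn_leq ge ltn_ord.
rewrite modnn subn1 prednK ?modnn ?subnn //.
exact: leq_ltn_trans (ltn_ord i).
Qed.

Lemma iter_ord_pred_full k (i : 'I_k) : iter k (@ord_pred _) i = i.
Proof.
have h t : iter t (@ord_pred _) (iter t (@ordS _) i) = i.
  by elim: t => [//|t IH]; rewrite iterSr iterS ordSK IH.
by rewrite -{1}[i](@iter_ordS_full k) h.
Qed.

Section CyclicQuiver.
Variables (K : comNzRingType) (k : nat).
Local Notation Q := (cyclic_quiver k).
Local Notation zero := (fun _ : 'I_k => 0 : K).

Section ToCyc.
Variables (B : pzAlgType K) (V : qvert Q -> B) (g : qarr Q -> B).
Hypothesis nR : @path_rels K Q B V g.

Section Walk.
Variables (f : 'I_k -> 'I_k + 'I_k) (tau : 'I_k -> 'I_k).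
Hypotheses (fsrc : forall i, @qsrc Q (f i) = i) (ftgt : forall i, @qtgt Q (f i) = tau i).
Hypotheses (tauI : injective tau) (tauk : forall i, iter k tau i = i).
(** One of the two directions around the circle: [f i] is the arrow leaving i and [tau i] its
    target, so that the a_i and the b_i are treated at once. *)
Definition walk : B := \sum_i g (f i).

Lemma walkV i : walk * V i = g (f i).
Proof.
rewrite /walk mulr_suml (bigD1 i) //= -[X in _ * V X]fsrc (p_gV nR) big1 ?addr0 // => j ji.
by rewrite -(p_gV nR) -mulrA (p_VM nR) fsrc (negbTE ji) mulr0.
Qed.
Lemma Vwalk i : V (tau i) * walk = g (f i).
Proof.
rewrite /walk mulr_sumr (bigD1 i) //= -ftgt (p_Vg nR) big1 ?addr0 // => j ji.
by rewrite -(p_Vg nR) mulrA (p_VM nR) !ftgt (inj_eq tauI) eq_sym (negbTE ji) mul0r.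
Qed.
Lemma walk_comm i : walk * V i = V (tau i) * walk.
Proof. by rewrite walkV Vwalk. Qed.

Lemma walk_path t i : exists w : qpath Q, [/\ walk ^+ t * V i = path_val V g w,
  psrc w = i, ptgt w = iter t tau i & size (parrows w) = t].
Proof.
elim: t => [|t [w [wE ws wt wz]]].
  by exists (@ptriv Q i); rewrite mul1r /path_val big_nil mulr1.
have e : @qsrc Q (f (iter t tau i)) = ptgt w by rewrite fsrc wt.
have [x [_ xt xa xs]] := @peM_comp K Q (@arrow_path Q (f (iter t tau i))) w e.
exists x; rewrite xs xt xa /= wz; split=> //; last exact: ftgt.
rewrite exprS -mulrA wE (path_val_cons (p_Vg nR) (p_gV nR) e xt xa) -walkV -mulrA.
by rewrite -wt (path_val_tgt _ (p_VM nR)).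
Qed.

(** The only path of length k from i in the given direction returns to i, hence is a closed
    nontrivial path. *)
Lemma walk_nil : walk ^+ k = 0.
Proof.
rewrite -[LHS]mulr1 -(p_V1 nR) mulr_sumr big1 // => i _.
have [w [-> ws wt wz]] := walk_path k i; apply: (p_cycle nR).
  by move=> w0; move: (leq_ltn_trans (leq0n i) (ltn_ord i)); rewrite -[X in (_ < X)%N]wz w0.
by rewrite ws wt tauk.
Qed.
End Walk.

Lemma two_cycle (e e' : qarr Q) :
  @qsrc Q e = @qtgt Q e' -> @qtgt Q e = @qsrc Q e' -> g e * g e' = 0.
Proof.
move=> h h'; have [x [_ xt xa xs]] := @peM_comp K Q (@arrow_path Q e) (@arrow_path Q e') h.
have <- : path_val V g x = 0.
  by apply: (p_cycle nR); rewrite ?xa // xs xt; exact: esym h'.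
rewrite (path_val_cons (p_Vg nR) (p_gV nR) (w := @arrow_path Q e') h xt xa).
by rewrite /path_val big_seq1 [ptgt _]/= (p_Vg nR).
Qed.

Definition arr_up (i : 'I_k) : 'I_k + 'I_k := inr (ord_pred i).
(** The b_i, which have degree 1, make up [up] but lower the vertex index; the reversal turns this
    into a step from s to s + 1. *)
Definition cyc_vtx (s : 'I_k) : B := V (rev_ord s).

(** The weights are 0 because up followed by dn, or dn followed by up, is at each vertex a closed
    path of length two. *)
Lemma path_rels_cyc : cyc_rel zero cyc_vtx (walk arr_up) (walk inl).
Proof.
have upsrc i : @qsrc Q (arr_up i) = i by rewrite /= ord_predK.
have uptgt i : @qtgt Q (arr_up i) = ord_pred i by [].
have dnsrc i : @qsrc Q (inl i) = i by [].
have dntgt i : @qtgt Q (inl i) = ordS i by [].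
have revS i : rev_ord (ordS i) = ord_pred (rev_ord i) :> 'I_k.
  by apply: (@ordS_inj k); rewrite rev_ordS ord_predK.
have z (x : B) : algc (0 : K) * x = 0 by rewrite rmorph0 mul0r.
split; rewrite /cyc_vtx.
- move=> i j; rewrite (p_VM nR) (inj_eq rev_ord_inj).
  by [].
- by rewrite -(p_V1 nR) [RHS](reindex_inj rev_ord_inj).
- by move=> i; rewrite (walk_comm upsrc uptgt (@ord_pred_inj k)) revS.
- move=> i; rewrite (walk_comm dnsrc dntgt (@ordS_inj k)) rev_ordS.
  by [].
- move=> i; rewrite z -mulrA (walkV upsrc) -(p_Vg nR) mulrA.
  by rewrite (walkV dnsrc) two_cycle //= ord_predK.
- move=> i; rewrite z -mulrA (walkV dnsrc) -(p_Vg nR) mulrA.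
  by rewrite (walkV upsrc) two_cycle //= ?ordSK // ord_predK.
- exact: (walk_nil upsrc uptgt (@iter_ord_pred_full k)).
- exact: (walk_nil dnsrc dntgt (@iter_ordS_full k)).
Qed.
End ToCyc.

Section FromCyc.
Variables (B : pzAlgType K) (E : 'I_k -> B) (up dn : B).
Hypothesis R : cyc_rel zero E up dn.

Definition cyc_arr (e : qarr Q) : B :=
  match e : 'I_k + 'I_k with inl i => dn * E (rev_ord i) | inr i => up * E (rev_ord (ordS i)) end.
Let V (v : qvert Q) : B := E (rev_ord (v : 'I_k)).

Local Notation pval := (@path_val K Q B V cyc_arr).

Lemma cyc_updn0 : up * dn = 0.
Proof.
apply: (cyc_ext R) => i; rewrite -[i]ord_predK (cyc_updn R) rmorph0 !mul0r.
by [].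
Qed.
Lemma cyc_dnup0 : dn * up = 0.
Proof. by apply: (cyc_ext R) => i; rewrite (cyc_dnup R) rmorph0 !mul0r. Qed.

Lemma cyc_VM v w : V v * V w = if v == w then V v else 0.
Proof. by rewrite /V (cycE R) (inj_eq rev_ord_inj). Qed.
Lemma cyc_arr_tgt e : V (@qtgt Q e) * cyc_arr e = cyc_arr e.
Proof.
case: e => i /=; rewrite /V mulrA.
- by rewrite (cyc_dn R) rev_ordS -mulrA (cycE R) eqxx.
- by rewrite -(rev_ordS i) -(cyc_up R) -mulrA (cycE R) eqxx.
Qed.
Lemma cyc_arr_src e : cyc_arr e * V (@qsrc Q e) = cyc_arr e.
Proof. by case: e => i /=; rewrite /V -mulrA (cycE R) eqxx. Qed.

(* A word that uses both [up] and [dn] vanishes, so that the length of a closed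
   path with nonzero value is divisible by k; then up ^ k = dn ^ k = 0 applies. *)
Lemma cyc_path_val (w : qpath Q) :
  [\/ pval w = 0,
      pval w = dn ^+ size (parrows w) * V (psrc w) /\
        ptgt w = iter (size (parrows w)) (@ordS _) (psrc w)
    | pval w = up ^+ size (parrows w) * V (psrc w) /\
        psrc w = iter (size (parrows w)) (@ordS _) (ptgt w)].
Proof.
move: w; apply: (@path_elim K Q) => [v|e w s IH x _ t sx a].
  by apply: Or32; rewrite /path_val big_nil mulr1 mul1r.
rewrite (path_val_cons cyc_arr_tgt cyc_arr_src s t a) sx a /=.
have mulE y i : V (ptgt w) = E i -> y * E i * pval w = y * pval w.
  by move=> <-; rewrite -mulrA (path_val_tgt _ cyc_VM).
have vE : E (rev_ord (@qsrc Q e)) = V (ptgt w) by rewrite s.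
case: IH => [->|[wE wt]|[wE wt]]; first by apply: Or31; rewrite mulr0.
- case: e s t a vE => i /= s t a vE; rewrite mulE -?vE // wE.
  + by apply: Or32; rewrite mulrA -exprS t s wt.
  + case wz: (size (parrows w)) wt => [|n] wt; last first.
      by apply: Or31; rewrite exprS !mulrA cyc_updn0 !mul0r.
    apply: Or33; rewrite expr0 mul1r expr1; split=> //.
    by rewrite t /=; apply: etrans (esym wt) (esym s).
- case: e s t a vE => i /= s t a vE; rewrite mulE -?vE // wE.
  + case wz: (size (parrows w)) wt => [|n] wt; last first.
      by apply: Or31; rewrite exprS !mulrA cyc_dnup0 !mul0r.
    apply: Or32; rewrite expr0 mul1r expr1; split=> //.
    by rewrite t wt /= -s.
  + by apply: Or33; rewrite mulrA -exprS -iterS iterSr t; split=> //; rewrite wt -s.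
Qed.

Lemma iter_ordS_fix t (i : 'I_k) : iter t (@ordS _) i = i -> (0 < t)%N -> (k <= t)%N.
Proof.
move=> /(congr1 val) /=; rewrite iter_ordS => e t0; apply: dvdn_leq => //.
have := congr1 (modn^~ k) e; rewrite modn_mod -{2}[val i]addn0 => /eqP.
by rewrite eqn_modDl mod0n.
Qed.

Lemma cyc_path_rels : @path_rels K Q B V cyc_arr.
Proof.
split.
- exact: cyc_VM.
- by rewrite -(cyc1 R) [RHS](reindex_inj rev_ord_inj).
- exact: cyc_arr_tgt.
- exact: cyc_arr_src.
move=> w wn wc; have w0 : (0 < size (parrows w))%N by case: (parrows w) wn.
case: (cyc_path_val w) => [//|[-> /esym]|[-> /esym]]; rewrite wc => /iter_ordS_fix/(_ w0) kw.
- by rewrite (dnX0 R kw) mul0r.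
- by rewrite (upX0 R kw) mul0r.
Qed.
End FromCyc.
End CyclicQuiver.

Section CyclicQuiverAlgebra.
Variables (K : comNzRingType) (k : nat) (N : pzAlgType K).
Local Notation Q := (cyclic_quiver k).
Variables (V : qvert Q -> N) (g : qarr Q -> N).
Hypothesis nR : path_rels V g.

Lemma walk_dnV i : walk g inl * V i = g (inl i).
Proof. exact: (walkV nR (f := inl)). Qed.

Lemma walk_upV i : walk g (@arr_up k) * V (ordS i) = g (inr i).
Proof.
rewrite (walkV nR) => [|j]; first by rewrite /arr_up ordSK.
by rewrite /= ord_predK.
Qed.

Hypothesis gen : alg_generated (fun x => (exists v, x = V v) \/ exists e, x = g e).
Hypothesis lift : forall (B : pzAlgType K) (V' : qvert Q -> B) (g' : qarr Q -> B),
  path_rels V' g' -> {phi : {rmorphism N -> B} | [/\ forall c, phi (algc c) = algc c,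
    forall v, phi (V v) = V' v & forall e, phi (g e) = g' e]}.

(** Single arrows are recovered by cutting a walk with a vertex idempotent, so the E_i, up and dn
    generate. *)
Lemma path_pres_cyc : {C : cyc_alg N (fun _ : 'I_k => 0 : K) |
  [/\ forall s, cE C s = V (rev_ord s), cup C = walk g (@arr_up k) & cdn C = walk g inl]}.
Proof.
unshelve eexists; first unshelve eapply (CycAlg (path_rels_cyc nR)); last by [].
- move=> P Pc PD PM PG.
  have PV v : P (V v).
    by apply: PG; apply: Or31; exists (rev_ord v); rewrite /cyc_vtx rev_ordK.
  apply: gen => // x [[v ->]//|[[i|i] ->]].
  + by rewrite -walk_dnV; apply: PM => //; apply: PG; apply: Or33.
  + by rewrite -walk_upV; apply: PM => //; apply: PG; apply: Or32.
- move=> S E up dn R; have [phi [pc pV pg]] := lift (cyc_path_rels R).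
  exists phi; split=> // [i||]; first by rewrite /cyc_vtx pV rev_ordK.
  + rewrite /walk rmorph_sum -[RHS]mulr1 -(cyc1 R) (reindex_inj rev_ord_inj) mulr_sumr.
    by apply: eq_bigr => i _; rewrite pg /= ord_predK rev_ordK.
  + rewrite /walk rmorph_sum -[RHS]mulr1 -(cyc1 R) (reindex_inj rev_ord_inj) mulr_sumr.
    by apply: eq_bigr => i _; rewrite pg /= rev_ordK.
Qed.
End CyclicQuiverAlgebra.

Section NoCycle.
Variables (K : fieldType) (k : nat).
Local Notation Q := (cyclic_quiver k).
Local Notation N := (nocycle_alg K k).
Local Notation pi := (quot_pi (@nocycle_rel K k)).

Lemma nocycle_relE x : nocycle_rel x <->
  exists w : qpath Q, [/\ parrows w <> [::], psrc w = ptgt w & x = path_elt K w].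
Proof. by split=> [[w]|[w [? ? ->]]]; [exists w|apply: NocycleRel]. Qed.

Let nR := path_quot_rels nocycle_relE.

Definition nocycle_vtx (v : qvert Q) : N := pi (vtx K v).
Definition nocycle_arr (e : qarr Q) : N := pi (arr K e).

Lemma nocycle_cyc : {C : cyc_alg N (fun _ : 'I_k => 0 : K) |
  [/\ forall s, cE C s = nocycle_vtx (rev_ord s), cup C = walk nocycle_arr (@arr_up k)
    & cdn C = walk nocycle_arr inl]}.
Proof.
apply: (path_pres_cyc nR); first exact: path_quot_generated.
by move=> B V g; apply: (path_quot_lift nocycle_relE).
Qed.

Lemma path_homog (w : qpath Q) : nocycle_homog (path_deg w) (pi (path_elt K w)).
Proof.
exists (path_elt K w) => // w' /(fsubsetP msuppU_le).
by rewrite in_fset1 => /eqP ->.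
Qed.

Lemma arr_homog (e : qarr Q) : nocycle_homog (arrow_deg e) (nocycle_arr e).
Proof.
have := path_homog (@arrow_path Q e).
by rewrite /path_deg big_seq1.
Qed.

(** Every degree may occur at every vertex, so the support condition is [True]. In the converse
    direction an arrow is a walk times an idempotent, a path is a product of arrows, and a
    homogeneous element is a combination of paths of its degree. *)
Lemma nocycle_graded (CA : cyc_alg N (fun _ : 'I_k => 0 : K)) :
  [/\ forall s, cE CA s = nocycle_vtx (rev_ord s), cup CA = walk nocycle_arr (@arr_up k)
    & cdn CA = walk nocycle_arr inl] ->
  forall (M : lmodType N) (C : int -> M -> Prop), direct_decomposition C ->
  nocycle_action C <-> cyc_graded CA 1 (fun _ _ => True) C.
Proof.
case=> CE Cup Cdn M C [Csub _ _]; split=> act.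
- move=> j x Cx; rewrite Cup Cdn; split=> //.
  + rewrite scaler_suml; apply: (big_ind (C (j + 1))).
    * exact: ksub0.
    * exact: ksubD.
    move=> i _; rewrite addrC; apply: act Cx; exact: (arr_homog (inr (ord_pred i))).
  + rewrite scaler_suml; apply: (big_ind (C (j - 1))).
    * exact: ksub0.
    * exact: ksubD.
    move=> i _; rewrite addrC; apply: act Cx; exact: (arr_homog (inl i)).
  + move=> i; rewrite CE; have := act _ _ _ _ (path_homog (ptriv (rev_ord i : qvert Q))) Cx.
    by rewrite /path_deg big_nil add0r.
have arrC e j x : C j x -> C (arrow_deg e + j) (nocycle_arr e *: x).
  move=> Cx; rewrite addrC; case: e => i.
  + have h := walk_dnV nR i; rewrite -[nocycle_arr _]h -scalerA.
    have [_ _ CEx _] := act _ _ Cx; have := CEx (rev_ord i).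
    by rewrite CE rev_ordK => /act[_]; rewrite Cdn.
  + have h := walk_upV nR i; rewrite -[nocycle_arr _]h -scalerA.
    have [_ _ CEx _] := act _ _ Cx; have := CEx (rev_ord (ordS i)).
    by rewrite CE rev_ordK => /act[]; rewrite Cup.
have pathC (w : qpath Q) j x : C j x -> C (path_deg w + j) (pi (path_elt K w) *: x).
  move: w; apply: (@path_elim K Q) => [v Cx|e w s IH y yE _ _ a Cx].
    have [_ _ CEx _] := act _ _ Cx; have := CEx (rev_ord v).
    by rewrite CE rev_ordK /path_deg big_nil add0r.
  have -> : pi (path_elt K y) = nocycle_arr e * pi (path_elt K w).
    exact: etrans (congr1 pi yE) (rmorphM pi _ _).
  rewrite -scalerA /path_deg a big_cons -addrA; apply: arrC; exact: IH.
move=> d y j x [f fd ->] Cx.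
have -> : pi f = \sum_(w <- msupp f) algc f@_w * pi (path_elt K w).
  apply: etrans (congr1 pi (path_algE f)) _.
  apply: etrans (rmorph_sum pi _ _ _) _; apply: eq_bigr => w _.
  apply: etrans (congr1 pi (esym (path_algcE _ _))) _.
  exact: rmorphM.
rewrite scaler_suml big_seq; apply: (big_ind (C (d + j))).
- exact: ksub0.
- exact: ksubD.
by move=> w /fd <-; rewrite -scalerA; apply: (ksubZ Csub); apply: pathC.
Qed.
End NoCycle.

(** * Segments between the breaks *)

Section OrdinalSuccessor.
Local Open Scope nat_scope.

(** Replaces the case distinction at the wrap-around by a linear term; L is what f gains in one
    turn. *)
Lemma ordS_wrap l (i : 'I_l) (f : nat -> nat) L : f 0 = 0 -> f l = L ->
  f i.+1 = f (ordS i) + (i.+1 == l) * L.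
Proof.
move=> f0 fl; case: eqP => [e|ne] /=; first by rewrite e modnn f0 mul1n.
by rewrite modn_small ?mul0n ?addn0 //; have := ltn_ord i; lia.
Qed.

Lemma iter_ordS_small l (i : 'I_l) t : i + t < l -> iter t (@ordS _) i = i + t :> nat.
Proof. by move=> lt; rewrite iter_ordS modn_small. Qed.

Lemma sum_iter_ordS l (j : 'I_l) (f : 'I_l -> nat) :
  \sum_(t < l) f (iter t (@ordS _) j) = \sum_i f i.
Proof.
have inj : injective (fun t : 'I_l => iter t (@ordS _) j).
  move=> t t' /(congr1 val) /=; rewrite !iter_ordS => /eqP; rewrite eqn_modDl.
  by rewrite !modn_small // => /eqP/val_inj.
by rewrite [RHS](reindex_inj inj).
Qed.
End OrdinalSuccessor.

Section Breaks.
Local Open Scope nat_scope.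
Variables (b : pred nat) (p : nat).

Definition cnt (q : nat) : nat := count b (iota 0 q).
Lemma cnt0 : cnt 0 = 0. Proof. by []. Qed.
Lemma cntS q : cnt q.+1 = cnt q + b q.
Proof. by rewrite /cnt -addn1 iotaD count_cat /= add0n addn0. Qed.
Lemma cnt_homo : {homo cnt : i j / i <= j}.
Proof. by move=> i j /subnK <-; rewrite addnC /cnt iotaD count_cat leq_addr. Qed.

(** The first point preceded by at least i breaks, that is the start of segment i. Where there is
    none, [find] returns p; this makes [rep (cnt p)] the end of the last segment ([rep_full]). *)
Definition rep (i : nat) : nat := find (fun q => i <= cnt q) (iota 0 p).

Lemma rep_le i : rep i <= p.
Proof. by rewrite -[leqRHS](size_iota 0) find_size. Qed.
Lemma ltn_rep i q : q < rep i -> cnt q < i.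
Proof.
move=> qr; have := before_find 0 qr.
by rewrite nth_iota ?add0n ?(leq_trans qr (rep_le i)) // leqNgt => /negbFE.
Qed.
Lemma rep_leq i q : q < p -> i <= cnt q -> rep i <= q.
Proof. by move=> qp iq; rewrite leqNgt; apply/negP => /ltn_rep; rewrite ltnNge iq. Qed.
Lemma rep0 : rep 0 = 0.
Proof. by rewrite /rep; case: p. Qed.
Lemma cnt_rep i : i <= cnt p -> cnt (rep i) = i.
Proof.
move=> ip; apply/eqP; rewrite eqn_leq; apply/andP; split.
  case rE: (rep i) => [|q] //; have := @ltn_rep i q; rewrite rE => /(_ (leqnn _)).
  by rewrite cntS; case: (b q); rewrite ?addn1 // addn0 => /ltnW.
have := rep_le i; rewrite leq_eqVlt => /orP[/eqP -> //|rp].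
have h : has (fun q => i <= cnt q) (iota 0 p) by rewrite has_find size_iota.
by have := nth_find 0 h; rewrite -/(rep i) nth_iota.
Qed.
Lemma rep_break q : q < p -> b q -> rep (cnt q).+1 = q.+1.
Proof.
move=> qp bq; apply/eqP; rewrite eqn_leq; apply/andP; split.
  have := qp; rewrite leq_eqVlt => /orP[/eqP ->|qp']; first exact: rep_le.
  by apply: rep_leq => //; rewrite cntS bq addn1.
have := @cnt_rep (cnt q).+1; have := cnt_homo qp; rewrite cntS bq addn1 => h /(_ h) e.
by rewrite ltnNge; apply/negP => /cnt_homo; rewrite e ltnn.
Qed.
Lemma rep_homo i j : i <= j -> j <= cnt p -> rep i <= rep j.
Proof.
move=> ij jp; case: (ltnP (rep j) p) => [lt|ge]; last exact: leq_trans (rep_le i) ge.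
by apply: rep_leq => //; rewrite cnt_rep.
Qed.
Lemma rep_ltS i : i < cnt p -> rep i < rep i.+1.
Proof.
move=> ip; rewrite ltn_neqAle rep_homo // andbT; apply/eqP => /(congr1 cnt).
by rewrite !cnt_rep ?(ltnW ip) // => /eqP; rewrite ltn_eqF.
Qed.
Lemma cnt_segment i t : i < cnt p -> rep i + t < rep i.+1 -> cnt (rep i + t) = i.
Proof.
move=> ip lt; apply/eqP; rewrite eqn_leq -ltnS ltn_rep //=.
by rewrite -{1}(@cnt_rep i) ?(ltnW ip) // cnt_homo // leq_addr.
Qed.
(** [cnt] stays i throughout segment i and becomes i + 1 at the next first point, so the jump, and
    with it the break, is at the last point. *)
Lemma break_segment i t : i < cnt p -> rep i + t < rep i.+1 ->
  b (rep i + t) = (rep i + t.+1 == rep i.+1).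
Proof.
move=> ip lt; have := cntS (rep i + t); rewrite cnt_segment // -addnS.
case: eqP => [->|ne]; first by rewrite cnt_rep //; case: (b _) => //; lia.
rewrite cnt_segment //; last by lia.
by case: (b _) => //; lia.
Qed.

Hypotheses (p0 : 0 < p) (bp : b p.-1).

Lemma cnt_lt q : q < p -> cnt q < cnt p.
Proof.
move=> qp; rewrite -(prednK p0) cntS bp addn1 ltnS; apply: cnt_homo.
by rewrite -ltnS prednK.
Qed.
Lemma rep_full : rep (cnt p) = p.
Proof.
apply/eqP; rewrite eqn_leq rep_le leqNgt; apply/negP => /cnt_lt.
by rewrite cnt_rep // ltnn.
Qed.
Lemma rep_lt i : i < cnt p -> rep i < p.
Proof. by move=> ip; apply: leq_trans (rep_ltS ip) (rep_le _). Qed.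
Lemma rep_cnt_le q : q < p -> rep (cnt q) <= q.
Proof. by move=> qp; apply: rep_leq. Qed.
Lemma nbreak_lt q : q < p -> ~~ b q -> q.+1 < p.
Proof.
move=> qp nb; rewrite ltn_neqAle qp andbT; apply/eqP => e.
by move: nb; rewrite -[q]/(q.+1.-1) e bp.
Qed.
End Breaks.

(** * The two coverings between Z/p and Z/k *)

Section Coverings.
Variables (K : fieldType) (b : pred nat) (p : nat) (u : 'I_p -> K).
Hypotheses (p0 : (0 < p)%N) (bp : b p.-1) (bE : forall q : 'I_p, b q = (u q == 0)).
Local Notation k := (cnt b p).
Local Notation zero := (fun _ : 'I_k => 0 : K).

Definition seg (q : 'I_p) : 'I_k := Ordinal (cnt_lt p0 bp (ltn_ord q)).
Definition first (i : 'I_k) : 'I_p := Ordinal (rep_lt (ltn_ord i)).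
Definition len (i : nat) : nat := (rep b p i.+1 - rep b p i)%N.
Definition depth (q : nat) : nat := (q - rep b p (cnt b q))%N.
(** The coefficient of dn in [cov_seg]: inside a segment the step is empty and dn must be
    multiplication by [u q]; at a break dn is the arrow itself, with coefficient 1. *)
Definition unz (q : 'I_p) : K := if u q == 0 then 1 else u q.

Lemma unz_neq0 q : unz q != 0.
Proof. by rewrite /unz; case: ifPn => [_|//]; rewrite oner_neq0. Qed.

Definition cov_seg : covering K k p :=
  {| cs := seg; ce := fun q => nat_of_bool (b q); cc := unz |}.
(** The inverted scalar is the product of the nonzero weights of the segment ([ccoef_seg_len]), so
    that dn returns from the round trip through [cov_seg] with coefficient 1. *)
Definition cov_first : covering K p k :=
  {| cs := first; ce := fun i => len i;
     cc := fun i => (ccoef cov_seg (first i) (len i))^-1 |}.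

Lemma len_gt0 (i : 'I_k) : (0 < len i)%N.
Proof. by rewrite subn_gt0 rep_ltS. Qed.
Lemma rep_len (i : 'I_k) : (rep b p i + len i = rep b p i.+1)%N.
Proof. by rewrite subnKC // ltnW // rep_ltS. Qed.

Lemma iter_first (i : 'I_k) t : (t < len i)%N ->
  iter t (@ordS _) (first i) = (rep b p i + t)%N :> nat.
Proof.
move=> tl; rewrite iter_ordS_small //=; apply: leq_trans (rep_le b p i.+1).
by rewrite -rep_len ltn_add2l.
Qed.

Lemma break_iter (i : 'I_k) t : (t < len i)%N ->
  (u (iter t (@ordS _) (first i)) == 0) = (t.+1 == len i).
Proof.
move=> tl; rewrite -bE iter_first // break_segment //.
  by rewrite -(rep_len i) eqn_add2l.
by rewrite -rep_len ltn_add2l.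
Qed.

Lemma seg_first i : seg (first i) = i.
Proof. by apply: val_inj; rewrite /= cnt_rep // ltnW. Qed.

Lemma depth_lt (q : 'I_p) : (depth q < len (seg q))%N.
Proof.
have := ltn_ord q; rewrite /depth /len /= => qp.
have := rep_cnt_le b qp; suff : (q < rep b p (cnt b q).+1)%N by lia.
rewrite ltnNge; apply/negP => /cnt_homo-/(_ b); rewrite cnt_rep ?ltnn //.
exact: cnt_lt.
Qed.

Lemma iter_depth (q : 'I_p) : iter (depth q) (@ordS _) (first (seg q)) = q.
Proof.
apply: val_inj; rewrite /= iter_first ?depth_lt //= subnKC //.
exact: rep_cnt_le.
Qed.

Lemma break_depth (q : 'I_p) : b q = ((depth q).+1 == len (seg q)).
Proof. by rewrite bE -{1}(iter_depth q) break_iter // depth_lt. Qed.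

Lemma cntS_ordS (q : 'I_p) : (cnt b q + b q = cnt b (ordS q) + (q.+1 == p) * k)%N.
Proof. by rewrite -cntS (ordS_wrap q (cnt0 b) (erefl _)). Qed.
Lemma repS_ordS (i : 'I_k) :
  (rep b p i + len i = rep b p (ordS i) + (i.+1 == k) * p)%N.
Proof. by rewrite rep_len (ordS_wrap i (rep0 b p) (rep_full p0 bp)). Qed.
Lemma ordS_id l (i : 'I_l) : (i.+1 = ordS i + (i.+1 == l) * l)%N.
Proof. exact: (@ordS_wrap l i id). Qed.

Lemma depth_ordS (q : 'I_p) : depth (ordS q) = if b q then 0%N else (depth q).+1.
Proof.
have qp := ltn_ord q; case: ifP => bq; last first.
  have lt := nbreak_lt bp qp (negbT bq).
  rewrite /depth /= modn_small // cntS bq addn0 subSn //; exact: rep_cnt_le.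
rewrite /depth; have := cntS_ordS q; rewrite bq addn1.
case: eqP => [e _|ne]; first by rewrite /= e modnn.
rewrite mul0n addn0 => <-; rewrite rep_break //= modn_small ?subnn //.
by have := qp; lia.
Qed.

Lemma uprod_zero (i : 'I_k) t : uprod zero i t = (t == 0)%N%:R.
Proof. by case: t => [|t]; rewrite ?uprod0 // uprodS mulr0. Qed.

Lemma iter_mod l (i j : 'I_l) t w : (i + t = j + w * l)%N -> iter t (@ordS _) i = j.
Proof.
by move=> e; apply: val_inj; rewrite /= iter_ordS e addnC modnMDl modn_small.
Qed.

(** An empty step has weight 1, which [unz] corrects to [u q]; at a break both [u q] and the weight
    of the arrow are 0. One turn around Z/p meets all k breaks. *)
Lemma cov_seg_ok : cov_ok zero u cov_seg.
Proof.
split=> [q|q|q] /=.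
- exact: (@iter_mod _ (seg q) (seg (ordS q)) _ _ (cntS_ordS q)).
- by rewrite uprod_zero bE /unz; case: eqP => [->|]; rewrite ?mulr0 ?mulr1.
- rewrite /clen (sum_iter_ordS q (fun q => nat_of_bool (b q))) /cnt -sum1_count.
  rewrite -[X in iota 0 X]subn0 -/(index_iota 0 p) big_mkcond big_mkord.
  by apply: leq_sum => i _; case: (b i).
Qed.

Lemma uprod_last (i : 'I_k) : uprod u (first i) (len i) = 0.
Proof.
have := len_gt0 i; case lE: (len i) => [//|t] _; rewrite uprodS.
have /eqP -> : u (iter t (@ordS _) (first i)) == 0 by rewrite break_iter lE.
by rewrite mulr0.
Qed.

(** The last point of a segment is a zero of u, so crossing the segment has weight 0; the lengths of
    the segments telescope to p. *)
Lemma cov_first_ok : cov_ok u zero cov_first.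
Proof.
split=> [i|i|i] /=.
- exact: (@iter_mod _ (first i) (first (ordS i)) _ _ (repS_ordS i)).
- by rewrite uprod_last mulr0.
- rewrite /clen (sum_iter_ordS i (fun i : 'I_k => len i)).
  rewrite -(big_mkord xpredT len) telescope_sumn_in ?rep0 ?rep_full ?subn0 //.
  by move=> j jk; apply: rep_homo => //; case/andP: jk.
Qed.

Lemma ccoef_seg_neq0 q t : ccoef cov_seg q t != 0.
Proof. by apply/prodf_neq0 => j _; apply: unz_neq0. Qed.

Lemma ccoef_seg_uprod (i : 'I_k) t : (t < len i)%N ->
  ccoef cov_seg (first i) t = uprod u (first i) t.
Proof.
move=> tl; apply: eq_bigr => j _ /=; rewrite /unz break_iter ?(ltn_trans _ tl) //.
by rewrite ltn_eqF // (leq_ltn_trans _ tl).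
Qed.

Lemma ccoef_seg_len (i : 'I_k) :
  ccoef cov_seg (first i) (len i) = uprod u (first i) (len i).-1.
Proof.
have := len_gt0 i; case lE: (len i) => [//|t] _; rewrite ccoefS ccoef_seg_uprod ?lE //=.
by rewrite /unz break_iter ?lE // eqxx mulr1.
Qed.

(** No zero of u precedes q in its segment, so the climb of [depth q] steps is invertible. Points
    other than breaks fall under the first case of [comp_dn]; at a break [depth q] is the length
    minus one, and the coefficient of [cov_first] cancels the climb. *)
Lemma comp_first_seg : comp_ok u cov_first cov_seg (fun q : 'I_p => depth q)
  (fun q => (uprod u (first (seg q)) (depth q))^-1).
Proof.
split=> q /=.
- exact: iter_depth.
- by rewrite mulVf // -ccoef_seg_uprod ?ccoef_seg_neq0 // depth_lt.
- have := break_depth q; rewrite depth_ordS; case: (b q) => /=.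
    by rewrite clenS /clen big_ord0 => /esym/eqP.
  by rewrite /clen big_ord0 addn0.
- have := break_depth q; rewrite depth_ordS /unz -bE; case bq: (b q) => /= e.
    right; split=> //; rewrite mul1r ccoefS /ccoef big_ord0 mul1r /= -/(ccoef _ _ _).
    rewrite ccoef_seg_len -(eqP (esym e)) mulVf //.
    by rewrite -ccoef_seg_uprod ?ccoef_seg_neq0 // depth_lt.
  by left; rewrite /clen /ccoef !big_ord0 mulr1.
Qed.

Lemma clen_seg (i : 'I_k) t : (t <= len i)%N ->
  (cnt b (rep b p i) + clen cov_seg (first i) t = cnt b (rep b p i + t))%N.
Proof.
elim: t => [|t IH] tl; first by rewrite /clen big_ord0 !addn0.
by rewrite clenS addnA IH 1?ltnW // addnS cntS /= iter_first.
Qed.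

(** A segment has exactly one break, so the [len i] steps that replace an arrow contain one arrow
    and otherwise empty steps; no climb is left over, whence the constant 0. *)
Lemma comp_seg_first : comp_ok zero cov_seg cov_first (fun=> 0%N) (fun=> 1).
Proof.
split=> i /=.
- by rewrite seg_first.
- by rewrite uprod0 mulr1.
- have := clen_seg (leqnn (len i)); rewrite rep_len !cnt_rep //; last exact: ltnW.
  by lia.
- right; split=> //; rewrite uprod0 mulr1 mulVf //; exact: ccoef_seg_neq0.
Qed.
End Coverings.

(** * Correspondence of degrees *)

Lemma intr_pchar0 (K : fieldType) p (z : int) : p \in [pchar K] -> z%:~R = 0 :> K ->
  exists c : int, z = p%:Z * c.
Proof.
move=> charK; case: z => m; rewrite ?NegzE ?mulrNz => /eqP.
  rewrite -pmulrn -(dvdn_pcharf charK) => /dvdnP[c ->].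
  by exists c%:Z; rewrite PoszM mulrC.
rewrite oppr_eq0 -pmulrn -(dvdn_pcharf charK) => /dvdnP[c ->].
by exists (- c%:Z); rewrite PoszM mulrN mulrC.
Qed.

Section GradedCoverings.
Variables (K : fieldType) (b : pred nat) (p n : nat) (u : 'I_p -> K).
Hypotheses (p0 : (0 < p)%N) (bp : b p.-1) (bE : forall q : 'I_p, b q = (u q == 0)).
Hypotheses (charK : p \in [pchar K]) (co_pn : coprime p n) (kn : cnt b p = n).
Local Notation k := (cnt b p).

(** q + 1 is the eigenvalue of h at q. The segment s is a separate argument, so that the wrap-around
    can be computed on integers. *)
Definition gdeg (q s : nat) (m : int) : int := n%:Z * q.+1%:Z + p%:Z * (m - s%:Z).
Definition rel_first (i : 'I_k) (D m : int) : Prop := D = gdeg (rep b p i) i m.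
Definition rel_seg (q : 'I_p) (D m : int) : Prop := m = gdeg q (cnt b q) D.

Let pnz : p%:Z != 0. Proof. by apply: contraTneq p0 => -[->]. Qed.
Let n0 : n%:R != 0 :> K.
Proof.
rewrite -(dvdn_pcharf charK); apply/negP => pn; have := pcharf_prime charK.
by move/prime_gt1; move: co_pn; rewrite /coprime (gcdn_idPl pn) => /eqP ->.
Qed.

Lemma gdeg_inj q s : injective (gdeg q s).
Proof. by move=> m m' /addrI/(mulfI pnz)/addIr. Qed.

(** e steps up that cross f breaks and make w turns. The turns contribute - n p w through q and + p
    k w through s, which cancel because k = n. *)
Lemma gdeg_wrap q s q' s' w e f m : (q + e = q' + w * p)%N -> (s + f = s' + w * k)%N ->
  gdeg q s m + n%:Z *+ e = gdeg q' s' (m + f%:Z).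
Proof.
move=> h1 h2; rewrite /gdeg -mulr_natr natz !intS.
have -> : q%:Z = q'%:Z + w%:Z * p%:Z - e%:Z by rewrite -PoszM -PoszD -h1 PoszD addrK.
have -> : s%:Z = s'%:Z + w%:Z * n%:Z - f%:Z by rewrite -kn -PoszM -PoszD -h2 PoszD addrK.
by ring.
Qed.

Lemma gdeg_shift q s m i : gdeg q s (m + i) = gdeg q s m + p%:Z * i.
Proof. by rewrite /gdeg; ring. Qed.

Lemma gdeg_weight q s m : (gdeg q s m)%:~R / n%:R = q.+1%:R :> K.
Proof.
rewrite /gdeg rmorphD !rmorphM /= -!pmulrn (pcharf0 charK) mul0r addr0.
by rewrite mulrAC divff ?mul1r.
Qed.

Lemma gdeg_exists q s (D : int) : q.+1%:R = D%:~R / n%:R :> K -> exists m, D = gdeg q s m.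
Proof.
move=> qD; have [|c cE] := @intr_pchar0 K p (D - n%:Z * q.+1%:Z) charK.
  rewrite rmorphB rmorphM /= -!pmulrn qD mulrC divfK ?subrr //.
by exists (c + s%:Z); rewrite /gdeg addrK -cE addrC subrK.
Qed.

Lemma graded_first : graded_covering (cov_first u p0 bp) n%:Z 1 p%:Z 1
  (t_weight K n) (fun _ _ => True) rel_first.
Proof.
have wr (i : 'I_k) m : gdeg (rep b p i) i m + n%:Z *+ len b p i =
    gdeg (rep b p (ordS i)) (ordS i) (m + 1).
  exact: (gdeg_wrap m (repS_ordS p0 bp i) (etrans (addn1 _) (ordS_id i))).
split=> // [j D D' m -> ->|j D m m' ->|j D|j D m ->|j D m e|j D m i ->] //.
- exact: gdeg_inj.
- exact: gdeg_exists.
(* The rule for dn is the rule for up at m - 1, read backwards. *)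
- rewrite /rel_first; have := wr j (m - 1); rewrite subrK -e => <-.
  by rewrite addrK.
- by rewrite /rel_first mul1r gdeg_shift.
Qed.

Lemma graded_seg : graded_covering (cov_seg u p0 bp) 1 n%:Z 1 p%:Z
  (fun _ _ => True) (t_weight K n) rel_seg.
Proof.
have wr (q : 'I_p) m : gdeg q (cnt b q) m + n%:Z *+ 1 =
    gdeg (ordS q) (cnt b (ordS q)) (m + (b q : nat)%:Z).
  exact: (gdeg_wrap m (etrans (addn1 _) (ordS_id q)) (cntS_ordS b q)).
split=> // [j D D' m ->|j D m m' -> ->|j D _|j D m ->|j D m ->|j D m e|j D m i ->] //.
- exact: gdeg_inj.
- by exists (gdeg j (cnt b j) D).
- by rewrite /t_weight gdeg_weight.
- by rewrite /rel_seg /= -[n%:Z]mulr1n wr natz.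
- rewrite /rel_seg /= natz; have := wr j (D - (b j : nat)%:Z).
  by rewrite subrK -e mulr1n => <-; rewrite addrK.
- by rewrite /rel_seg mul1r gdeg_shift.
Qed.

(** Climbing from the first point of a segment to q crosses no break and makes no turn, so this is
    [gdeg_wrap] with f = w = 0. *)
Lemma rel_first_seg q D D' m : rel_first (cs (cov_seg u p0 bp) q) D D' ->
  rel_seg q D' m -> m = D + n%:Z *+ depth b p q.
Proof.
rewrite /rel_first /rel_seg /= => -> ->; rewrite -(addr0 D').
rewrite -[in LHS](@gdeg_wrap (rep b p (cnt b q)) (cnt b q) q (cnt b q) 0 (depth b p q) 0).
- by rewrite addr0.
- by rewrite mul0n addn0 subnKC // rep_cnt_le.
- by [].
Qed.

Lemma rel_seg_first i D D' m : rel_seg (cs (cov_first u p0 bp) i) D D' ->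
  rel_first i D' m -> m = D + 1 *+ 0.
Proof.
move=> e1 e2; have e : D' = gdeg (rep b p i) (cnt b (rep b p i)) D := e1.
rewrite (cnt_rep (ltnW (ltn_ord i))) e2 in e.
by rewrite (gdeg_inj e) addr0.
Qed.
End GradedCoverings.

(** * Counting the segments *)

(** Both sides count the distinct positive values of a nondecreasing T: the left by the values, the
    right by the strict jumps that first reach them. *)
Lemma count_values (T : nat -> nat) n : T 0%N = 0%N ->
  (forall i, (i < n)%N -> (T i <= T i.+1)%N) ->
  count (fun q => q.+1 \in [seq T i | i <- iota 1 n]) (iota 0 (T n)) =
  count (fun i => T i < T i.+1)%N (iota 0 n).
Proof.
move=> T0; elim: n => [|n IH] Th; first by rewrite T0.
have le := Th n (leqnn _).
have -> : iota 0 n.+1 = iota 0 n ++ [:: n] by rewrite -addn1 iotaD.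
have iota1 : iota 1 n.+1 = iota 1 n ++ [:: n.+1] by rewrite -{1}[n.+1]addn1 iotaD add1n.
rewrite iota1 [RHS]count_cat /= addn0 -IH => [|i lt]; last by apply/Th/ltnW.
rewrite -[X in iota 0 X](subnKC le) iotaD count_cat add0n; congr (_ + _)%N.
  apply: eq_in_count => q; rewrite mem_iota add0n => /= qT.
  rewrite map_cat mem_cat /= inE; case: eqP => [e|]; last by rewrite orbF.
  (* Here q < T n <= T (n + 1) = q + 1, so the value already occurs as T n, and n > 0 because T 0 =
     0. *)
  case: n {IH iota1} Th le qT e => [|n] Th le qT e; first by rewrite T0 in qT.
  rewrite orbT; apply/esym/mapP; exists n.+1; first by rewrite mem_iota; lia.
  by lia.
(* By monotonicity all earlier values are at most T n, so only T (n + 1) can equal q + 1. *)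
have memS q : (T n <= q)%N ->
    (q.+1 \in [seq T i | i <- iota 1 n ++ [:: n.+1]]) = (q.+1 == T n.+1).
  rewrite -iota1; move=> Tq; apply/mapP/eqP => [[i]|->]; last first.
    by exists n.+1; rewrite // mem_iota; lia.
  rewrite mem_iota => /andP[i1 i2] e; suff -> : n.+1 = i by [].
  apply/eqP; rewrite eqn_leq; apply/andP; split; last by lia.
  rewrite ltnNge; apply/negP => ilt.
  have mono j : (i <= j)%N -> (j <= n)%N -> (T i <= T j)%N.
    elim: j => [|j IHj]; first by rewrite leqn0 => /eqP ->.
    rewrite leq_eqVlt => /orP[/eqP -> //|ij jn].
    by apply: leq_trans (IHj ij (ltnW jn)) (Th _ _); lia.
  by have := mono n ilt (leqnn n); lia.
rewrite (@eq_in_count _ _ (fun q => q.+1 == T n.+1)); last first.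
  by move=> q; rewrite mem_iota => /andP[/memS -> _].
case: (ltnP (T n) (T n.+1)) => lt; last first.
  by have -> : (T n.+1 - T n = 0)%N by lia.
have -> : (T n.+1 - T n = (T n.+1 - T n).-1 + 1)%N by lia.
rewrite iotaD count_cat /= addn0.
have -> : (T n + (T n.+1 - T n).-1).+1 == T n.+1 by apply/eqP; lia.
rewrite (@eq_in_count _ _ pred0) ?count_pred0 // => q; rewrite mem_iota => h.
by apply/negbTE/eqP; move: h; lia.
Qed.

Section RootBreaks.
Variables (K : fieldType) (p n : nat) (r : nat -> nat).
Hypotheses (charK : p \in [pchar K]) (n_ge1 : (1 <= n)%N).
Hypothesis r_le : (\sum_(1 <= i < n) r i <= p)%N.

Let p0 : (0 < p)%N := prime_gt0 (pcharf_prime charK).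

Definition root_break (q : nat) : bool := (v_poly n r K).[q.+1%:R] == 0.

Definition psum (i : nat) : nat := (\sum_(1 <= j < i.+1) r j)%N.

(* The gap r_0 comes last here, so that [level n] is p. *)
Definition level (i : nat) : nat := if (i < n)%N then psum i else p.

Lemma psum0 : psum 0 = 0%N. Proof. by rewrite /psum big_geq. Qed.
Lemma psumS i : psum i.+1 = (psum i + r i.+1)%N.
Proof. by rewrite /psum big_nat_recr. Qed.
Lemma psum_homo : {homo psum : i j / (i <= j)%N}.
Proof.
move=> i j /subnK <-; elim: (j - i)%N => // t IH.
by rewrite addSn psumS (leq_trans IH) ?leq_addr.
Qed.
Lemma psum_le i : (i < n)%N -> (psum i <= p)%N.
Proof.
move=> lt; apply: leq_trans r_le; rewrite -[n in leqRHS](prednK n_ge1).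
by apply: psum_homo; lia.
Qed.

Lemma root_breakP q : reflect (exists2 i, (i < n)%N & q.+1%:R = (psum i)%:R :> K)
  (root_break q).
Proof.
rewrite /root_break /v_poly horner_prod prodf_seq_eq0.
apply: (iffP hasP) => [[i _]|[i lt e]].
  rewrite hornerXsubC subr_eq0 -natr_sum => /eqP e.
  by exists i.
exists (Ordinal lt); first exact: mem_index_enum.
by rewrite hornerXsubC subr_eq0 -natr_sum; apply/eqP.
Qed.

(** Between 1 and p, equality in K is equality of integers. A partial sum equal to 0 is the residue
    of p instead, that is, the value of [level n]. *)
Lemma root_break_level q : (q < p)%N ->
  root_break q = (q.+1 \in [seq level i | i <- iota 1 n]).
Proof.
move=> qp; apply/root_breakP/mapP => [[i lt e]|[i]].
  case: (posnP (psum i)) => [s0|s0].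
    exists n; first by rewrite mem_iota; lia.
    rewrite /level ltnn; move/eqP: e; rewrite s0 -(dvdn_pcharf charK) => /dvdn_leq h.
    by apply/eqP; rewrite eqn_leq qp h.
  have e' : q.+1 = psum i by apply: (natr_pchar_inj charK) => //; apply: psum_le.
  exists i; last by rewrite /level lt.
  by rewrite mem_iota; case: i s0 {e e'} lt => [|i]; rewrite ?psum0 //; lia.
rewrite mem_iota /level => /andP[i1 i2]; case: ifP => [lt ->|_ ->]; first by exists i.
by exists 0%N; rewrite // psum0 (pcharf0 charK).
Qed.

Lemma root_break_last : root_break p.-1.
Proof.
apply/root_breakP; exists 0%N => //.
by rewrite prednK // psum0 (pcharf0 charK).
Qed.

(** The jumps of [level] are r_1, ..., r_(n-1) and, at the last index, p minus their sum, which is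
    r_0; so nonzero gaps are strict jumps. *)
Lemma cnt_root_break : cnt root_break p = num_nonzero_gaps p n r.
Proof.
have -> : cnt root_break p =
    count (fun q => q.+1 \in [seq level i | i <- iota 1 n]) (iota 0 (level n)).
  rewrite /level ltnn; apply: eq_in_count => q; rewrite mem_iota => h.
  by apply: root_break_level; case/andP: h.
rewrite count_values => [||i lt]; last first.
- rewrite /level lt; case: ifP => [_|_]; last exact: psum_le.
  exact: psum_homo.
- by rewrite /level n_ge1 psum0.
rewrite /num_nonzero_gaps -(prednK n_ge1) -[in LHS]addn1 iotaD count_cat add0n addnC.
rewrite [RHS]/= -addn1 [X in (X + _)%N]/= addn0; congr (_ + _)%N.
  rewrite /level prednK // ltnn leqnn /gap /= -lt0n subn_gt0.
  by rewrite /psum prednK.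
rewrite (iotaDl 1 0) count_map; apply: eq_in_count => i; rewrite mem_iota => /andP[_ lt] /=.
have lt1 : (i.+1 < n)%N by lia.
by rewrite /level lt1 (ltnW lt1) psumS -[X in (X < _)%N]addn0 ltn_add2l lt0n.
Qed.
End RootBreaks.

Theorem proposition6p12 (p n : nat) (K : closedFieldType) (r : nat -> nat)
    (charK : p \in [pchar K]) (n_ge1 : (1 <= n)%N) (co_pn : coprime p n)
    (r_le : (\sum_(1 <= i < n) r i <= p)%N) :
  let v : {poly K} := v_poly n r K in
  let k : nat := num_nonzero_gaps p n r in
  morita_equivalent (t_alg v p) (nocycle_alg K k) /\
  (k = n ->
   exists F : functor (t_grmod v charK) (nocycle_grmod K n), zequivalence F).
Proof.
move=> v k; have p0 := prime_gt0 (pcharf_prime charK).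
have kE : cnt (root_break K n r) p = k := cnt_root_break charK n_ge1 r_le.
have bp := root_break_last r charK n_ge1.
have bE (q : 'I_p) : root_break K n r q = (t_wt v q == 0) by [].
have [C C_gens] := t_cyc v charK; rewrite -kE.
have [C' C'_gens] := nocycle_cyc K (cnt (root_break K n r) p).
have ok1 := cov_first_ok p0 bp bE; have ok2 := cov_seg_ok p0 bp bE.
have c12 := comp_first_seg p0 bp bE; have c21 := comp_seg_first (@t_wt K p v) p0 bp.
split=> [|kn]; first exact: (cyc_morita C C' ok1 ok2 c12 c21).
(* Graded t(v)-modules are defined with the degree of v, read off here from its n linear factors. *)
have size_v : (size v).-1 = n.
  rewrite /v /v_poly -(big_mkord xpredT (fun i => 'X - (\sum_(1 <= j < i.+1) (r j)%:R)%:P)).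
  by rewrite size_prod_XsubC size_iota subn0.
have kn' : cnt (root_break K n r) p = (size v).-1 by rewrite size_v.
have co_pn' : coprime p (size v).-1 by rewrite size_v.
(* The coverings use [cnt] vertices, so k = n is rewritten only here, in the type of the target
   category. *)
suff : exists F : functor (t_grmod v charK) (nocycle_grmod K (cnt (root_break K n r) p)),
    zequivalence F by rewrite [X in nocycle_grmod K X]kn.
exact: (cyc_zequivalence (t_action_shift charK) (@nocycle_action_shift K _) ok1 ok2 c12 c21
  (graded_first (@t_wt K p v) p0 bp charK co_pn' kn')
  (graded_seg (@t_wt K p v) p0 bp charK co_pn' kn')
  (@rel_first_seg _ _ _ _ (@t_wt K p v) p0 bp kn')
  (@rel_seg_first _ _ _ _ (@t_wt K p v) p0 bp)
  (t_graded charK C_gens) (nocycle_graded C'_gens)).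
Qed.
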